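(* Let $S$ be a connected compact closed surface (not necessarily orientable) and $\mathcal{M}$ a map on $S$ with vertex set $V$, covertex set $V^*$, edge set $E$ and coedge set $E^*$. Let $H=H_1(S\setminus(V\cup V^* );\mathbb{F}_2)$. Then the image $\iota(H)$ of $H$ under $c\mapsto\iota(c)$ is a totally isotropic subspace of the symplectic space $\mathbb{F}_2^E\oplus\mathbb{F}_2^{E^*}$.
   Context: A map $\mathcal{M}=(G,S)$ is a finite graph $G$ (nonempty edge set) embedded in $S$ such that every component of $S\setminus G$ is an open 2-cell (a face). The dual map has one covertex in each face (set $V^*$) and for each edge $e$ a coedge $e^*$ meeting $e$ in exactly one point and disjoint from all other edges. For $c\in H$ and $e\in E\cup E^*$, $(c,e)\in\mathbb{F}_2$ is the mod 2 intersection index of $c$ with $e$. $\mathbb{F}_2^E\oplus\mathbb{F}_2^{E^*}$ is the $\mathbb{F}_2$-vector space with basis $E\cup E^*$ and bilinear form $\langle e,e^*\rangle=\langle e^*,e\rangle=1$ for $e\in E$, $\langle f,g\rangle=0$ for basis elements with $g\neq f^*$ (this form is symmetric and alternating, i.e. symplectic). The incidence vector is $\iota(c)=\sum_{e\in E\cup E^*}(c,e)\,e$. *)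

(* Defs.v *)
From HB Require Import structures.
From mathcomp Require Import all_boot all_order all_algebra finmap.
From mathcomp Require Import all_classical all_reals topology normedtype.

Set Implicit Arguments.
Unset Strict Implicit.
Unset Printing Implicit Defensive.

Import Order.TTheory GRing.Theory Num.Theory.
Import numFieldNormedType.Exports.

Local Open Scope classical_set_scope.
Local Open Scope ring_scope.

Definition simplex (R : realType) (n : nat) : set 'rV[R]_n.+1 :=
  [set x | (forall i, 0 <= x ord0 i) /\ \sum_i x ord0 i = 1].
Arguments simplex : clear implicits.

Definition coface_mx (R : realType) (n : nat) (i : 'I_n.+2)
    (x : 'rV[R]_n.+1) : 'rV[R]_n.+2 :=
  \row_j oapp (x ord0) 0 (unlift i j).

Lemma coface_subproof (R : realType) (n : nat) (i : 'I_n.+2)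
    (x : simplex R n) : coface_mx i (set_val x) \in simplex R n.+1.
Proof.
have [x0 x1] := set_valP x; apply/mem_set; split.
  by move=> j; rewrite mxE; case: (unlift i j) => //= k; exact: x0.
rewrite (bigD1_ord i)//= mxE unlift_none add0r -[RHS]x1.
by apply: eq_bigr => k _; rewrite mxE liftK.
Qed.

Definition coface (R : realType) (n : nat) (i : 'I_n.+2) (x : simplex R n) :
  simplex R n.+1 := SigSub (coface_subproof i x).

Lemma coface_continuous (R : realType) (n : nat) (i : 'I_n.+2) :
  continuous (@coface R n i).
Proof.
apply: continuous_comp_initial => x.
apply: (@continuous_comp _ _ _ (set_val : simplex R n -> _) (coface_mx i)).
  exact: initial_continuous.
move=> A [B Bn BA].
exists (fun _ k => B ord0 (lift i k)) => [j k|y yB].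
  by rewrite (ord1 j); have := Bn ord0 (lift i k); rewrite mxE liftK.
apply: BA => j k; rewrite (ord1 j); have := Bn ord0 k; rewrite !mxE.
by case: unliftP => /= [l -> _|_ /nbhs_singleton//]; exact: yB.
Qed.

Definition singular (R : realType) (n : nat) (T : topologicalType) :=
  continuousType (simplex R n) T.

Definition sing_face (R : realType) (n : nat) (T : topologicalType)
    (i : 'I_n.+2) (s : singular R n.+1 T) : singular R n T :=
  s \o mkcts (@coface_continuous R n i).

Definition chain (R : realType) (n : nat) (T : topologicalType) :
    set (singular R n T -> 'F_2) :=
  [set c | finite_set [set s | c s != 0]].

(* No signs: the coefficients have characteristic 2. *)
Definition boundary (R : realType) (n : nat) (T : topologicalType)
    (c : singular R n.+1 T -> 'F_2) (t : singular R n T) : 'F_2 :=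
  \sum_(s \in [set: singular R n.+1 T])
    c s * \sum_(i < n.+2) (sing_face i s == t)%:R.

Definition cycle1 (R : realType) (T : topologicalType) :
    set (singular R 1 T -> 'F_2) :=
  [set z | chain z /\ boundary z = 0].

Definition homologous1 (R : realType) (T : topologicalType)
    (z z' : singular R 1 T -> 'F_2) :=
  exists2 b : singular R 2 T -> 'F_2, chain b & z' - z = boundary b.

(* H_1(T; F_2), as the set of cosets of 1-boundaries in the 1-cycles. *)
Definition H1 (R : realType) (T : topologicalType) :
    set (set (singular R 1 T -> 'F_2)) :=
  [set [set z' | cycle1 z' /\ homologous1 z z'] | z in @cycle1 R T].
Arguments H1 : clear implicits.

(* U is open and h restricts to a homeomorphism of U onto the plane. *)
Definition plane_chart (R : realType) (S : topologicalType)
    (U : set S) (h : S -> R * R) :=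
  [/\ open U, {within U, continuous h} &
      exists k : R * R -> S, [/\ continuous k,
        forall x, U x -> k (h x) = x & forall p, U (k p) /\ h (k p) = p]].

Definition open_2cell (R : realType) (S : topologicalType) (U : set S) :=
  exists h : S -> R * R, plane_chart U h.

Definition closed_surface (R : realType) (S : topologicalType) :=
  [/\ hausdorff_space S, compact [set: S] &
      forall x : S, exists2 U : set S, open_2cell R U & U x].

(* The drawing of a graph in S: its vertices, and for each edge a
   parametrization, of which only the restriction to [0, 1] matters.
   Loops and multiple edges are allowed. *)
Record drawing (R : realType) (S : topologicalType) (E : finType) := Drawing {
  vertices : set S ;
  edge_path : E -> R -> S }.

Section Maps.
Context {R : realType} {S : topologicalType} {E : finType}.
Implicit Types G M : drawing R S E.

Definition edge G (e : E) : set S := edge_path G e @` `[0, 1].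
Definition open_edge G (e : E) : set S := edge_path G e @` `]0, 1[.

Definition points G : set S := vertices G `|` \bigcup_e edge G e.

(* In the chart h on U, the set A is the first coordinate axis. *)
Definition straightens (U : set S) (h : S -> R * R) (A : set S) :=
  plane_chart U h /\ forall y, U y -> (A y <-> (h y).2 = 0).

(* The last clause is tameness of the edges, without which crossings with an
   edge would not be defined; in dimension 2 it follows from the other clauses
   by the Schoenflies theorem. *)
Definition embedded_graph G :=
  [/\ finite_set (vertices G),
      forall e, {within `[0, 1], continuous (edge_path G e)},
      forall e, vertices G (edge_path G e 0) /\ vertices G (edge_path G e 1),
      forall e t, t \in `]0, 1[ -> ~ vertices G (edge_path G e t) &
      (forall e e' t t', t \in `]0, 1[ -> t' \in `]0, 1[ ->
        edge_path G e t = edge_path G e' t' -> e = e' /\ t = t') /\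
      (forall e y, open_edge G e y -> exists (U : set S) (h : S -> R * R),
        straightens U h (open_edge G e) /\ U y)].

Definition face G (F : set S) :=
  exists2 x, ~ points G x & F = connected_component (~` points G) x.

Definition is_map M :=
  [/\ embedded_graph M, (0 < #|E|)%N &
      forall F, face M F -> open_2cell R F].

(* A and B cross at y: some chart around y carries A and B to the two axes. *)
Definition cross_at (A B : set S) (y : S) :=
  exists (U : set S) (h : S -> R * R),
    [/\ straightens U h A, U y & forall x, U x -> (B x <-> (h x).1 = 0)].

(* The coedge e^* is edge_path M' e. *)
Definition dual_map M M' :=
  [/\ is_map M',
      vertices M' `<=` ~` points M,
      forall F, face M F -> exists! v, vertices M' v /\ F v,
      forall e, exists2 y, edge M e `&` edge M' e = [set y] &
                           cross_at (open_edge M e) (open_edge M' e) y &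
      forall e e', e != e' -> edge M e `&` edge M' e' = set0].

End Maps.

Section Intersection.
Context {R : realType} {S : topologicalType}.
Variable X : set S.

Definition sing_time (x : simplex R 1) : R := set_val x ord0 ord_max.

Definition hits (s : singular R 1 X) (A : set S) : set (simplex R 1) :=
  [set x | A (set_val (s x))].

(* At the interior time x the path s passes from one local side of A to the
   other one. *)
Definition transverse_at (s : singular R 1 X) (A : set S) (x : simplex R 1) :=
  0 < sing_time x < 1 /\
  exists (U : set S) (h : S -> R * R),
    [/\ straightens U h A, U (set_val (s x)) &
      (\forall y \near x, y <> x ->
         0 < (sing_time y - sing_time x) * (h (set_val (s y))).2) \/
      (\forall y \near x, y <> x ->
         (sing_time y - sing_time x) * (h (set_val (s y))).2 < 0)].

Definition transverse (z : singular R 1 X -> 'F_2) (A : set S) :=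
  forall s, z s != 0 ->
    finite_set (hits s A) /\ forall x, hits s A x -> transverse_at s A x.

Definition crossings (z : singular R 1 X -> 'F_2) (A : set S) : 'F_2 :=
  \sum_(s \in [set: singular R 1 X])
    z s * (#|` fset_set (hits s A)|%fset)%:R.

(* The mod 2 intersection index of the homology class c with A: the number
   mod 2 of crossings of A with any cycle of c that is transverse to A. *)
Definition inter_index (c : set (singular R 1 X -> 'F_2)) (A : set S) : 'F_2 :=
  xget 0 [set crossings z A | z in [set z | c z /\ transverse z A]].

End Intersection.

(* The basis E \cup E^* is E + E: inl e is e and inr e is e^*. *)
Definition sspace (E : finType) := {ffun E + E -> ('F_2)^o}.

Definition star (E : finType) (f : E + E) : E + E :=
  match f with inl e => inr e | inr e => inl e end.

Definition sform (E : finType) (u v : sspace E) : 'F_2 :=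
  \sum_f \sum_g u f * v g * (g == star f)%:R.

Definition totally_isotropic (E : finType) (W : {vspace sspace E}) :=
  forall u v, u \in W -> v \in W -> sform u v = 0.

Definition punctured (R : realType) (S : topologicalType) (E : finType)
    (M M' : drawing R S E) : set S := ~` (vertices M `|` vertices M').

Definition curve_of (R : realType) (S : topologicalType) (E : finType)
    (M M' : drawing R S E) (f : E + E) : set S :=
  match f with inl e => open_edge M e | inr e => open_edge M' e end.

Definition incidence (R : realType) (S : topologicalType) (E : finType)
    (M M' : drawing R S E)
    (c : set (singular R 1 (punctured M M') -> 'F_2)) : sspace E :=
  [ffun f => inter_index c (curve_of M M' f)].

(* Main.v *)
Require Import Defs.
From HB Require Import structures.
From mathcomp Require Import all_boot all_order all_algebra finmap.
From mathcomp Require Import all_classical all_reals topology normedtype.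
From mathcomp Require Import ring lra.

(* A bool-valued D x z, germ in z near x, that is locally of the form f z + f x is a
   1-cocycle; its integrals along singular paths give periods that depend only on mod 2
   homology classes. A properly embedded tame curve gives such a D (which side of the
   curve z lies on), and its period on a transverse cycle is the number of crossings, so
   (c, e) and (c, e* ) are periods. An edge e and its coedge e* cross at a point y_e and
   cut out four corners there. The L-shaped curve made of the half of e and the half of
   e* that bound a corner k has a period d_k(c), and
   (c, e)(c', e* ) + (c, e* )(c', e) = sum of d_k(c) d_k(c') over the four corners of e.
   A locally constant f on the complement of all edges and coedges gives the linear
   relation: sum of f(k) d_k(c) over all corners k is 0.
   In a face F, homeomorphic to the plane, the half coedges are rays from the covertex v*
   to infinity. H^1(F - v* ) is F_2, and a ray gives its nonzero class since it does not
   separate F - v*; so two rays in F together bound a colouring, but one alone does not.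
   Consequently a component of the complement contains at most two corners, on which the
   d_k agree by the linear relations, and the total sum of d_k(c) d_k(c') is even. *)
Set Implicit Arguments.
Unset Strict Implicit.
Unset Printing Implicit Defensive.

Import Order.TTheory GRing.Theory Num.Theory.
Import numFieldNormedType.Exports.

Local Open Scope classical_set_scope.
Local Open Scope ring_scope.

(** * Locally exact germs and the Poincare lemma *)

(** The index of a class is chosen by [xget] among the crossing numbers of its transverse cycles,
    with default 0. It is meaningful only once each class has a transverse cycle and all of these
    give the same number; the identification with periods settles the second point and makes the
    index additive. Germs are used instead of singular cochains because they are read off from local
    sides of a curve and their primitives can be continued along segments by connectedness, without
    subdivision. Of the components of the complement only their locally constant functions are used.
    These are closed under Boolean operations, and multiplication is what bounds the number of
    corners: two colourings with two jumps each can multiply to one with a single jump. The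
    definition of a dual map does not by itself forbid a coedge to pass through a vertex that lies
    on no edge. Such vertices are excluded beforehand: the face around one, with the vertex added,
    would be open and compact, hence all of the connected S, whereas M has an edge. *)

Lemma segment_chain (R : realType) (r : R -> R -> Prop) (a b : R) :
  (forall s t u, r s t -> r t u -> r s u) ->
  (forall t, a <= t <= b ->
     \forall u \near t, a <= u <= b -> r t u /\ r u t) ->
  a <= b -> r a b.
Proof.
move=> rtr rloc ab.
pose B := [set` `[a, b]] `&` [set t | r a t].
have aab : a <= a <= b by rewrite lexx.
suff BE : B = [set` `[a, b]].
  by have : B b; [rewrite BE/= in_itv/= ab lexx | case].
(* Connectedness replaces a subdivision of the segment: [r t u] for u near t makes B open, [r u t]
   makes it closed. *)
apply: (@segment_connected R a b).
- by exists a; split; [rewrite /= in_itv/= aab|have [] := nbhs_singleton (rloc _ aab) aab].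
- exists [set t | \forall u \near t, a <= u <= b -> r a u].
    rewrite openE => t /= Ht; exact: (near_join Ht).
  apply/seteqP; split => t [] /=; rewrite in_itv/= => tab Ht; split=> //=.
    apply: filterS (rloc _ tab) => u Hu uab; have [Htu _] := Hu uab.
    exact: rtr Htu.
  by have := nbhs_singleton Ht; exact.
- exists (~` [set t | \forall u \near t, a <= u <= b -> ~ r a u]).
    apply: open_closedC; rewrite openE => t /= Ht; exact: (near_join Ht).
  apply/seteqP; split => t [] /=; rewrite in_itv/= => tab Ht; split=> //=.
    by move=> /nbhs_singleton; exact.
  apply: contrapT => nr; apply: Ht.
  apply: filterS (rloc _ tab) => u Hu uab au; have [_ Hut] := Hu uab.
  by apply: nr; exact: rtr Hut.
Qed.

Lemma segment_const (R : realType) (f : R -> bool) (a b : R) :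
  (forall t, a <= t <= b -> \forall u \near t, a <= u <= b -> f u = f t) ->
  a <= b -> f a = f b.
Proof.
move=> floc; apply: (@segment_chain R (fun s t => f s = f t)).
  by move=> s t u -> .
by move=> t /floc; apply: filterS => u H /H ->.
Qed.

Definition locally_const (T : topologicalType) (f : T -> bool) (x : T) :=
  \forall z \near x, f z = f x.

Section Germs.
Variable T : topologicalType.
Implicit Types (D : T -> T -> bool) (f F : T -> bool) (c : T -> T -> bool).
Implicit Types (X Y : set T) (x y z : T).

(** This concerns the germ at the single base point x; [exact_at] asks for one f that serves all
    base points near x, which is the cocycle condition. *)
Definition prim D f x := \forall z \near x, D x z = f z (+) f x.

Definition exact_at D x := exists f, \forall y \near x, prim D f y.

(** The complement of Y is dense at x, so a constant difference of two colourings can be read off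
    outside Y. *)
Definition thin Y x := forall U, nbhs x U -> exists2 z, U z & ~ Y z.

(** Gluing data: [c x] colours a neighbourhood of x outside Y, and colourings based at nearby points
    differ by constants. *)
Definition atlas Y X c := forall x, X x ->
  \forall y \near x, exists k, \forall z \near y, ~ Y z -> c y z = c x z (+) k.

(** The colourings [c x] are meaningful outside Y only; the primitive F may take any values on Y
    that fit D. *)
Definition rep D Y X c := forall x, X x -> exists2 F,
  (\forall y \near x, prim D F y) &
  (\forall z \near x, ~ Y z -> F z = c x z).

Lemma rep_exact D Y X c x : rep D Y X c -> X x -> exact_at D x.
Proof. by move=> rD /rD[F DF _]; exists F. Qed.

Lemma prim_diff D f g x : prim D f x -> prim D g x ->
  \forall z \near x, f z (+) g z = f x (+) g x.
Proof.
apply: filterS2 => z Hf Hg; move: Hg; rewrite Hf.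
by case: (f z); case: (f x); case: (g z); case: (g x).
Qed.

Lemma prim_near D f g x k : prim D f x -> (\forall z \near x, g z = f z (+) k) ->
  prim D g x.
Proof.
move=> Df gf; have gx := nbhs_singleton gf.
apply: filterS2 Df gf => z -> ->; rewrite gx.
by rewrite addbACA addbb addbF.
Qed.

Lemma prim_diag D f x : prim D f x -> D x x = false.
Proof. by move/nbhs_singleton; rewrite addbb. Qed.

Lemma rep_mono D Y Y' X X' c : Y `<=` Y' -> X' `<=` X ->
  rep D Y X c -> rep D Y' X' c.
Proof.
move=> YY XX rD x /XX/rD[F DF Fc]; exists F => //.
by apply: filterS Fc => z H nY'; apply: H => /YY.
Qed.

Lemma repD D D' Y X c c' : rep D Y X c -> rep D' Y X c' ->
  rep (fun x z => D x z (+) D' x z) Y X (fun x z => c x z (+) c' x z).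
Proof.
move=> rD rD' x Xx; have [F DF Fc] := rD x Xx; have [F' DF' Fc'] := rD' x Xx.
exists (fun z => F z (+) F' z).
  apply: filterS2 DF DF' => y; apply: filterS2 => z -> ->.
  by rewrite addbACA.
by apply: filterS2 Fc Fc' => z H H' nY; rewrite H// H'.
Qed.

(** Each local colouring must be extended across Y in such a way that the extensions still differ by
    constants. The value at z comes from the colouring based at z itself, shifted by the constant
    that relates it to [c x]. *)
Lemma atlas_rep Y X c : (forall x, X x -> \forall y \near x, thin Y y) ->
  atlas Y X c -> exists D, rep D Y X c.
Proof.
move=> tY ac.
(* The constant between [c z] and [c x] near z; it is well defined where Y is thin. *)
pose k z x := `[< \forall w \near z, ~ Y w -> c x w = ~~ c z w >].
have kP z x kk : thin Y z -> (\forall w \near z, ~ Y w -> c z w = c x w (+) kk) ->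
    k z x = kk.
  move=> tz ck; apply/asboolP/idP.
    move=> H; have : nbhs z [set w | ~ Y w -> c x w = ~~ c z w /\ c z w = c x w (+) kk].
      by apply: filterS2 ck H => w /[swap] H1 H2 nY; rewrite -H2// -H1.
    move=> /tz[w /= H' nYw]; have [] := H' nYw.
    by move=> ->; case: (c z w); case: (kk).
  move=> kkt; apply: filterS ck => w H nY; rewrite H// kkt.
  by case: (c x w).
(* At z outside Y this equals [c x z]. *)
pose F x z := k z x (+) c z z.
exists (fun y z => F y z (+) F y y) => x Xx; exists (F x).
  near=> y.
  have ty : \forall z \near y, thin Y z.
    by near: y; apply: near_join; exact: tY.
  have : \forall z \near y, exists k0, \forall w \near z, ~ Y w -> c z w = c x w (+) k0.
    by near: y; apply: near_join; exact: ac.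
  have [k0 ck0] : exists k0, \forall z \near y, ~ Y z -> c y z = c x z (+) k0.
    by near: y; exact: ac.
  move=> cz.
  have tyy := nbhs_singleton ty.
  have kzy : \forall z \near y, k z y = k z x (+) k0.
    apply: filterS3 ty cz (near_join ck0) => z tz [k1 ck1] ck2.
    rewrite (kP z x k1)// (kP z y (k1 (+) k0))//.
    apply: filterS2 ck1 ck2 => w H1 H2 nY; rewrite H1// H2//.
    by rewrite -!addbA (addbC k0) addbK.
  have := nbhs_singleton kzy => kyy.
  apply: filterS kzy => z kzz; rewrite /F kyy kzz.
  by case: (k z x); case: (k y x); case: (k0); case: (c z z); case: (c y y).
have cx := ac x Xx.
apply: filterS2 (tY _ Xx) cx => z tz [k0 ck0] nYz.
by rewrite /F (kP _ _ k0)// (nbhs_singleton ck0 nYz) (addbC _ k0) addbA addbb.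
Unshelve. all: by end_near.
Qed.

(** Outside Y, f fixes the constant by which each local primitive has to be shifted; thinness makes
    the shifted primitives agree near every point, up to a constant. *)
Lemma rep_primitive D Y X c f : (forall x, X x -> \forall y \near x, thin Y y) ->
  open X -> rep D Y X c ->
  (forall x, X x -> exists k, \forall z \near x, ~ Y z -> f z = c x z (+) k) ->
  exists2 g, (forall x, X x -> prim D g x) &
             (forall x, X x -> ~ Y x -> g x = f x).
Proof.
move=> tY oX rD fc.
have /choice[F DF] : forall x, exists F : T -> bool, X x ->
    (\forall y \near x, prim D F y) /\ \forall z \near x, ~ Y z -> F z = c x z.
  move=> x; case: (pselect (X x)) => [/rD[F]|nX]; last by exists (fun=> false).
  by exists F.
have /choice[k fk] : forall x, exists k, X x ->
    \forall z \near x, ~ Y z -> f z = F x z (+) k.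
  move=> x.
  case: (pselect (X x)) => [Xx|nX]; last by exists false.
  have [k0 fk0] := fc _ Xx; exists k0 => _; have [_ FX] := DF _ Xx.
  by apply: filterS2 fk0 FX => z H H' nY; rewrite H// H'.
exists (fun x => F x x (+) k x) => [x Xx|x Xx nY]; last first.
  by rewrite (nbhs_singleton (fk _ Xx)).
have [DFx _] := DF _ Xx.
apply: (prim_near (f := F x) (k := k x)); first exact: nbhs_singleton DFx.
have Xn : nbhs x X by exact: open_nbhs_nbhs.
near=> y.
have Xy : X y by near: y.
have [DFy _] := DF _ Xy.
have ty : thin Y y by near: y; exact: tY.
have DxFy : prim D (F x) y by near: y.
have dF := prim_diff (nbhs_singleton DFy) DxFy.
have fy := fk _ Xy.
have fx : \forall z \near y, ~ Y z -> f z = F x z (+) k x.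
  by near: y; apply: near_join; exact: fk.
have : nbhs y [set z | ~ Y z -> F y z (+) k y = F x z (+) k x /\ F y z (+) F x z = F y y (+) F x y].
  by apply: filterS3 dF fy fx => z H0 H1 H2 nY; rewrite H0 -H1// -H2.
move=> /ty[z /= H nY]; have [H1 H2] := H nY; move: H1 H2.
by case: (F y z); case: (F x z); case: (F y y); case: (F x y); case: (k x); case: (k y).
Unshelve. all: by end_near.
Qed.

Lemma prim_rep D Y X c g x : rep D Y X c -> X x -> prim D g x ->
  exists k, \forall z \near x, ~ Y z -> g z = c x z (+) k.
Proof.
move=> rD Xx Dg; have [F DF Fc] := rD _ Xx.
exists (F x (+) g x); have := prim_diff (nbhs_singleton DF) Dg.
apply: filterS2 Fc => z H H' nY; rewrite -H//; move: H'.
by case: (F z); case: (g z); case: (F x); case: (g x).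
Qed.

End Germs.

Section Pullback.
Variables (T T' : topologicalType) (phi : T' -> T).
Hypothesis cphi : continuous phi.

Lemma near_preimage (x : T') (P : T -> Prop) :
  (\forall z \near phi x, P z) -> \forall z \near x, P (phi z).
Proof. by move=> H; exact: cphi H. Qed.

Lemma prim_pull D f x : prim D f (phi x) ->
  prim (fun x z => D (phi x) (phi z)) (f \o phi) x.
Proof. by move=> H; exact: near_preimage H. Qed.

Lemma exact_pull D x : exact_at D (phi x) ->
  exact_at (fun x z => D (phi x) (phi z)) x.
Proof.
move=> [f Df]; exists (f \o phi).
by apply: filterS (near_preimage Df) => y; exact: prim_pull.
Qed.

Lemma rep_pull D Y X c : rep D Y X c ->
  rep (fun x z => D (phi x) (phi z)) (phi @^-1` Y) (phi @^-1` X)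
      (fun x z => c (phi x) (phi z)).
Proof.
move=> rD x /= /rD[F DF Fc]; exists (F \o phi); last exact: (near_preimage Fc).
by apply: filterS (near_preimage DF) => y; exact: prim_pull.
Qed.

End Pullback.

Lemma pairl_continuous (T U : topologicalType) (x : T) :
  continuous (fun u : U => (x, u)).
Proof.
move=> u A [[N J] [/= nN nJ] NJ]; apply: filterS nJ => v Jv; apply: NJ.
by split => //=; exact: nbhs_singleton nN.
Qed.

Lemma pairr_continuous (T U : topologicalType) (u : U) :
  continuous (fun x : T => (x, u)).
Proof.
move=> x A [[N J] [/= nN nJ] NJ]; apply: filterS nN => v Jv; apply: NJ.
by split => //=; exact: nbhs_singleton nJ.
Qed.

Section Poincare.
Variables (R : realType) (T : topologicalType) (D : T -> T -> bool).
Variables (c : T * R -> T) (x0 : T).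
Hypotheses (cc : continuous c) (c0 : forall x, c (x, 0) = x0).
Hypothesis c1 : forall x, c (x, 1) = x.
Hypothesis exD : forall x, exact_at D x.

Let E (p q : T * R) := D (c p) (c q).

Let exE p : exact_at E p. Proof. exact: exact_pull. Qed.

(** The primitive is continued upwards from u = 0 by [segment_chain]. Each gluing shrinks the
    neighbourhood of x, so the result lives on a tube around one segment only. *)
Lemma tube_primitive (x : T) : exists F : T * R -> bool,
  \forall y \near x, forall u, 0 <= u <= 1 -> prim E F (y, u).
Proof.
pose good t := exists F : T * R -> bool,
  \forall y \near x, forall u, 0 <= u <= t -> prim E F (y, u).
suff: good 0 -> good 1.
  apply; have [f [[N J] [/= nN nJ] NJ]] := exE (x, 0); exists f.
  apply: filterS nN => y Ny u /andP[u0 u0']; apply: NJ; split => //=.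
  have -> : u = 0 by apply/eqP; rewrite eq_le u0 u0'.
  exact: nbhs_singleton nJ.
apply: (@segment_chain R (fun s t => good s -> good t)) => //.
  by move=> s t u H1 H2 /H1.
move=> t t01.
have [f [[N J] [/= nN nJ] NJ]] := exE (x, t).
have [e /= e0 eJ] := (nbhs_ballP _ _).1 nJ.
have glue s u : s <= u -> ball t e s -> ball t e u -> good s -> good u.
  move=> su Bs Bu [F HF].
  have Bv v : s <= v <= u -> J v.
    move=> /andP[sv vu]; apply: eJ; move: Bs Bu.
    rewrite /ball/= !ltr_norml => /andP[? ?] /andP[? ?]; apply/andP; split; lra.
  (* For negative s nothing has been built yet, and the local primitive f alone reaches u. *)
  have [s0|s0] := ltP s 0.
    exists f; apply: filterS nN => y Ny v /andP[v0 vu]; apply: NJ; split => //=.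
    by apply: Bv; rewrite vu andbT; lra.
  have Fxs : prim E F (x, s) by apply: (nbhs_singleton HF); rewrite s0/=.
  have fxs : prim E f (x, s).
    by apply: NJ; split => //=; [exact: nbhs_singleton nN|apply: Bv; rewrite lexx].
  (* Two primitives at (x, s) differ by a constant near it, so f shifted by m continues F above the
     level s. *)
  set m := f (x, s) (+) F (x, s).
  have [[N2 J2] [/= nN2 nJ2] NJ2] := prim_diff fxs Fxs.
  pose F' p := if p.2 <= s then F p else f p (+) m.
  exists F'; near=> y => v /andP[v0 vu].
  have Ny : N y by near: y.
  have nN2y : nbhs y N2 by near: y; apply: near_join.
  have HFy : forall u0, 0 <= u0 <= s -> prim E F (y, u0) by near: y.
  have snd_lt (w : R) (P : R -> Prop) : (\forall a \near v, P a) ->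
      \forall q \near (y, v), P q.2.
    by move=> H; exact: (cvg_snd H).
  have [vs|sv|vs] := ltgtP v s.
  - apply: (prim_near (f := F) (k := false)); first by apply: HFy; rewrite v0 ltW.
    have := snd_lt v _ (lt_nbhsl vs); apply: filterS => q qs.
    by rewrite /F' (ltW qs) addbF.
  - apply: (prim_near (f := f) (k := m)).
      by apply: NJ; split => //=; apply: Bv; rewrite ltW.
    have := snd_lt v _ (lt_nbhsr sv); apply: filterS => q qs.
    by rewrite /F' leNgt qs.
  - subst v; apply: (prim_near (f := F) (k := false)); first by apply: HFy; rewrite s0/=.
    exists (N2, J2) => // -[q1 q2] q12; have := NJ2 _ q12; rewrite /F' /m addbF.
    by case: ifP => // _ <-; rewrite addbA addbb.
have shrink s u : u <= s -> good s -> good u.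
  move=> us [F HF]; exists F; apply: filterS HF => y H v /andP[v0 vu].
  by apply: H; rewrite v0 (le_trans vu).
have tb : ball t e t by exact: ballxx.
near=> u => u01.
have ub : ball t e u by near: u; apply/nbhs_ballP; exists e.
have [ut|tu] := leP u t; split.
- exact: shrink.
- exact: glue.
- by apply: glue => //; exact: ltW.
- by apply: shrink; exact: ltW.
Unshelve. all: by end_near.
Qed.

(** The homotopy formula: g integrates the pulled back germ along the path from x0 to x. Since c is
    constant at u = 0, the variation of g comes from u = 1 alone, where it is D. *)
Lemma poincare : exists g, forall x, prim D g x.
Proof.
have [F HF] := choice tube_primitive.
exists (fun x => F x (x, 1) (+) F x (x, 0)) => x.
have same y z : (forall u, 0 <= u <= 1 -> prim E (F y) (z, u)) ->
    F z (z, 1) (+) F z (z, 0) = F y (z, 1) (+) F y (z, 0).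
  move=> Hy; have Hz := nbhs_singleton (HF z).
  suff : F z (z, 0) (+) F y (z, 0) = F z (z, 1) (+) F y (z, 1).
    by case: (F z (z, 0)); case: (F z (z, 1)); case: (F y (z, 0)); case: (F y (z, 1)).
  apply: (@segment_const R (fun u => F z (z, u) (+) F y (z, u))) => // u u01.
  have := prim_diff (Hz _ u01) (Hy _ u01).
  move=> /(near_preimage (@pairl_continuous T R z)).
  by apply: filterS => v -> _.
have H1 : prim E (F x) (x, 1) by apply: (nbhs_singleton (HF x)); rewrite lexx ler01.
have H0 : prim E (F x) (x, 0) by apply: (nbhs_singleton (HF x)); rewrite lexx ler01.
have D0 : D x0 x0 = false by have := prim_diag H0; rewrite /E c0.
have H1' := near_preimage (@pairr_continuous T R 1) H1.
have H0' := near_preimage (@pairr_continuous T R 0) H0.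
apply: filterS3 (HF x) H1' H0' => z Hz /=.
rewrite /E !c1 !c0 D0 => -> H3; rewrite (same x z)//.
by move: H3; case: (F x (z, 1)); case: (F x (z, 0)); case: (F x (x, 1)); case: (F x (x, 0)).
Qed.

End Poincare.

(** * Simplices *)

Lemma addF2xx (x : 'F_2) : x + x = 0.
Proof. by case: x => -[|[|//]] i; exact/val_inj. Qed.

Lemma natF2D (a b : bool) : (a (+) b)%:R = a%:R + b%:R :> 'F_2.
Proof. by case: a; case: b => //=; rewrite ?addr0 ?add0r// addF2xx. Qed.

Lemma addfF2xx (T : Type) (f : T -> 'F_2) : f + f = 0.
Proof. by apply/funext => t; exact: addF2xx. Qed.

Section RealContinuity.
Variables (R : realType) (T : topologicalType).

Lemma fun_continuousD (V : normedModType R) (f g : T -> V) :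
  continuous f -> continuous g -> continuous (fun x => f x + g x).
Proof. by move=> cf cg x; apply: cvgD; [exact: cf|exact: cg]. Qed.

Lemma fun_continuousZ (V : normedModType R) (f : T -> R) (g : T -> V) :
  continuous f -> continuous g -> continuous (fun x => f x *: g x).
Proof. by move=> cf cg x; apply: cvgZ; [exact: cf|exact: cg]. Qed.

Lemma fun_continuousM (f g : T -> R) :
  continuous f -> continuous g -> continuous (fun x => f x * g x).
Proof. by move=> cf cg x; apply: cvgM; [exact: cf|exact: cg]. Qed.

Lemma fun_continuousB (V : normedModType R) (f g : T -> V) :
  continuous f -> continuous g -> continuous (fun x => f x - g x).
Proof. by move=> cf cg x; apply: cvgB; [exact: cf|exact: cg]. Qed.

Lemma fun_continuous_sum (V : normedModType R) n (f : 'I_n -> T -> V) :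
  (forall i, continuous (f i)) -> continuous (fun x => \sum_i f i x).
Proof.
elim: n f => [|n IH] f cf.
  under [X in continuous X]eq_fun do rewrite big_ord0.
  exact: cst_continuous.
under [X in continuous X]eq_fun do rewrite big_ord_recl.
by apply: fun_continuousD => //; exact: IH.
Qed.

Lemma row_continuous n (f : T -> 'rV[R]_n) :
  (forall j, continuous (fun x => f x ord0 j)) -> continuous f.
Proof.
move=> cf x A [B Bn BA].
have : \forall z \near x, forall j, B ord0 j (f z ord0 j).
  by apply: filter_forall => j; exact: (cf j x _ (Bn ord0 j)).
by apply: filterS => z Hz; apply: BA => i j; rewrite (ord1 i).
Qed.

(** Retracts the line onto a segment, so that paths and homotopies are maps on the whole line and
    their continuity needs no subspace topology. *)
Definition clamp (a b t : R) := Num.max a (Num.min b t).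

Lemma clamp_continuous (a b : R) : continuous (clamp a b).
Proof.
move=> t; apply: (@continuous_max _ _ (fun=> a) (Num.min b)); first exact: cst_continuous.
by apply: (@continuous_min _ _ (fun=> b) id); [exact: cst_continuous|].
Qed.

Lemma clamp_itv (a b t : R) : a <= b -> a <= clamp a b t <= b.
Proof. by move=> ab; rewrite /clamp le_max lexx/= ge_max ab ge_min lexx. Qed.

Lemma clamp_id (a b t : R) : a <= t <= b -> clamp a b t = t.
Proof.
by move=> /andP[at_ tb]; rewrite /clamp (min_idPr tb) (max_idPr at_).
Qed.

End RealContinuity.

Lemma set_val_continuous (S : topologicalType) (X : set S) :
  continuous (set_val : X -> S).
Proof. exact: initial_continuous. Qed.

Lemma set_type_continuous (T S : topologicalType) (X : set S) (f : T -> X) :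
  continuous (fun x => set_val (f x)) -> continuous f.
Proof. by move=> cf; exact: (@continuous_comp_initial _ _ _ (set_val : X -> S)). Qed.

Definition corestrict (T S : topologicalType) (X : set S) (f : T -> S)
  (fX : forall x, X (f x)) (x : T) : X := SigSub (mem_set (fX x)).

Lemma corestrictE (T S : topologicalType) (X : set S) (f : T -> S)
  (fX : forall x, X (f x)) (x : T) : set_val (corestrict fX x) = f x.
Proof. by []. Qed.

Lemma corestrict_continuous (T S : topologicalType) (X : set S) (f : T -> S)
  (fX : forall x, X (f x)) : continuous f -> continuous (corestrict fX).
Proof. by move=> cf; exact: set_type_continuous. Qed.

Lemma set_val_eq (S : topologicalType) (X : set S) (x y : X) :
  set_val x = set_val y -> x = y.
Proof. by move=> xy; exact: val_inj. Qed.

Section Simplices.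
Variable R : realType.

Definition coord n (x : simplex R n) (i : 'I_n.+1) : R := set_val x ord0 i.

Lemma coord_ge0 n (x : simplex R n) i : 0 <= coord x i.
Proof. by have [x0 _] := set_valP x; exact: x0. Qed.

Lemma coord_sum1 n (x : simplex R n) : \sum_i coord x i = 1.
Proof. by have [_ ->] := set_valP x. Qed.

Lemma coord_fun_continuous n (i : 'I_n.+1) : continuous (fun x : simplex R n => coord x i).
Proof.
move=> x; apply: (@continuous_comp _ _ _ (set_val : simplex R n -> _)
   (fun M : 'rV[R]_n.+1 => M ord0 i)); first exact: set_val_continuous.
exact: coord_continuous.
Qed.

Lemma coord_inj n (x y : simplex R n) : coord x =1 coord y -> x = y.
Proof.
move=> xy; apply: set_val_eq; apply/rowP => j; exact: xy.
Qed.

Lemma bary_subproof n (p : 'I_n.+1 -> R) : (forall i, 0 <= p i) ->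
  \sum_i p i = 1 -> \row_i p i \in simplex R n.
Proof.
move=> p0 p1; apply/mem_set.
by split => [i|]; rewrite ?mxE// -[RHS]p1; apply: eq_bigr => i _; rewrite mxE.
Qed.

Definition bary n (p : 'I_n.+1 -> R) (p0 : forall i, 0 <= p i)
  (p1 : \sum_i p i = 1) : simplex R n := SigSub (bary_subproof p0 p1).

Lemma coord_bary n p p0 p1 i : coord (@bary n p p0 p1) i = p i.
Proof. by rewrite /coord /= mxE. Qed.

Lemma vtx_ge0 n (k i : 'I_n.+1) : 0 <= (i == k)%:R :> R.
Proof. by rewrite ler0n. Qed.

Lemma vtx_sum1 n (k : 'I_n.+1) : \sum_(i < n.+1) (i == k)%:R = 1 :> R.
Proof. by rewrite (bigD1 k)//= eqxx big1 ?addr0// => i /negbTE ->. Qed.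

Definition vtx n (k : 'I_n.+1) : simplex R n := bary (vtx_ge0 k) (vtx_sum1 k).

Lemma coord_coface n (i : 'I_n.+2) (x : simplex R n) j :
  coord (coface i x) j = oapp (coord x) 0 (unlift i j).
Proof. by rewrite /coord /= mxE. Qed.

Lemma coface_vtx n (i : 'I_n.+2) (k : 'I_n.+1) : coface i (vtx k) = vtx (lift i k).
Proof.
apply: coord_inj => j; rewrite coord_coface coord_bary.
case: unliftP => /= [l ->|->]; first by rewrite coord_bary (inj_eq lift_inj).
by rewrite (negbTE (neq_lift i k)).
Qed.

Lemma simplex0 (x : simplex R 0) : x = vtx ord0.
Proof.
apply: coord_inj => j; rewrite coord_bary (ord1 j) eqxx.
by have := coord_sum1 x; rewrite big_ord1.
Qed.

Section Contraction.
Variable n : nat.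

Let mixc (p : simplex R n * R) (i : 'I_n.+1) : R :=
  (1 - clamp 0 1 p.2) * coord (vtx (@ord0 n)) i + clamp 0 1 p.2 * coord p.1 i.

Let mix_ge0 p i : 0 <= mixc p i.
Proof.
have /andP[? ?] := clamp_itv p.2 (@ler01 R).
by rewrite /mixc addr_ge0// mulr_ge0 ?coord_ge0// subr_ge0.
Qed.

Let mix_sum1 p : \sum_i mixc p i = 1.
Proof. by rewrite big_split/= -!mulr_sumr !coord_sum1 !mulr1 subrK. Qed.

Definition contraction p : simplex R n := bary (mix_ge0 p) (mix_sum1 p).

Lemma contraction_continuous : continuous contraction.
Proof.
apply: set_type_continuous; apply: row_continuous => j.
rewrite (_ : (fun x => _) = mixc^~ j); last first.
  by apply/funext => p; exact: coord_bary.
have c2 : continuous (fun p : simplex R n * R => clamp 0 1 p.2).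
  move=> p; apply: (@continuous_comp _ _ _ snd (clamp 0 1)); first exact: cvg_snd.
  exact: clamp_continuous.
have c1 : continuous (fun p : simplex R n * R => coord p.1 j).
  move=> p; apply: (@continuous_comp _ _ _ fst (fun x : simplex R n => coord x j)).
    exact: cvg_fst.
  exact: coord_fun_continuous.
apply: fun_continuousD; last exact: fun_continuousM.
apply: fun_continuousM; last exact: cst_continuous.
by apply: fun_continuousB => //; exact: cst_continuous.
Qed.

Lemma contraction0 x : contraction (x, 0) = vtx ord0.
Proof.
apply: coord_inj => i; rewrite coord_bary /mixc/= clamp_id ?lexx ?ler01//.
by rewrite subr0 mul1r mul0r addr0.
Qed.

Lemma contraction1 x : contraction (x, 1) = x.
Proof.
apply: coord_inj => i; rewrite coord_bary /mixc/= clamp_id ?lexx ?ler01//.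
by rewrite subrr mul1r mul0r add0r.
Qed.

Lemma simplex_primitive (D : simplex R n -> simplex R n -> bool) :
  (forall x, exact_at D x) -> exists g, forall x, prim D g x.
Proof.
exact: (poincare contraction_continuous contraction0 contraction1).
Qed.

Lemma simplex_const (f : simplex R n -> bool) :
  (forall x, locally_const f x) -> forall x y, f x = f y.
Proof.
move=> lf; suff fv x : f x = f (vtx ord0) by move=> x y; rewrite fv (fv y).
rewrite -(contraction0 x) -[in LHS](contraction1 x).
apply/esym/(@segment_const R (fun t => f (contraction (x, t)))) => // t _.
have := near_preimage (@pairl_continuous _ _ x) (near_preimage contraction_continuous
  (lf (contraction (x, t)))).
by apply: filterS => u -> _.
Qed.

End Contraction.

Section Affine.
Variables (V : normedModType R) (n : nat).

Definition affine (p : 'I_n.+1 -> V) (x : simplex R n) : V := \sum_i coord x i *: p i.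

Lemma affine_continuous p : continuous (affine p).
Proof.
apply: fun_continuous_sum => i; apply: fun_continuousZ; first exact: coord_fun_continuous.
exact: cst_continuous.
Qed.

End Affine.

Lemma affine_coface (V : normedModType R) n (p : 'I_n.+2 -> V) (i : 'I_n.+2) x :
  affine p (coface i x) = affine (p \o lift i) x.
Proof.
rewrite /affine (bigD1_ord i)//= coord_coface unlift_none scale0r add0r.
by apply: eq_bigr => k _; rewrite coord_coface liftK.
Qed.

End Simplices.

(** * Singular chains and periods *)

Section Chains.
Variables (R : realType) (T : topologicalType).

Definition pairing n (z phi : singular R n T -> 'F_2) : 'F_2 :=
  \sum_(s \in [set: singular R n T]) z s * phi s.

(** A carrier that may exceed the support, so that several chains can be summed over one common
    finite set. *)
Definition bears n (A : {fset singular R n T}) (z : singular R n T -> 'F_2) :=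
  forall s, s \notin A -> z s = 0.

Lemma chain_bears n (z : singular R n T -> 'F_2) :
  chain z <-> exists A, bears A z.
Proof.
split=> [cz|[A Az]].
  exists (fset_set [set s | z s != 0]) => s; rewrite in_fset_set//.
  by move=> /negP; rewrite inE/= => /negP; rewrite negbK => /eqP.
apply: (@sub_finite_set _ _ [set` A]); last exact: finite_fset.
move=> s /= zs; apply: contraT => /Az zs0; by rewrite zs0 eqxx in zs.
Qed.

Lemma pairing_bears n A (z phi : singular R n T -> 'F_2) : bears A z ->
  pairing z phi = \sum_(s <- A) z s * phi s.
Proof. by move=> Az; apply: fsbigTE => s /Az ->; rewrite mul0r. Qed.

Lemma bearsU n (A B : {fset singular R n T}) z : bears A z -> bears (A `|` B)%fset z.
Proof. by move=> Az s; rewrite in_fsetU negb_or => /andP[/Az]. Qed.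

Arguments bearsU {n A} B {z}.

Lemma chainD n (z z' : singular R n T -> 'F_2) : chain z -> chain z' -> chain (z + z').
Proof.
move=> /chain_bears[A Az] /chain_bears[B Bz]; apply/chain_bears.
exists (A `|` B)%fset => s sAB; rewrite /= -[LHS]/(z s + z' s).
by rewrite (bearsU B Az)// (bearsU A Bz) ?addr0// fsetUC.
Qed.

Lemma chain0 n : chain (0 : singular R n T -> 'F_2).
Proof. by apply/chain_bears; exists fset0. Qed.

Lemma pairingDl n (z z' phi : singular R n T -> 'F_2) : chain z -> chain z' ->
  pairing (z + z') phi = pairing z phi + pairing z' phi.
Proof.
move=> /chain_bears[A Az] /chain_bears[B Bz].
have Az' := bearsU B Az.
have Bz' : bears (A `|` B)%fset z' by rewrite fsetUC; exact: bearsU.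
rewrite (pairing_bears _ Az') (pairing_bears _ Bz').
rewrite (pairing_bears (A := (A `|` B)%fset)); last first.
  by move=> s sAB; rewrite -[LHS]/(z s + z' s) Az'// Bz'// addr0.
rewrite -big_split/=; apply: eq_bigr => s _.
by rewrite -[(z + z') s]/(z s + z' s) mulrDl.
Qed.

Lemma pairingDr n (z phi psi : singular R n T -> 'F_2) : chain z ->
  pairing z (phi + psi) = pairing z phi + pairing z psi.
Proof.
move=> /chain_bears[A Az]; rewrite !(pairing_bears _ Az) -big_split/=.
by apply: eq_bigr => s _; rewrite -[(phi + psi) s]/(phi s + psi s) mulrDr.
Qed.

Lemma pairing0l n (phi : singular R n T -> 'F_2) : pairing 0 phi = 0.
Proof. by rewrite (pairing_bears (A := fset0))// big_seq_fset0. Qed.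

Lemma eq_pairing n (z phi psi : singular R n T -> 'F_2) :
  (forall s, z s != 0 -> phi s = psi s) -> pairing z phi = pairing z psi.
Proof.
move=> e; apply: eq_fsbigr => s _.
by have [->|/e ->] := eqVneq (z s) 0; rewrite ?mul0r.
Qed.

Lemma boundary_bears n (A : {fset singular R n.+1 T}) z : bears A z ->
  bears [fset sing_face p.2 p.1 | p in [seq (s, i) | s <- A, i <- enum 'I_n.+2]]%fset
    (boundary z).
Proof.
move=> Az t tA; rewrite -[LHS]/(pairing z _) (pairing_bears _ Az).
rewrite big_seq big1// => s sA; rewrite big1 ?mulr0// => i _.
case: eqP => // st; case/negP: tA; apply/imfsetP => /=.
by exists (s, i) => //; apply/allpairsP; exists (s, i); split => //=; rewrite mem_enum.
Qed.

Lemma chain_boundary n (z : singular R n.+1 T -> 'F_2) : chain z -> chain (boundary z).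
Proof.
move=> /chain_bears[A Az]; apply/chain_bears; eexists; exact: boundary_bears Az.
Qed.

(** The coboundary is the transpose of the boundary; both sides are finite sums over the faces of
    the simplices that carry z. *)
Lemma pairing_boundary n (z : singular R n.+1 T -> 'F_2) (phi : singular R n T -> 'F_2) :
  chain z ->
  pairing (boundary z) phi = pairing z (fun s => \sum_(i < n.+2) phi (sing_face i s)).
Proof.
move=> /chain_bears[A Az]; rewrite (pairing_bears _ (boundary_bears Az)).
rewrite (pairing_bears _ Az).
set B := [fset _ | _ in _]%fset.
under eq_bigr => t _.
  rewrite -[boundary z t]/(pairing z _) (pairing_bears _ Az) mulr_suml.
  over.
rewrite exchange_big/= big_seq [RHS]big_seq; apply: eq_bigr => s sA.
under eq_bigr do rewrite -mulrA.
rewrite -mulr_sumr; congr (_ * _).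
transitivity (\sum_(t <- B) \sum_(i < n.+2) (sing_face i s == t)%:R * phi t).
  by apply: eq_bigr => t _; rewrite big_distrl.
rewrite exchange_big/=; apply: eq_bigr => i _.
have sB : sing_face i s \in B.
  apply/imfsetP => /=; exists (s, i) => //.
  by apply/allpairsP; exists (s, i); split => //=; rewrite mem_enum.
rewrite (big_fsetD1 _ sB)/= eqxx mul1r big_seq big1 ?addr0// => t.
by rewrite in_fsetD1 eq_sym => /andP[/negbTE -> _]; rewrite mul0r.
Qed.

Lemma boundaryD n (z z' : singular R n.+1 T -> 'F_2) : chain z -> chain z' ->
  boundary (z + z') = boundary z + boundary z'.
Proof. by move=> cz cz'; apply/funext => t; exact: pairingDl. Qed.

Lemma boundary0 n : boundary (0 : singular R n.+1 T -> 'F_2) = 0.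
Proof. by apply/funext => t; exact: pairing0l. Qed.

Definition point_simplex (x : T) : singular R 0 T :=
  mkcts (@cst_continuous (simplex R 0) T x).

Lemma sing_faceE n (i : 'I_n.+2) (s : singular R n.+1 T) x :
  sing_face i s x = s (coface i x).
Proof. by []. Qed.

Lemma face1E (i : 'I_2) (s : singular R 1 T) :
  sing_face i s = point_simplex (s (vtx R (lift i ord0))).
Proof.
by apply/continuousEP => x; rewrite sing_faceE (simplex0 x) coface_vtx.
Qed.

Lemma boundary_boundary (b : singular R 2 T -> 'F_2) : chain b ->
  boundary (boundary b) = 0.
Proof.
move=> cb; apply/funext => t.
rewrite -[LHS]/(pairing (boundary b) _) pairing_boundary// /pairing.
apply: fsbig1 => s _.
rewrite [X in _ * X](_ : _ = 0) ?mulr0//.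
rewrite !big_ord_recl !big_ord0 !addr0 !face1E !sing_faceE !coface_vtx.
(* Indexing vertices by numbers lets iterated lifts compute; each vertex of the triangle then occurs
   twice. *)
pose a m := point_simplex (s (vtx R (inord m))) == t.
have E (k : 'I_3) : (point_simplex (s (vtx R k)) == t) = a (val k).
  by rewrite /a inord_val.
rewrite !E /= /bump /=.
by case: (a _); case: (a _); case: (a _); exact/val_inj.
Qed.

(** The increment along s of a primitive of the pulled back germ. By [integE] the choice of the
    primitive does not matter, because the simplex is connected. *)
Definition integ (D : T -> T -> bool) (s : singular R 1 T) : bool :=
  `[< exists2 g, (forall x, prim (fun x z => D (s x) (s z)) g x) &
                 g (vtx R ord_max) (+) g (vtx R ord0) >].

Lemma integE D (s : singular R 1 T) g : (forall x, prim (fun x z => D (s x) (s z)) g x) ->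
  integ D s = g (vtx R ord_max) (+) g (vtx R ord0).
Proof.
move=> pg; apply/asboolP/idP => [[g' pg' g'v]|gv]; last by exists g.
have := @simplex_const R 1 (fun x => g x (+) g' x) (fun x => prim_diff (pg x) (pg' x))
  (vtx R ord_max) (vtx R ord0).
by move: g'v; case: (g _); case: (g _); case: (g' _); case: (g' _).
Qed.

Lemma integ_prim D (s : singular R 1 T) : (forall x, exact_at D x) -> exists2 g,
  (forall x, prim (fun x z => D (s x) (s z)) g x) &
  integ D s = g (vtx R ord_max) (+) g (vtx R ord0).
Proof.
move=> eD; have [|g pg] := @simplex_primitive R 1 (fun x z => D (s x) (s z)).
  by move=> x; apply: exact_pull => //; exact: cts_fun.
by exists g => //; exact: integE.
Qed.

Definition period (D : T -> T -> bool) (z : singular R 1 T -> 'F_2) : 'F_2 :=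
  pairing z (fun s => (integ D s)%:R).

Lemma periodD D D' z : (forall x, exact_at D x) -> (forall x, exact_at D' x) -> chain z ->
  period (fun x y => D x y (+) D' x y) z = period D z + period D' z.
Proof.
move=> eD eD' cz; rewrite /period -pairingDr//; apply: eq_pairing => s _.
have [g pg E] := integ_prim s eD; have [g' pg' E'] := integ_prim s eD'.
rewrite -[RHS]/((integ D s)%:R + (integ D' s)%:R) E E' -natF2D.
have pgg x : prim (fun x z => D (s x) (s z) (+) D' (s x) (s z)) (fun x => g x (+) g' x) x.
  by apply: filterS2 (pg x) (pg' x) => y -> ->; rewrite addbACA.
by rewrite (@integE (fun x y => D x y (+) D' x y) s _ pgg); congr (_%:R); rewrite addbACA.
Qed.

(** Stokes: D has a primitive on each 2-simplex, and its increments along the three sides add up to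
    zero. *)
Lemma period_boundary D b : (forall x, exact_at D x) -> chain b ->
  period D (boundary b) = 0.
Proof.
move=> eD cb; rewrite /period pairing_boundary//; apply: fsbig1 => s _.
rewrite [X in _ * X](_ : _ = 0) ?mulr0//.
have [|g pg] := @simplex_primitive R 2 (fun x z => D (s x) (s z)).
  by move=> x; apply: exact_pull => //; exact: cts_fun.
have E (i : 'I_3) : integ D (sing_face i s) =
    g (vtx R (lift i ord_max)) (+) g (vtx R (lift i ord0)).
  rewrite (@integE _ _ (g \o coface i)) => [|x]; first by rewrite /= !coface_vtx.
  exact: (prim_pull (@coface_continuous R 1 i) (pg _)).
rewrite !big_ord_recl big_ord0 addr0 !E.
pose a m := g (vtx R (inord m)).
have F (k : 'I_3) : g (vtx R k) = a (val k) by rewrite /a inord_val.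
rewrite !F /= /bump /=.
by case: (a _); case: (a _); case: (a _); exact/val_inj.
Qed.

Lemma cycle_pairing z (phi : T -> 'F_2) : cycle1 z ->
  pairing z (fun s => phi (s (vtx R ord_max)) + phi (s (vtx R ord0))) = 0.
Proof.
move=> [cz bz].
have := @pairing_boundary 0 z (fun p => phi (p (vtx R ord0))) cz.
rewrite bz pairing0l => /esym; rewrite /pairing => E; rewrite -[RHS]E.
apply: eq_fsbigr => s _; congr (_ * _).
rewrite !big_ord_recl big_ord0 addr0 !face1E /=.
by congr (phi (s (vtx R _)) + phi (s (vtx R _))); exact/val_inj.
Qed.

(** With a global primitive the integral depends only on the endpoints, and these cancel in a
    cycle. *)
Lemma period_prim D f z : (forall x, prim D f x) -> cycle1 z -> period D z = 0.
Proof.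
move=> pf cz; rewrite -[RHS](cycle_pairing (fun x => (f x)%:R) cz).
apply: eq_pairing => s _; rewrite -natF2D (@integE _ _ (f \o s))// => x.
by apply: (prim_pull _ (pf _)); exact: cts_fun.
Qed.

Lemma periodDl D z z' : chain z -> chain z' -> period D (z + z') = period D z + period D z'.
Proof. exact: pairingDl. Qed.

Lemma cycle1D (z z' : singular R 1 T -> 'F_2) : cycle1 z -> cycle1 z' -> cycle1 (z + z').
Proof.
by move=> [cz bz] [cz' bz']; split; [exact: chainD|rewrite boundaryD// bz bz' addr0].
Qed.

Lemma cycle10 : cycle1 (0 : singular R 1 T -> 'F_2).
Proof. by split; [exact: chain0|exact: boundary0]. Qed.

Lemma subF2 (U : Type) (f g : U -> 'F_2) : f - g = f + g.
Proof. by apply/eqP; rewrite subr_eq -addrA addfF2xx addr0. Qed.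

Lemma homologous_cycle z z' : cycle1 z -> homologous1 (R := R) (T := T) z z' -> cycle1 z'.
Proof.
move=> cz [b cb /eqP]; rewrite subr_eq => /eqP ->; apply: cycle1D => //.
by split; [exact: chain_boundary|exact: boundary_boundary].
Qed.

Lemma period_homologous D z z' : (forall x, exact_at D x) -> cycle1 z ->
  homologous1 z z' -> period D z' = period D z.
Proof.
move=> eD [cz _] [b cb /eqP]; rewrite subr_eq => /eqP ->.
by rewrite periodDl ?period_boundary ?add0r//; exact: chain_boundary.
Qed.

End Chains.

(** * Charts and the two sides of a curve *)

Lemma path_const (R : realType) (T : topologicalType) (f : T -> bool) (g : R -> T)
    (a b : R) : continuous g -> a <= b ->
  (forall t, a <= t <= b -> locally_const f (g t)) -> f (g a) = f (g b).
Proof.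
move=> cg ab lf; apply: (@segment_const R (f \o g)) => // t /lf lft.
by apply: filterS (near_preimage cg lft) => u /= -> _.
Qed.

Lemma near_preimage_at (T T' : topologicalType) (phi : T' -> T) (x : T') (P : T -> Prop) :
  {for x, continuous phi} ->
  (\forall z \near phi x, P z) -> \forall z \near x, P (phi z).
Proof. by move=> cphi H; exact: cphi H. Qed.

Lemma sign_locally_const (R : realType) (T : topologicalType) (g : T -> R) (z : T) :
  {for z, continuous g} -> g z != 0 -> locally_const (fun w => 0 < g w) z.
Proof.
move=> cg; rewrite neq_lt => /orP[gz|gz].
  apply: filterS (near_preimage_at cg (lt_nbhsl gz)) => w gw.
  by rewrite !ltNge !ltW.
by apply: filterS (near_preimage_at cg (lt_nbhsr gz)) => w gw; rewrite gw gz.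
Qed.

Section Plane.
Variable R : realType.
Implicit Types p q : R * R.

Definition box p (e : R) : set (R * R) :=
  [set q | `|q.1 - p.1| < e /\ `|q.2 - p.2| < e].

Lemma boxP p (W : set (R * R)) :
  nbhs p W <-> exists2 e, 0 < e & box p e `<=` W.
Proof.
split.
  move=> /nbhs_ballP[e /= e0 eW]; exists e => // q [q1 q2]; apply: eW.
  by split; rewrite /ball/= distrC.
move=> [e e0 eW]; apply/nbhs_ballP; exists e => // q [q1 q2]; apply: eW.
by split; rewrite distrC.
Qed.

Lemma box_nbhs p e : 0 < e -> nbhs p (box p e).
Proof. by move=> e0; apply/boxP; exists e. Qed.

Definition lerp p q (t : R) : R * R := p + t *: (q - p).

Lemma lerp1E p q t : (lerp p q t).1 = p.1 + t * (q.1 - p.1). Proof. by []. Qed.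
Lemma lerp2E p q t : (lerp p q t).2 = p.2 + t * (q.2 - p.2). Proof. by []. Qed.

Lemma lerp_continuous p q : continuous (lerp p q).
Proof.
apply: fun_continuousD; first by move=> t; exact: cvg_cst.
by apply: fun_continuousZ => // t; [exact: cvg_id|exact: cvg_cst].
Qed.

Lemma lerp0 p q : lerp p q 0 = p. Proof. by rewrite /lerp scale0r addr0. Qed.
Lemma lerp1 p q : lerp p q 1 = q. Proof. by rewrite /lerp scale1r addrC subrK. Qed.

Lemma lerp_gt (c a b t : R) : 0 <= t <= 1 -> c < a -> c < b -> c < a + t * (b - a).
Proof.
move=> /andP[t0 t1] ca cb; have [t2|t2] := lerP t (1 / 2).
  have : 0 < (1 - t) * (a - c) by rewrite mulr_gt0//; lra.
  have : 0 <= t * (b - c) by rewrite mulr_ge0//; lra.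
  lra.
have : 0 <= (1 - t) * (a - c) by rewrite mulr_ge0//; lra.
have : 0 < t * (b - c) by rewrite mulr_gt0//; lra.
lra.
Qed.

Lemma lerp_lt (c a b t : R) : 0 <= t <= 1 -> a < c -> b < c -> a + t * (b - a) < c.
Proof.
move=> t01 ac bc; have := @lerp_gt (- c) (- a) (- b) t t01.
rewrite !ltrN2 => /(_ ac bc); lra.
Qed.

Lemma lerp_box p a b e t : 0 <= t <= 1 -> box p e a -> box p e b -> box p e (lerp a b t).
Proof.
case: p a b => [p1 p2] [a1 a2] [b1 b2] t01 [/= A1 A2] [/= B1 B2].
by split => /=; [move: A1 B1|move: A2 B2]; rewrite !ltr_distl => /andP[? ?] /andP[? ?];
  rewrite lerp_gt ?lerp_lt.
Qed.

Lemma lerp_const (T : topologicalType) (f : T -> bool) (k : R * R -> T) p q :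
  continuous k ->
  (forall t, 0 <= t <= 1 -> locally_const f (k (lerp p q t))) -> f (k p) = f (k q).
Proof.
move=> ck lf; have := @path_const R T f (k \o lerp p q) 0 1.
rewrite /= lerp0 lerp1; apply => // t.
by apply: continuous_comp; [exact: lerp_continuous|exact: ck].
Qed.

End Plane.

Section Charts.
Variables (R : realType) (S : topologicalType).
Implicit Types (U A B X Y : set S) (h : S -> R * R) (x y z : S).

Lemma chart_continuous U h x : plane_chart U h -> U x -> {for x, continuous h}.
Proof. by move=> [oU ch _]; move: ch; rewrite continuous_open_subspace//; move=> + /mem_set;
  exact. Qed.

Lemma chart_box U h x e : plane_chart U h -> U x -> 0 < e ->
  \forall z \near x, U z /\ box (h x) e (h z).
Proof.
move=> Uh Ux e0; have cx := chart_continuous Uh Ux.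
have [oU _ _] := Uh.
apply: filterS2 (open_nbhs_nbhs (conj oU Ux)) (near_preimage_at cx (box_nbhs (h x) e0)) => z ? ?.
by split.
Qed.

Lemma chart_inv U h : plane_chart U h -> exists k : R * R -> S,
  [/\ continuous k, forall x, U x -> k (h x) = x,
      forall p, U (k p), forall p, h (k p) = p &
      forall x W, U x -> nbhs x W -> exists2 e, 0 < e & forall q, box (h x) e q -> W (k q)].
Proof.
move=> [oU ch [k [ck kh hk]]]; exists k; split => //.
- by move=> p; have [] := hk p.
- by move=> p; have [] := hk p.
move=> x W Ux xW; have : nbhs (h x) (k @^-1` W) by apply: ck; rewrite kh.
by move=> /boxP.
Qed.

Lemma chart_continuous2 U h x : plane_chart U h -> U x -> {for x, continuous (fun z => (h z).2)}.
Proof.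
move=> Uh Ux; apply: (@continuous_comp _ _ _ h snd); first exact: chart_continuous Ux.
exact: cvg_snd.
Qed.

Lemma side_locally_const U h A z : straightens U h A -> U z -> ~ A z ->
  locally_const (fun w => 0 < (h w).2) z.
Proof.
move=> [Uh UA] Uz nA; apply: sign_locally_const; first exact: chart_continuous2 Uz.
by apply/eqP => /(UA _ Uz).
Qed.

(** Each half of a small chart box is convex, so f is constant on it; m tells whether the two
    constants differ. *)
Lemma two_sides U h A x (f : S -> bool) : straightens U h A -> U x -> A x ->
  (\forall z \near x, ~ A z -> locally_const f z) ->
  exists n m, \forall z \near x, ~ A z -> f z = n (+) (m && (0 < (h z).2)).
Proof.
move=> [Uh UA] Ux Ax lf; have [k [ck kh Uk hk kW]] := chart_inv Uh.
have [e e0 eW] := kW _ _ Ux lf.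
have hx0 : (h x).2 = 0 by apply/UA.
have qb (d : R) : `|d| < e -> box (h x) e ((h x).1, d).
  by move=> de; split => /=; rewrite ?subrr ?normr0// hx0 subr0.
have e2 : `|e / 2| < e by rewrite ger0_norm; lra.
have e2' : `|- (e / 2)| < e by rewrite normrN.
pose fp := f (k ((h x).1, e / 2)); pose fn := f (k ((h x).1, - (e / 2))).
exists fn, (fn (+) fp).
apply: filterS (chart_box Uh Ux e0) => z [Uz zb] nAz.
have hz0 : (h z).2 != 0 by apply/eqP => /(UA _ Uz).
have sg (d : R) : `|d| < e ->
    (forall t, 0 <= t <= 1 -> (lerp (h z) ((h x).1, d) t).2 != 0) -> f z = f (k ((h x).1, d)).
  move=> de d0; rewrite -{1}(kh z)//; apply: (@lerp_const R S f k) => // t t01.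
  apply: eW; first by apply: lerp_box => //; exact: qb.
  by move=> /(UA _ (Uk _)); rewrite hk => /eqP; apply/negP; exact: d0.
have [hz|hz|/esym hz] := ltgtP 0 (h z).2; last by rewrite hz eqxx in hz0.
  rewrite andbT addbA addbb -/fp; apply: sg => // t t01.
  by rewrite lerp2E gt_eqF// lerp_gt//=; lra.
rewrite andbF addbF; apply: sg => // t t01.
by rewrite lerp2E lt_eqF// lerp_lt//=; lra.
Qed.

Lemma near_side U h A x W (b : bool) : straightens U h A -> U x -> A x -> nbhs x W ->
  exists z, [/\ W z, U z, ~ A z & (0 < (h z).2) = b].
Proof.
move=> [Uh UA] Ux Ax xW; have [k [ck kh Uk hk kW]] := chart_inv Uh.
have [e e0 eW] := kW _ _ Ux xW.
have hx0 : (h x).2 = 0 by apply/UA.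
pose d := if b then e / 2 else - (e / 2).
have de : `|d| < e by rewrite /d; case: (b); rewrite ?normrN ger0_norm; lra.
exists (k ((h x).1, d)); split=> //.
- by apply: eW; split => /=; rewrite ?subrr ?normr0// hx0 subr0.
- by move=> /(UA _ (Uk _)); rewrite hk /= /d; case: (b); lra.
- by rewrite hk /= /d; case: (b); [apply/idP; lra|apply/negbTE; rewrite -leNgt; lra].
Qed.

(** By [two_sides] the sign in h' depends only on the side in h. It cannot be constant, since both
    sides of A in h' occur arbitrarily close to x. *)
Lemma side_compare U h U' h' A x : straightens U h A -> straightens U' h' A ->
  U x -> U' x -> A x ->
  exists n, \forall z \near x, ~ A z -> (0 < (h' z).2) = (0 < (h z).2) (+) n.
Proof.
move=> s s' Ux U'x Ax.
have [|n [[] Hm]] := @two_sides U h A x (fun z => 0 < (h' z).2) s Ux Ax.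
- have [[oU' _ _] _] := s'.
  by apply: filterS (open_nbhs_nbhs (conj oU' U'x)) => z U'z nA; exact: (side_locally_const s').
- by exists n; apply: filterS Hm => z H nA; rewrite H//= addbC.
have [z [H _ nA hz]] := near_side (~~ n) s' U'x Ax Hm.
by have := H nA; rewrite hz /= addbF => /esym/eqP; case: (n).
Qed.

Section CurveAtlas.
Variables (A : set S) (ch : S -> set S * (S -> R * R)).
Hypothesis chA : forall x, A x -> straightens (ch x).1 (ch x).2 A /\ (ch x).1 x.

Definition side x z := 0 < ((ch x).2 z).2.

Lemma curve_thin x : thin A x.
Proof.
move=> W xW; have [Ax|nA] := pselect (A x); last by exists x => //; exact: nbhs_singleton xW.
have [s Ux] := chA Ax; have [z [Wz _ nA _]] := near_side true s Ux Ax xW.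
by exists z.
Qed.

Lemma near_side_compare x : A x -> \forall y \near x, A y ->
  exists k, \forall z \near y, ~ A z -> side y z = side x z (+) k.
Proof.
move=> Ax; have [s Ux] := chA Ax; have [[oU _ _] _] := s.
apply: filterS (open_nbhs_nbhs (conj oU Ux)) => y Uxy Ay.
have [s' Uy] := chA Ay; exact: (side_compare s s' Uxy Uy Ay).
Qed.

Lemma near_side_const x : A x -> \forall y \near x, ~ A y ->
  exists k, \forall z \near y, side x z = k.
Proof.
move=> Ax; have [s Ux] := chA Ax; have [[oU _ _] _] := s.
apply: filterS (open_nbhs_nbhs (conj oU Ux)) => y Uxy nAy.
by exists (side x y); exact: (side_locally_const s).
Qed.

(** Crossing B flips the colour and crossing the rest of A does not. This is consistent because,
    within X, B is relatively open in A and closed: its ends lie outside X. *)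
Lemma piece_atlas B X : B `<=` A ->
  (forall x, X x -> B x -> \forall z \near x, A z -> B z) ->
  (forall x, X x -> ~ B x -> \forall z \near x, ~ B z) ->
  atlas A X (fun x z => `[< B x >] && side x z).
Proof.
move=> BA Bo Bc x Xx; have [Bx|nB] := pselect (B x); last first.
  apply: filterS (Bc _ Xx nB) => y nBy; exists false; apply: nearW => z _.
  by rewrite !asboolF.
have Ax := BA _ Bx.
apply: filterS3 (Bo _ Xx Bx) (near_side_compare Ax) (near_side_const Ax) => y yB yk ynk.
have [Ay|nAy] := pselect (A y).
  have [k Hk] := yk Ay; exists k; apply: filterS Hk => z H /H.
  by rewrite !asboolT//; exact: yB.
have [k Hk] := ynk nAy; exists k; apply: filterS Hk => z H _.
by rewrite (asboolT Bx) H asboolF ?addbb// => /BA.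
Qed.

End CurveAtlas.

End Charts.

(** * Crossings as periods *)

Lemma natF2_odd n : n%:R = (odd n)%:R :> 'F_2.
Proof. by elim: n => // n IH; rewrite -natr1 IH -(natF2D _ true) addbT. Qed.

Section Time.
Variable R : realType.
Implicit Types (x y : simplex R 1) (t : R).

Lemma ord2E (i : 'I_2) : i = ord0 \/ i = ord_max.
Proof. by case: i => -[|[|//]] i; [left|right]; exact/val_inj. Qed.

Lemma coord0E x : coord x ord0 = 1 - sing_time x.
Proof.
have := coord_sum1 x; rewrite !big_ord_recl big_ord0 addr0 => <-.
rewrite /sing_time -/(coord x ord_max) [in coord x ord_max](_ : ord_max = lift ord0 ord0).
  by rewrite addrK.
exact/val_inj.
Qed.

Lemma time_inj x y : sing_time x = sing_time y -> x = y.
Proof.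
by move=> xy; apply: coord_inj => i; have [->|->] := ord2E i; rewrite ?coord0E ?xy.
Qed.

Lemma time_itv x : 0 <= sing_time x <= 1.
Proof.
by rewrite (coord_ge0 x ord_max)/= -subr_ge0 -coord0E coord_ge0.
Qed.

Lemma time_continuous : continuous (@sing_time R).
Proof. exact: coord_fun_continuous. Qed.

Definition at_time t : simplex R 1 := contraction (vtx R ord_max, t).

Lemma at_time_continuous : continuous at_time.
Proof.
move=> t; apply: (@continuous_comp _ _ _ (fun u : R => (vtx R ord_max, u)) (@contraction R 1)).
  exact: pairl_continuous.
exact: contraction_continuous.
Qed.

Lemma time_at t : sing_time (at_time t) = clamp 0 1 t.
Proof.
by rewrite -[LHS]/(coord (at_time t) ord_max) coord_bary !coord_bary eqxx/= mulr0 add0r mulr1.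
Qed.

Lemma time_vtx0 : sing_time (vtx R (@ord0 1)) = 0.
Proof. by rewrite -[LHS]/(coord _ ord_max) coord_bary. Qed.

Lemma time_vtx1 : sing_time (vtx R (@ord_max 1)) = 1.
Proof. by rewrite -[LHS]/(coord _ ord_max) coord_bary eqxx. Qed.

Lemma at_timeK x : at_time (sing_time x) = x.
Proof. by apply: time_inj; rewrite time_at clamp_id// time_itv. Qed.

End Time.

Lemma big_addb_true (I : Type) (r : seq I) : \big[addb/false]_(i <- r) true = odd (size r).
Proof. by elim: r => [|i r IH]; rewrite ?big_nil// big_cons IH /=. Qed.

Section Crossing.
Variables (R : realType) (S : topologicalType) (X A : set S).
Variable ch : S -> set S * (S -> R * R).
Hypothesis chA : forall x, A x -> straightens (ch x).1 (ch x).2 A /\ (ch x).1 x.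
Variable D : S -> S -> bool.
Hypothesis rD : rep D A X (fun x z => `[< A x >] && side ch x z).

Definition restrict2 (x z : X) := D (set_val x) (set_val z).

Lemma restrict2_exact x : exact_at restrict2 x.
Proof.
apply: exact_pull; first exact: set_val_continuous.
by apply: (rep_exact rD); exact: set_valP.
Qed.

(** The parity [n] of the number of earlier hits has, outside the hits, the same changes as a
    primitive of the pulled back germ: at a hit it flips, as the side of A does by transversality.
    Its total increment is the parity of the number of hits. *)
Lemma integ_transverse (s : singular R 1 X) : finite_set (hits s A) ->
  (forall x, hits s A x -> transverse_at s A x) ->
  integ restrict2 s = odd #|` fset_set (hits s A)|%fset.
Proof.
move=> fH tH.
pose H := fset_set (hits s A).
have HP x : (x \in H) = (x \in hits s A) by rewrite in_fset_set.
have cs : continuous (fun x => set_val (s x)).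
  move=> x; apply: (@continuous_comp _ _ _ s set_val); first exact: cts_fun.
  exact: set_val_continuous.
have := rep_pull cs rD; set Y := _ @^-1` A; set X' := _ @^-1` X.
have X'T x : X' x by exact: set_valP.
move=> rD'.
pose n x := \big[addb/false]_(h <- H) (sing_time h < sing_time x).
have near_n x : \forall z \near x, forall h, h \in H -> h != x ->
    (sing_time h < sing_time z) = (sing_time h < sing_time x).
  pose P (i : 'I_(size H)) z := nth x H i != x ->
    (sing_time (nth x H i) < sing_time z) = (sing_time (nth x H i) < sing_time x).
  have : \forall z \near x, forall i, P i z.
    apply: (@filter_forall _ _ P _ (nbhs_filter x)) => i; rewrite /P;
      have [->|hx] := eqVneq (nth x H i) x.
      by apply: nearW => z; rewrite ?eqxx.
    set h := nth x H i.
    have : locally_const (fun z => 0 < sing_time z - sing_time h) x.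
      apply: sign_locally_const.
        by apply: fun_continuousB; [exact: time_continuous|exact: cst_continuous].
      by rewrite subr_eq0; apply: contra_neq hx => /time_inj.
    by apply: filterS => z; rewrite !subr_gt0 => -> _.
  apply: filterS => z Hz h hH hx.
  have ih : (index h H < size H)%N by rewrite index_mem.
  by have := Hz (Ordinal ih); rewrite /P /= nth_index//; exact.
(* Near a hit, the side of A on which s lies is decided by whether time x has passed, up to the
   constant k relating two charts and the direction of the crossing. *)
have crossing x : hits s A x -> exists k, \forall z \near x, z <> x ->
    ~ Y z /\ side ch (set_val (s x)) (set_val (s z)) = (sing_time x < sing_time z) (+) k.
  move=> hx; have [x01 [U [h [sU Ux tr]]]] := tH _ hx.
  have [sc Uc] := chA hx.
  have [m /(near_preimage cs) Hm] := side_compare sU sc Ux Uc hx.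
  have [[oU _ _] UA] := sU.
  have nU : \forall z \near x, U (set_val (s z)).
    exact: (near_preimage cs (open_nbhs_nbhs (conj oU Ux))).
  have sgn z (b : bool) : sing_time z - sing_time x != 0 -> (h (set_val (s z))).2 != 0 ->
      (0 < (sing_time z - sing_time x) * (h (set_val (s z))).2) = b ->
      (0 < (h (set_val (s z))).2) = (sing_time x < sing_time z) (+) ~~ b.
    move=> tx hz <-; have [t0|t0] := ltP (sing_time x) (sing_time z).
      by rewrite pmulr_rgt0 ?subr_gt0//; case: (0 < _).
    rewrite nmulr_rgt0; last by rewrite lt_neqAle tx subr_le0.
    by rewrite addFb -leNgt le_eqVlt eq_sym (negbTE hz).
  have [b Hb] : exists b, \forall z \near x, z <> x ->
      [/\ sing_time z - sing_time x != 0, (h (set_val (s z))).2 != 0 &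
        (0 < (sing_time z - sing_time x) * (h (set_val (s z))).2) = b].
    case: tr => tr; [exists true|exists false]; apply: filterS tr => z Hz /Hz tz.
      by move: (gt_eqF tz) => /negbT; rewrite mulf_eq0 negb_or tz => /andP[-> ->].
    move: (lt_eqF tz) => /negbT; rewrite mulf_eq0 negb_or => /andP[-> ->].
    by split => //; apply/negbTE; rewrite -leNgt ltW.
  exists (~~ b (+) m); apply: filterS3 Hm nU Hb => z Hz Uz /[swap] zx /(_ zx)[tx hz sb].
  have nA : ~ Y z by move=> /(UA _ Uz)/eqP; apply/negP.
  by split => //; rewrite -[LHS]/(0 < _) Hz// (sgn z b)// addbA.
have thinY x : thin Y x.
  move=> W xW; have [hx|hx] := pselect (Y x); last first.
    by exists x => //; exact: nbhs_singleton xW.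
  have [k Hk] := crossing _ hx.
  have [/andP[x0 x1] _] := tH _ hx.
  have : nbhs (sing_time x) (fun t => W (at_time t) /\ (at_time t <> x -> ~ Y (at_time t))).
    apply: (near_preimage (@at_time_continuous R) (P := fun z => W z /\ (z <> x -> ~ Y z))).
    by rewrite at_timeK; apply: filterS2 xW Hk => z Wz H' ; split => // /H'[].
  move=> /nbhs_ballP[e /= e0 eW].
  (* Moving forward by d stays within radius e and before time 1, as x is an interior time. *)
  pose d := Num.min (e / 2) ((1 - sing_time x) / 2).
  have d0 : 0 < d by rewrite /d lt_min !divr_gt0// subr_gt0.
  have de : d < e by rewrite /d gt_min; apply/orP; left; lra.
  have d1 : d < 1 - sing_time x by rewrite /d gt_min; apply/orP; right; lra.
  have [] := eW (sing_time x + d).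
    by rewrite /ball/= opprD addrA subrr add0r normrN gtr0_norm.
  move=> We; exists (at_time (sing_time x + d)) => //; apply: b.
  move=> /(congr1 (@sing_time R)); rewrite time_at clamp_id; last by apply/andP; split; lra.
  lra.
have [|||g gp gn] := @rep_primitive _ _ Y X' _ n _ _ rD'.
- by move=> x _; apply: (@filterS _ _ (nbhs_filter x) setT) => [y _|];
  [exact: thinY|exact: filterT].
- by rewrite (_ : X' = setT); [exact: openT|apply/seteqP; split => // x _; exact: X'T].
- move=> x _; have [hx|hx] := pselect (Y x); last first.
    exists (n x); apply: filterS (near_n x) => z Hz _.
    rewrite asboolF//= /n; apply: eq_big_seq => h hH; apply: Hz => //.
    by apply: contra_notN hx => /eqP <-; move: hH; rewrite HP inE.
  have xH : x \in H by rewrite HP inE.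
  have [k Hk] := crossing _ hx.
  exists (k (+) n x); apply: filterS2 (near_n x) Hk => z Hz Hk' nYz.
  have zx : z <> x by move=> zx; apply: nYz; rewrite zx.
  have [_ ->] := Hk' zx.
  rewrite asboolT//= /n !(big_fsetD1 _ xH)/= ltxx /=.
  rewrite addbA -(addbA _ k k) addbb addbF; congr (_ (+) _).
  rewrite big_seq [RHS]big_seq; apply: eq_bigr => h; rewrite in_fsetD1 => /andP[hx' hH].
  exact: Hz.
(* Transversality only allows hits at interior times, so g agrees with [n] at both ends. *)
have nv0 : ~ Y (vtx R ord0) by move=> /tH[]; rewrite time_vtx0 ltxx.
have nv1 : ~ Y (vtx R ord_max) by move=> /tH[]; rewrite time_vtx1 ltxx andbF.
rewrite (@integE _ _ _ _ g) => [|x]; last exact: gp.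
rewrite !gn// /n time_vtx0 time_vtx1.
rewrite [X in _ (+) X]big_seq [X in _ (+) X]big1 => [|h _]; last first.
  by apply/negbTE; rewrite -leNgt; case/andP: (time_itv h).
rewrite addbF -big_addb_true; apply: eq_big_seq => h.
by rewrite HP inE => /tH[/andP[_ ->]].
Qed.

Lemma crossings_period (z : singular R 1 X -> _) : chain z -> transverse z A -> crossings z A =
  period restrict2 z.
Proof.
move=> cz tz; apply: eq_pairing => s zs; have [fH tH] := tz _ zs.
by rewrite integ_transverse// natF2_odd.
Qed.

End Crossing.

(** * Transverse representatives *)

Section BoundaryRelation.
Variables (R : realType) (T : topologicalType).

Definition delta n (s t : singular R n T) : 'F_2 := (s == t)%:R.

Lemma delta_bears n (s : singular R n T) : bears [fset s]%fset (delta s).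
Proof. by move=> t; rewrite in_fset1 /delta eq_sym => /negbTE ->. Qed.

Lemma chain_delta n (s : singular R n T) : chain (delta s).
Proof. by apply/chain_bears; exists [fset s]%fset; exact: delta_bears. Qed.

Lemma boundary_delta n (s : singular R n.+1 T) :
  boundary (delta s) = fun t => \sum_(i < n.+2) delta (sing_face i s) t.
Proof.
apply/funext => t; rewrite -[LHS]/(pairing _ _) (pairing_bears _ (@delta_bears _ s)).
by rewrite big_seq_fset1 /delta eqxx mul1r.
Qed.

Definition bounds (c : singular R 1 T -> 'F_2) := exists2 b, chain b & c = boundary b.

Lemma boundsD c c' : bounds c -> bounds c' -> bounds (c + c').
Proof.
by move=> [b cb ->] [b' cb' ->]; exists (b + b'); [exact: chainD|rewrite boundaryD].
Qed.

Lemma bounds0 : bounds 0.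
Proof. by exists 0; [exact: chain0|rewrite boundary0]. Qed.

Section Segments.
Variables (V : normedModType R) (K : V -> T).
Hypothesis cK : continuous K.

Lemma affine_sing_subproof n (p : 'I_n.+1 -> V) : continuous (K \o affine p).
Proof. by move=> x; apply: continuous_comp; [exact: affine_continuous|exact: cK]. Qed.

Definition affine_sing n (p : 'I_n.+1 -> V) : singular R n T :=
  mkcts (@affine_sing_subproof n p).

Definition seg (a b : V) : singular R 1 T :=
  affine_sing (fun i : 'I_2 => if i == ord0 then a else b).

Lemma segE a b x : seg a b x = K (a + sing_time x *: (b - a)).
Proof.
rewrite -[LHS]/(K (affine _ x)) /affine; congr K.
rewrite !big_ord_recl big_ord0 addr0 /= coord0E.
rewrite [coord x _](_ : _ = sing_time x); last first.
  by rewrite /sing_time /coord; congr (_ ord0 _); exact/val_inj.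
by rewrite scalerBl scale1r scalerBr addrA addrAC.
Qed.

Lemma affine_sing_face n (p : 'I_n.+2 -> V) i :
  sing_face i (affine_sing p) = affine_sing (p \o lift i).
Proof.
apply/continuousEP => x; rewrite sing_faceE.
by rewrite -[LHS]/(K (affine _ _)) affine_coface.
Qed.

Lemma bounds_triangle a b c : bounds (delta (seg a b) + delta (seg b c) + delta (seg a c)).
Proof.
pose p (i : 'I_3) := if i == ord0 then a else if i == ord_max then c else b.
exists (delta (affine_sing p)); first exact: chain_delta.
rewrite boundary_delta; apply/funext => t; rewrite !big_ord_recl big_ord0 addr0 !affine_sing_face.
have E (q q' : 'I_2 -> V) : q =1 q' -> affine_sing q = affine_sing q' by move=> /funext ->.
have -> : affine_sing (p \o lift ord0) = seg b c.
  by apply: E => i; have [->|->] := ord2E i.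
have -> : affine_sing (p \o lift (lift ord0 ord0)) = seg a c.
  by apply: E => i; have [->|->] := ord2E i.
have -> : affine_sing (p \o lift (lift ord0 (lift ord0 ord0))) = seg a b.
  by apply: E => i; have [->|->] := ord2E i.
rewrite -[LHS]/(delta _ t + delta _ t + delta _ t).
ring.
Qed.

Lemma bounds_const a : bounds (delta (seg a a)).
Proof. by have := bounds_triangle a a a; rewrite addfF2xx add0r. Qed.

Lemma bounds_sym a b : bounds (delta (seg a b) + delta (seg b a)).
Proof.
have := boundsD (bounds_triangle a b a) (bounds_const a).
by rewrite -addrA addfF2xx addr0.
Qed.

End Segments.

End BoundaryRelation.

Section TransverseCycle.
Variables (R : realType) (S : topologicalType) (X A : set S).
Hypothesis oX : open X.
Hypothesis cA : forall x, X x -> ~ A x -> \forall z \near x, ~ A z.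
Variable ch : S -> set S * (S -> R * R).
Hypothesis chA : forall x, A x -> straightens (ch x).1 (ch x).2 A /\ (ch x).1 x.
Local Notation SX := (singular R 1 X).
Implicit Types (c w : SX -> 'F_2) (s : SX).

(** Stated for chains rather than cycles: it is then additive and can be established simplex by
    simplex, modulo boundaries. *)
Definition trans c := exists w, [/\ chain w, transverse w A & bounds (c + w)].

Lemma transverseD w w' : transverse w A -> transverse w' A -> transverse (w + w') A.
Proof.
move=> tw tw' s; rewrite -[(w + w') s]/(w s + w' s).
by have [->|ws _] := eqVneq (w s) 0; [rewrite add0r; exact: tw'|exact: tw].
Qed.

Lemma transD c c' : trans c -> trans c' -> trans (c + c').
Proof.
move=> [w [cw tw bw]] [w' [cw' tw' bw']]; exists (w + w'); split.
- exact: chainD.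
- exact: transverseD.
- by rewrite addrACA; exact: boundsD.
Qed.

Lemma trans_bounds c : bounds c -> trans c.
Proof.
move=> bc; exists 0; split; [exact: chain0| |by rewrite addr0].
by move=> s; rewrite eqxx.
Qed.

Lemma trans_cong c c' : bounds (c + c') -> trans c' -> trans c.
Proof.
by move=> /trans_bounds bc tc'; have := transD bc tc'; rewrite -addrA addfF2xx addr0.
Qed.

Definition transverse_simplex s :=
  finite_set (hits s A) /\ forall x, hits s A x -> transverse_at s A x.

Lemma trans_delta s : transverse_simplex s -> trans (delta s).
Proof.
move=> ts; exists (delta s); split; first exact: chain_delta.
  by move=> t; rewrite /delta; have [<- _|_] := eqVneq s t; rewrite ?eqxx.
by rewrite addfF2xx; exact: bounds0.
Qed.

Lemma trans_avoid s : (forall x, ~ A (set_val (s x))) -> trans (delta s).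
Proof.
move=> nA; apply: trans_delta; split; last by move=> x /nA.
by rewrite (_ : hits s A = set0)//; apply/seteqP; split => // x /nA.
Qed.

(** A simplex with an endpoint on A is never transverse; these paths push the endpoint off A. In a
    chart the path is the vertical segment of height e / 2. *)
Lemma leaving_path (x : X) : exists2 g : R -> X, continuous g &
  g 0 = x /\ forall t, 0 < t <= 1 -> ~ A (set_val (g t)).
Proof.
have [Ax|nA] := pselect (A (set_val x)); last first.
  by exists (fun=> x); [exact: cst_continuous|].
have [[Uh UA] Ux] := chA Ax; have [k [ck kh Uk hk kW]] := chart_inv Uh.
move: Uh UA Ux ck kh Uk hk kW; set U := (ch _).1; set h := (ch _).2.
move=> Uh UA Ux ck kh Uk hk kW.
have nX : nbhs (set_val x) X by apply: open_nbhs_nbhs; split => //; exact: set_valP.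
have [e e0 eX] := kW _ _ Ux nX.
have hx0 : (h (set_val x)).2 = 0 by apply/UA.
pose p0 := h (set_val x); pose p1 := (p0.1, e / 2).
pose f t := k (lerp p0 p1 (clamp 0 1 t)).
have fX t : X (f t).
  apply: eX; apply: lerp_box; first exact: clamp_itv.
    by split; rewrite subrr normr0.
  by split; rewrite /= ?subrr ?normr0// hx0 subr0 gtr0_norm; lra.
exists (corestrict fX).
  apply: corestrict_continuous => t.
  apply: (@continuous_comp _ _ _ (clamp 0 1) (k \o lerp p0 p1)); first exact: clamp_continuous.
  by apply: continuous_comp; [exact: lerp_continuous|exact: ck].
split.
  by apply: set_val_eq; rewrite corestrictE /f clamp_id ?lexx ?ler01// lerp0 kh.
move=> t /andP[t0 t1]; rewrite corestrictE /f clamp_id; last by rewrite t1 ltW.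
move=> /(UA _ (Uk _)); rewrite hk lerp2E /= hx0 add0r subr0 => /eqP.
by rewrite mulf_eq0 !gt_eqF//; lra.
Qed.

Section ChartBox.
Variables (U : set S) (h : S -> R * R) (k : R * R -> S) (p : R * R) (e : R).
Hypothesis sU : straightens U h A.
Hypothesis ck : continuous k.
Hypothesis kh : forall x, U x -> k (h x) = x.
Hypothesis Uk : forall q, U (k q).
Hypothesis hk : forall q, h (k q) = q.
Hypothesis e0 : 0 < e.
Hypothesis eX : forall q, `|q.1 - p.1| <= e -> `|q.2 - p.2| <= e -> X (k q).

(** Retraction of the plane onto a closed box, which turns the chart into a map from the whole plane
    to X, as affine simplices require. *)
Definition clamp2 (q : R * R) : R * R :=
  (clamp (p.1 - e) (p.1 + e) q.1, clamp (p.2 - e) (p.2 + e) q.2).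

Let ee (a : R) : a - e <= a + e. Proof. by move: e0 => e0'; lra. Qed.

Lemma clamp2_X q : X (k (clamp2 q)).
Proof.
apply: eX; rewrite ler_distl; have /andP[? ?] := clamp_itv q.1 (ee p.1);
  have /andP[? ?] := clamp_itv q.2 (ee p.2); rewrite /=; apply/andP; split => //.
Qed.

Lemma clamp2_id q : box p e q -> clamp2 q = q.
Proof.
case: q => q1 q2 [/=]; rewrite !ltr_distl => /andP[? ?] /andP[? ?].
by rewrite /clamp2/= !clamp_id//; apply/andP; split; lra.
Qed.

Lemma clamp2_continuous : continuous clamp2.
Proof.
move=> q; apply: (@cvg_pair _ _ _ _ (nbhs (clamp2 q).1) (nbhs (clamp2 q).2)).
  apply: (@continuous_comp _ _ _ fst (clamp (p.1 - e) (p.1 + e))); first exact: cvg_fst.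
  exact: clamp_continuous.
apply: (@continuous_comp _ _ _ snd (clamp (p.2 - e) (p.2 + e))); first exact: cvg_snd.
exact: clamp_continuous.
Qed.

Definition chart_map : R * R -> X := corestrict clamp2_X.

Lemma chart_map_continuous : continuous chart_map.
Proof.
apply: corestrict_continuous => q.
by apply: (@continuous_comp _ _ _ clamp2 k); [exact: clamp2_continuous|exact: ck].
Qed.

Lemma chart_map_in q : box p e q -> set_val (chart_map q) = k q.
Proof. by move=> pq; rewrite corestrictE clamp2_id. Qed.

(** The second coordinate is affine along the segment and nonzero at both ends, so it vanishes at
    most once, at an interior time and with nonzero slope. *)
Lemma trans_chart_seg (a b : R * R) : box p e a -> box p e b -> a.2 != 0 -> b.2 != 0 ->
  trans (delta (seg chart_map_continuous a b)).
Proof.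
move=> pa pb a0 b0; apply: trans_delta.
set s := seg _ _ _.
have sE x : set_val (s x) = k (lerp a b (sing_time x)).
  by rewrite segE chart_map_in//; apply: lerp_box => //; exact: time_itv.
have hitE x : hits s A x -> a.2 + sing_time x * (b.2 - a.2) = 0.
  by rewrite /hits /= sE => /(sU.2 _ (Uk _)); rewrite hk.
have ab x : hits s A x -> b.2 - a.2 != 0.
  by move=> /hitE; apply: contra_eq_neq => ->; rewrite mulr0 addr0.
split.
  have [[x hx]|nh] := pselect (exists x, hits s A x); last first.
    rewrite (_ : hits s A = set0)//; apply/seteqP; split => // x hx.
    by apply: nh; exists x.
  apply: (@sub_finite_set _ _ [set x]); last exact: finite_set1.
  move=> y hy; apply: time_inj; apply: (mulIf (ab _ hx)).
  by apply: (addrI a.2); rewrite !hitE.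
move=> x hx; have tx := hitE _ hx; have abx := ab _ hx; split.
  have /andP[t0 t1] := time_itv x; rewrite !lt_neqAle t0 t1 !andbT; apply/andP; split.
    by apply: contraNneq a0 => t; move: tx; rewrite -t mul0r addr0 => ->.
  by apply: contraNneq b0 => t; move: tx; rewrite t mul1r addrC subrK => ->.
exists U, h; split => //; first by rewrite sE.
have E y : (sing_time y - sing_time x) * (h (set_val (s y))).2 =
    (sing_time y - sing_time x) ^+ 2 * (b.2 - a.2).
  rewrite sE hk lerp2E expr2 -mulrA; congr (_ * _).
  by rewrite mulrBl -[LHS]subr0 -[X in _ - X]tx opprD addrACA subrr add0r.
have sq y : y <> x -> 0 < (sing_time y - sing_time x) ^+ 2.
  by move=> yx; rewrite exprn_even_gt0//= subr_eq0; apply/eqP => /time_inj.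
move: abx; rewrite neq_lt => /orP[ab0|ab0]; [right|left].
  by apply: (@filterS _ _ (nbhs_filter x) setT) => [y _ /sq ?|];
    [rewrite E pmulr_rlt0|exact: filterT].
by apply: (@filterS _ _ (nbhs_filter x) setT) => [y _ /sq ?|];
    [rewrite E pmulr_rgt0|exact: filterT].
Qed.

(** The straight-line homotopy in the chart, on a square cut into two triangles. Its vertical sides
    are constant paths, which bound. *)
Lemma bounds_straighten (g : R -> X) (cg : continuous (g : R^o -> X)) (a b : R) :
  (forall t, 0 <= t <= 1 -> U (set_val (g (a + t * (b - a)))) /\
     box p e (h (set_val (g (a + t * (b - a)))))) ->
  bounds (delta (seg cg a b) +
    delta (seg chart_map_continuous (h (set_val (g a))) (h (set_val (g b))))).
Proof.
move=> gU.
pose q t := h (set_val (g (a + clamp 0 1 t * (b - a)))).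
have cq : continuous q.
  move=> t; apply: (@continuous_comp _ _ _ (fun t => set_val (g (a + clamp 0 1 t * (b - a)))) h).
    apply: (@continuous_comp _ _ _ (fun t => g (a + clamp 0 1 t * (b - a))) set_val).
      apply: (@continuous_comp _ _ _ (fun t => a + clamp 0 1 t * (b - a)) g); last exact: cg.
      apply: fun_continuousD; first exact: cst_continuous.
      apply: fun_continuousM; last exact: cst_continuous.
      exact: clamp_continuous.
    exact: set_val_continuous.
  apply: (chart_continuous sU.1).
  by have [] := gU _ (clamp_itv t (@ler01 R)).
have bq t : box p e (q t) by have [] := gU _ (clamp_itv t (@ler01 R)).
have q0 : q 0 = h (set_val (g a)) by rewrite /q clamp_id ?lexx ?ler01// mul0r addr0.
have q1 : q 1 = h (set_val (g b)) by rewrite /q clamp_id ?lexx ?ler01// mul1r addrC subrK.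
pose H (r : R * R) := chart_map (q r.1 + r.2 *: (lerp (q 0) (q 1) r.1 - q r.1)).
have cq1 : continuous (fun r : R * R => q r.1).
  by move=> r; apply: (@continuous_comp _ _ _ fst q); [exact: cvg_fst|exact: cq].
have cH : continuous H.
  move=> r; apply: (@continuous_comp _ _ _ (fun r : R * R => q r.1 + r.2 *: (lerp (q 0) (q 1)
    r.1 - q r.1)) chart_map); last exact: chart_map_continuous.
  apply: fun_continuousD => //; apply: fun_continuousZ; first by move=> r'; exact: cvg_snd.
  apply: fun_continuousB => // r'.
  by apply: (@continuous_comp _ _ _ fst (lerp (q 0) (q 1)));
    [exact: cvg_fst|exact: lerp_continuous].
have T1 := bounds_triangle cH (0, 0) (1, 0) (1, 1).
have T2 := bounds_triangle cH (0, 0) (0, 1) (1, 1).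
have L (a1 a2 b1 b2 t : R) : (a1, a2) + t *: ((b1, b2) - (a1, a2)) =
    (a1 + t * (b1 - a1), a2 + t * (b2 - a2)) :> R * R by [].
have E1 : seg cH (0, 0) (1, 0) = seg cg a b.
  apply/continuousEP => x; rewrite !segE L /H /=.
  rewrite subr0 subrr !mulr0 !addr0 add0r scale0r addr0 mulr1.
  apply: set_val_eq; rewrite chart_map_in// /q clamp_id ?time_itv// kh//.
  by have [] := gU _ (time_itv x).
have E2 : seg cH (0, 1) (1, 1) =
    seg chart_map_continuous (h (set_val (g a))) (h (set_val (g b))).
  apply/continuousEP => x; rewrite !segE L /H /=.
  rewrite subr0 subrr !mulr0 !addr0 add0r mulr1 scale1r addrC subrK -q0 -q1.
  by [].
have E3 : seg cH (1, 0) (1, 1) = seg chart_map_continuous (q 1) (q 1).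
  apply/continuousEP => x; rewrite !segE L /H /=.
  by rewrite subrr mulr0 addr0 lerp1 !subrr !scaler0 !addr0.
have E4 : seg cH (0, 0) (0, 1) = seg chart_map_continuous (q 0) (q 0).
  apply/continuousEP => x; rewrite !segE L /H /=.
  by rewrite subrr mulr0 addr0 lerp0 !subrr !scaler0 !addr0.
rewrite E1 E3 in T1; rewrite E2 E4 in T2.
have := boundsD (boundsD T1 (bounds_const chart_map_continuous (q 1)))
  (boundsD T2 (bounds_const chart_map_continuous (q 0))).
set d0 := delta _; set d1 := delta _; set d2 := delta _; set d3 := delta _; set d4 := delta _.
have -> : d0 + d1 + d2 + d1 + (d3 + d4 + d2 + d3) =
  d0 + d4 + (d1 + d1) + (d2 + d2) + (d3 + d3).
  by apply/funext => t; rewrite -[LHS]/((d0 t + d1 t + d2 t + d1 t) + (d3 t + d4 t + d2 t + d3 t))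
   -[RHS]/(d0 t + d4 t + (d1 t + d1 t) + (d2 t + d2 t) + (d3 t + d3 t)); ring.
by rewrite !addfF2xx !addr0.
Qed.

End ChartBox.


Arguments chart_map_continuous [k p e] ck e0 eX [x t] _.

(** * Corrections at the endpoints of simplices *)

Section Exits.
Variable mu : X -> R -> X.
Hypothesis cmu : forall x : X, continuous (mu x : R^o -> X).
Hypothesis mu0 : forall x, mu x 0 = x.
Hypothesis muA : forall x t, 0 < t <= 1 -> ~ A (set_val (mu x t)).

Definition exit (x : X) : SX := seg (@cmu x) 0 1.

Lemma exit_avoid x : ~ A (set_val x) -> trans (delta (exit x)).
Proof.
move=> nA; apply: trans_avoid => y; rewrite segE add0r subr0.
have /andP[t0 t1] := time_itv y; rewrite -[_ *: _]/(_ * _) mulr1.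
have [t|t] := eqVneq (sing_time y) 0; first by rewrite t mu0.
by apply: muA; rewrite t1 lt_neqAle eq_sym t t0.
Qed.

(** The exit path is cut at a time t for which the initial part stays in the box, where it can be
    straightened; the remaining part avoids A. *)
Lemma chart_exit (U : set S) (h : S -> R * R) (k : R * R -> S) (p : R * R) (e : R)
    (sU : straightens U h A) (ck : continuous k) (kh : forall x, U x -> k (h x) = x)
    (Uk : forall q, U (k q)) (hk : forall q, h (k q) = q) (e0 : 0 < e)
    (eX : forall q, `|q.1 - p.1| <= e -> `|q.2 - p.2| <= e -> X (k q)) (x : X) :
  U (set_val x) -> box p e (h (set_val x)) ->
  exists q, [/\ box p e q, q.2 != 0 &
    trans (delta (exit x) + delta (seg (chart_map_continuous ck e0 eX) (h (set_val x)) q))].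
Proof.
move=> Ux bx; have [[oU _ _] _] := sU.
have nb : \forall z \near set_val x, U z /\ box p e (h z).
  have : box p e (h (set_val x)) /\ exists2 d, 0 < d & box (h (set_val x)) d `<=` box p e.
    split => //; case: bx; move: (h (set_val x)) => [q1 q2] /= b1 b2.
    exists (Num.min (e - `|q1 - p.1|) (e - `|q2 - p.2|)).
      by rewrite lt_min !subr_gt0 b1 b2.
    move=> [r1 r2] [/=]; rewrite !lt_min => /andP[c1 _] /andP[_ c2]; split => /=.
      by have := ler_distD q1 r1 p.1; lra.
    by have := ler_distD q2 r2 p.2; lra.
  move=> [_ [d d0 dp]]; apply: filterS (chart_box sU.1 Ux d0) => z [Uz bz].
  by split => //; exact: dp.
have cv : continuous (fun t : R => set_val (mu x t)).
  move=> t; apply: (@continuous_comp _ _ _ (mu x) set_val); first exact: cmu.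
  exact: set_val_continuous.
have : \forall t \near (0 : R), U (set_val (mu x t)) /\ box p e (h (set_val (mu x t))).
  by apply: (near_preimage cv (P := fun z => U z /\ box p e (h z))); rewrite mu0.
move=> /nbhs_ballP[d /= d0 dU].
pose t := Num.min (d / 2) 1.
have t0 : 0 < t by rewrite lt_min divr_gt0 ?ltr01.
have t1 : t <= 1 by rewrite ge_min lexx orbT.
have td : t < d by rewrite gt_min; apply/orP; left; lra.
have Ut v : 0 <= v <= t -> U (set_val (mu x v)) /\ box p e (h (set_val (mu x v))).
  move=> /andP[v0 vt]; apply: dU; rewrite /ball/= sub0r normrN ger0_norm//.
  exact: le_lt_trans td.
have [Utt btt] : U (set_val (mu x t)) /\ box p e (h (set_val (mu x t))).
  by apply: Ut; rewrite lexx ltW.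
exists (h (set_val (mu x t))); split => //.
  apply/eqP => /(sU.2 _ Utt); apply: muA; by rewrite t0.
have B1 := bounds_triangle (@cmu x) 0 t 1.
have B2 : bounds (delta (seg (@cmu x) 0 t) +
    delta (seg (chart_map_continuous ck e0 eX) (h (set_val (mu x 0))) (h (set_val (mu x t))))).
  apply: (bounds_straighten sU ck kh e0 eX) => v /andP[v0 v1]; rewrite add0r subr0.
  by apply: Ut; rewrite mulr_ge0 ?(ltW t0)//= ger_pMl.
have T3 : trans (delta (seg (@cmu x) t 1)).
  apply: trans_avoid => y; rewrite segE; apply: muA; rewrite -[_ *: _]/(_ * _).
  have /andP[y0 y1] := time_itv y; apply/andP; split.
    by have : 0 <= sing_time y * (1 - t) by [rewrite mulr_ge0// subr_ge0]; lra.
  have : sing_time y * (1 - t) <= 1 - t by rewrite ler_piMl// subr_ge0.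
  lra.
apply: (trans_cong _ T3).
have := boundsD B1 B2; rewrite mu0 /exit.
set d0' := delta _; set d1 := delta _; set d2 := delta _; set d3 := delta _.
have -> : d0' + d1 + d2 + (d0' + d3) = d2 + d3 + d1 + (d0' + d0') by ring.
by rewrite addfF2xx addr0.
Qed.

(** Near a point off A everything avoids A. At a point of A all is done in one chart: by
    [chart_exit] the exits become straight segments to points a and b off the axis, and modulo
    boundaries the whole sum becomes the segment from a to b, which is transverse. *)
Lemma trans_local (g : R -> X) (cg : continuous (g : R^o -> X)) (t : R) :
  \forall u \near t, trans (delta (seg cg t u) + delta (exit (g t)) + delta (exit (g u))).
Proof.
have cv : continuous (fun u : R => set_val (g u)).
  move=> u; apply: (@continuous_comp _ _ _ g set_val); first exact: cg.
  exact: set_val_continuous.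
have ball_seg d u y : 0 < d -> `|t - u| < d -> 0 <= y <= 1 -> ball t d (t + y * (u - t)).
  move=> d0 tu /andP[y0 y1]; rewrite /ball/= opprD addrA subrr add0r normrN normrM.
  rewrite (ger0_norm y0); apply: le_lt_trans tu; rewrite distrC.
  by rewrite ler_piMl.
have [At|nAt] := pselect (A (set_val (g t))); last first.
  have := near_preimage cv (cA (set_valP (g t)) nAt).
  move=> /nbhs_ballP[d /= d0 dA]; apply/nbhs_ballP; exists d => //= u tu.
  apply: transD; last by apply: exit_avoid; exact: dA.
  apply: transD; last exact: exit_avoid.
  apply: trans_avoid => y; rewrite segE; apply: dA.
  by apply: ball_seg => //; exact: time_itv.
have [sU Ux] := chA At; have [k [ck kh Uk hk kW]] := chart_inv sU.1.
move: sU Ux ck kh Uk hk kW; set U := (ch _).1; set h := (ch _).2.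
move=> sU Ux ck kh Uk hk kW.
have nX : nbhs (set_val (g t)) X by apply: open_nbhs_nbhs; split => //; exact: set_valP.
have [e' e0' eX'] := kW _ _ Ux nX.
have ee' : e' / 2 < e' by lra.
pose e := e' / 2; have e0 : 0 < e by rewrite divr_gt0.
set p := h (set_val (g t)) in eX'.
have eX q : `|q.1 - p.1| <= e -> `|q.2 - p.2| <= e -> X (k q).
  by move=> q1 q2; apply: eX'; split; [exact: le_lt_trans q1 ee'|exact: le_lt_trans q2 ee'].
have := near_preimage cv (chart_box sU.1 Ux e0).
move=> /nbhs_ballP[d /= d0 dU]; apply/nbhs_ballP; exists d => //= u tu.
have [Uu bu] := dU _ tu.
have [_ bt] := dU _ (ballxx t d0).
have [a [ba a0 Ta]] := chart_exit sU ck kh Uk hk e0 eX Ux bt.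
have [b [bb b0 Tb]] := chart_exit sU ck kh Uk hk e0 eX Uu bu.
have B1 : bounds (delta (seg cg t u) +
    delta (seg (chart_map_continuous ck e0 eX) (h (set_val (g t))) (h (set_val (g u))))).
  apply: (bounds_straighten sU ck kh e0 eX) => v v01.
  by apply: dU; exact: ball_seg.
have T4 := trans_chart_seg sU ck Uk hk e0 eX ba bb a0 b0.
have B2 := bounds_triangle (chart_map_continuous ck e0 eX) (h (set_val (g t))) (h (set_val (g
  u))) b.
have B3 := bounds_triangle (chart_map_continuous ck e0 eX) (h (set_val (g t))) a b.
have := transD (transD (transD Ta Tb) T4) (trans_bounds (boundsD B1 (boundsD B2 B3))).
set x0 := delta _; set x1 := delta _; set x2 := delta _; set x3 := delta _.
set x4 := delta _; set x5 := delta _; set x6 := delta _; set x7 := delta _.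
have -> : x0 + x1 + (x2 + x3) + x4 + (x5 + x6 + (x6 + x3 + x7 + (x1 + x4 + x7))) =
   x5 + x0 + x2 + (x1 + x1) + (x3 + x3) + (x4 + x4) + (x6 + x6) + (x7 + x7) by ring.
by rewrite !addfF2xx !addr0.
Qed.

Lemma trans_exits (s : SX) : trans (delta s + delta (exit (s (vtx R ord0))) +
  delta (exit (s (vtx R ord_max)))).
Proof.
pose g t := s (at_time t).
have cg : continuous (g : R^o -> X).
  move=> t; apply: (@continuous_comp _ _ _ (@at_time R) s); first exact: at_time_continuous.
  exact: cts_fun.
have sg : s = seg cg 0 1.
  apply/continuousEP => x; rewrite segE add0r subr0 -[_ *: _]/(_ * _) mulr1 /g.
  by rewrite at_timeK.
have g0 : g 0 = s (vtx R ord0) by rewrite /g -(time_vtx0 R) at_timeK.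
have g1 : g 1 = s (vtx R ord_max) by rewrite /g -(time_vtx1 R) at_timeK.
rewrite -g0 -g1 {1}sg.
apply: (@segment_chain R (fun u v => trans (delta (seg cg u v) + delta (exit (g u)) + delta
  (exit (g v))))) => //.
  move=> u v w Tu Tv.
  have := transD (transD Tu Tv) (trans_bounds (bounds_triangle cg u v w)).
  set x0 := delta _; set x1 := delta _; set x2 := delta _; set x3 := delta _.
  set x4 := delta _; set x5 := delta _.
  have -> : x0 + x1 + x2 + (x3 + x2 + x4) + (x0 + x3 + x5) =
    x5 + x1 + x4 + (x0 + x0) + (x2 + x2) + (x3 + x3) by ring.
  by rewrite !addfF2xx !addr0.
move=> t _; apply: filterS (trans_local cg t) => u Tu _; split => //.
have := transD Tu (trans_bounds (bounds_sym cg t u)).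
set x0 := delta _; set x1 := delta _; set x2 := delta _; set x3 := delta _.
have -> : x0 + x1 + x2 + (x0 + x3) = x3 + x2 + x1 + (x0 + x0) by ring.
by rewrite addfF2xx addr0.
Qed.

(** Each simplex becomes transverse modulo boundaries after adding the exits of its two ends. An
    exit depends on the endpoint only, so in a cycle the added exits cancel by [cycle_pairing]. *)
Lemma trans_cycle (z : SX -> 'F_2) : cycle1 z -> trans z.
Proof.
move=> cz; have /chain_bears[B Bz] := cz.1.
pose G s := delta s + delta (exit (s (vtx R ord0))) + delta (exit (s (vtx R ord_max))).
have -> : z = fun t => \sum_(s <- B) z s * G s t.
  apply/funext => t.
  pose phi x := delta (exit x) t.
  have := cycle_pairing phi cz; rewrite (pairing_bears _ Bz) => E.
  rewrite -[LHS]addr0 -[X in _ + X = _]E.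
  have -> : z t = \sum_(s <- B) z s * delta s t.
    have [tB|tB] := boolP (t \in B).
      rewrite (big_fsetD1 _ tB)/= /delta eqxx mulr1 big_seq big1 ?addr0// => s.
      by rewrite in_fsetD1 => /andP[/negbTE -> _]; rewrite mulr0.
    rewrite Bz// big_seq big1// => s sB; rewrite /delta.
    by case: eqP => [st|]; rewrite ?mulr0//; rewrite -st sB in tB.
  rewrite -big_split/=; apply: eq_bigr => s _; rewrite -mulrDr; congr (_ * _).
  rewrite -[RHS]/(delta s t + phi (s (vtx R ord0)) + phi (s (vtx R ord_max))).
  by rewrite -addrA [X in _ = _ + X]addrC.
elim: (enum_fset B) => [|s r IH].
  rewrite (_ : (fun _ => _) = 0); first exact: trans_bounds (bounds0 _ _).
  by apply/funext => t; rewrite big_nil.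
rewrite (_ : (fun _ => _) = (fun t => z s * G s t) + (fun t => \sum_(s <- r) z s * G s t)).
  apply: transD => //; have [zs|zs] := eqVneq (z s) 0.
    rewrite (_ : (fun _ => _) = 0); first exact: trans_bounds (bounds0 _ _).
    by apply/funext => t; rewrite zs mul0r.
  rewrite (_ : (fun _ => _) = G s); first exact: trans_exits.
  apply/funext => t; rewrite (_ : z s = 1) ?mul1r//.
  by move: zs; case: (z s) => -[|[|//]] i; rewrite -?val_eqE//= => _; exact/val_inj.
by apply/funext => t; rewrite big_cons.
Qed.

End Exits.

Lemma transverse_cycle (z : SX -> 'F_2) : cycle1 z ->
  exists z', [/\ cycle1 z', homologous1 z z' & transverse z' A].
Proof.
move=> cz.
have /choice[mu Hmu] : forall x : X, exists g : R -> X, continuous g /\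
    g 0 = x /\ forall t, 0 < t <= 1 -> ~ A (set_val (g t)).
  by move=> x; have [g] := leaving_path x; exists g.
have [] := @trans_cycle mu (fun x => (Hmu x).1) (fun x => (Hmu x).2.1) (fun x => (Hmu x).2.2) z cz.
move=> w [cw tw [b cb zw]].
have hzw : homologous1 z w by exists b => //; rewrite subF2 addrC.
by exists w; split => //; exact: homologous_cycle hzw.
Qed.

End TransverseCycle.

(** * Cohomology of the punctured plane *)

Definition exact_on (T : topologicalType) (D : T -> T -> bool) (X : set T) :=
  exists g, forall x, X x -> prim D g x.

Lemma subtype_near (S : topologicalType) (X : set S) (x : X) (P : X -> Prop) : open X ->
  (\forall z \near x, P z) ->
  \forall w \near set_val x, forall Xw : X w, P (SigSub (mem_set Xw)).
Proof.
move=> oX [_ /= [[W oW <-] /= Wx WP]].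
apply: filterS (open_nbhs_nbhs (conj oW Wx)) => w Ww Xw.
by apply: WP.
Qed.

Lemma near_neq (R : realType) (a c : R) : a != c -> \forall z \near a, z != c.
Proof.
rewrite neq_lt => /orP[ac|ac]; [move: (lt_nbhsl ac)|move: (lt_nbhsr ac)];
  by apply: filterS => z zc; rewrite ?(lt_eqF zc) ?(gt_eqF zc).
Qed.

Section PlaneCohomology.
Variable R : realType.
Implicit Types (p q : R * R) (D : R * R -> R * R -> bool) (U : set (R * R)).

Let fst_cts : continuous (fst : R * R -> R). Proof. by move=> q; exact: cvg_fst. Qed.
Let snd_cts : continuous (snd : R * R -> R). Proof. by move=> q; exact: cvg_snd. Qed.

Lemma lerp_const_plane (f : R * R -> bool) p q :
  (forall t, 0 <= t <= 1 -> locally_const f (lerp p q t)) -> f p = f q.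
Proof. by move=> lf; apply: (@lerp_const R _ f id) => //; move=> ? ?. Qed.

Lemma star_exact U q0 D : open U -> U q0 ->
  (forall q t, U q -> 0 <= t <= 1 -> U (lerp q0 q t)) ->
  (forall q, U q -> exact_at D q) -> exact_on D U.
Proof.
move=> oU Uq0 star eD.
have cU (q : U * R) : U (lerp q0 (set_val q.1) (clamp 0 1 q.2)).
  by apply: star; [exact: set_valP|exact: clamp_itv].
have x0 : U := SigSub (mem_set Uq0).
have [||||g gp] := @poincare R U (fun x z => D (set_val x) (set_val z)) (corestrict cU)
  (SigSub (mem_set Uq0)).
- apply: corestrict_continuous; apply: fun_continuousD; first by move=> q; exact: cvg_cst.
  apply: fun_continuousZ.
    move=> q; apply: (@continuous_comp _ _ _ snd (clamp 0 1)); first exact: cvg_snd.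
    exact: clamp_continuous.
  apply: fun_continuousB; last by move=> q; exact: cvg_cst.
  move=> q; apply: (@continuous_comp _ _ _ fst set_val); first exact: cvg_fst.
  exact: set_val_continuous.
- by move=> x; apply: set_val_eq; rewrite corestrictE/= clamp_id ?lexx ?ler01// lerp0.
- by move=> x; apply: set_val_eq; rewrite corestrictE/= clamp_id ?lexx ?ler01// lerp1.
- move=> x; apply: exact_pull; first exact: set_val_continuous.
  by apply: eD; exact: set_valP.
pose g' q := if pselect (U q) is left Uq then g (SigSub (mem_set Uq)) else false.
have g'E q (Uq : U q) : g' q = g (SigSub (mem_set Uq)).
  by rewrite /g'; case: pselect => // Uq'; congr g; exact: set_val_eq.
exists g' => q Uq.
have := subtype_near oU (gp (SigSub (mem_set Uq))).
apply: filterS2 (open_nbhs_nbhs (conj oU Uq)) => w Uw /(_ Uw).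
by rewrite !g'E.
Qed.

Lemma slit_open p (P : R -> bool) : (forall a, P a -> \forall b \near a, P b) ->
  open [set q : R * R | q.2 != p.2 \/ P q.1].
Proof.
move=> oP; rewrite openE => q; rewrite /interior => -[q2|q1].
  by apply: filterS (near_preimage snd_cts (x := q) (near_neq q2)) => w; left.
by apply: filterS (near_preimage fst_cts (x := q) (oP _ q1)) => w; right.
Qed.

Lemma slit_open1 p : open [set q : R * R | q.2 != p.2 \/ p.1 < q.1].
Proof. by apply: (@slit_open p (fun a => p.1 < a)) => a; exact: lt_nbhsr. Qed.

Lemma slit_open2 p : open [set q : R * R | q.2 != p.2 \/ q.1 < p.1].
Proof. by apply: (@slit_open p (fun a => a < p.1)) => a; exact: lt_nbhsl. Qed.

(* The class [a (+) b] of D in H^1 of the punctured plane. *)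
Definition slit_class D p (g1 g2 : R * R -> bool) (a b : bool) :=
  [/\ forall q, q.2 != p.2 \/ p.1 < q.1 -> prim D g1 q,
      forall q, q.2 != p.2 \/ q.1 < p.1 -> prim D g2 q,
      forall q, p.2 < q.2 -> g1 q (+) g2 q = a &
      forall q, q.2 < p.2 -> g1 q (+) g2 q = b].

(** Mayer-Vietoris for two slit planes, star-shaped about points to the right and to the left of p.
    They overlap in the open half-planes above and below p, which are convex, so the difference of
    the primitives is constant on each. *)
Lemma slit_class_exists D p : (forall q, q <> p -> exact_at D q) ->
  exists g1 g2 a b, slit_class D p g1 g2 a b.
Proof.
move=> eD.
have [||||g1 g1p] := @star_exact [set q | q.2 != p.2 \/ p.1 < q.1] (p.1 + 1, p.2) D.
- exact: slit_open1.
- by right; rewrite /= ltrDl.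
- move=> q t [q2|q1] /andP[t0 t1].
    have [->|tn0] := eqVneq t 0; first by right; rewrite lerp0 ltrDl.
    by left; rewrite lerp2E -subr_eq0 addrAC subrr add0r mulf_neq0// subr_eq0.
  by right; rewrite lerp1E; apply: lerp_gt; rewrite ?t0// ltrDl.
- by move=> q [] qp; apply: eD => qE; rewrite qE ?eqxx ?ltxx in qp.
have [||||g2 g2p] := @star_exact [set q | q.2 != p.2 \/ q.1 < p.1] (p.1 - 1, p.2) D.
- exact: slit_open2.
- by right; rewrite /= gtrBl.
- move=> q t [q2|q1] /andP[t0 t1].
    have [->|tn0] := eqVneq t 0; first by right; rewrite lerp0 gtrBl.
    by left; rewrite lerp2E -subr_eq0 addrAC subrr add0r mulf_neq0// subr_eq0.
  by right; rewrite lerp1E; apply: lerp_lt; rewrite ?t0// gtrBl.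
- by move=> q [] qp; apply: eD => qE; rewrite qE ?eqxx ?ltxx in qp.
have lc q : q.2 != p.2 -> locally_const (fun q => g1 q (+) g2 q) q.
  by move=> q2; apply: prim_diff; [apply: g1p|apply: g2p]; left.
pose u := (p.1, p.2 + 1); pose l := (p.1, p.2 - 1).
exists g1, g2, (g1 u (+) g2 u), (g1 l (+) g2 l); split => //.
  move=> q qp; apply: (@lerp_const_plane (fun q => g1 q (+) g2 q)) => t t01.
  by apply: lc; rewrite gt_eqF// lerp2E lerp_gt// ltrDl.
move=> q qp; apply: (@lerp_const_plane (fun q => g1 q (+) g2 q)) => t t01.
by apply: lc; rewrite lt_eqF// lerp2E lerp_lt// gtrBl.
Qed.

Lemma slit_class_exact D p g1 g2 a b : slit_class D p g1 g2 a b -> a = b ->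
  exact_on D [set q | q <> p].
Proof.
move=> [p1 p2 Ha Hb] ab; subst b.
pose u q := (q.2 != p.2) || (p.1 < q.1).
exists (fun q => if u q then g1 q else g2 q (+) a) => q qp.
have [uq|nuq] := boolP (u q).
  apply: (prim_near (f := g1) (k := false)); first by apply: p1; apply/orP.
  have : nbhs q [set q : R * R | q.2 != p.2 \/ p.1 < q.1].
    by apply: open_nbhs_nbhs; split; [exact: slit_open1|apply/orP].
  by apply: filterS => w /orP; rewrite -/(u w) => ->; rewrite addbF.
move: nuq; rewrite negb_or negbK -leNgt => /andP[/eqP q2 q1].
have q1' : q.1 < p.1.
  rewrite lt_neqAle q1 andbT; apply/eqP => q1E; apply: qp.
  by case: q p q1E q2 {q1 Ha Hb p1 p2 u} => [? ?] [? ?] /= -> ->.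
apply: (prim_near (f := g2) (k := a)); first by apply: p2; right.
have := near_preimage fst_cts (x := q) (lt_nbhsl q1').
apply: filterS => w w1; case: ifP => // uw.
have : g1 w (+) g2 w = a.
  move: uw; rewrite /u ltNge (ltW w1) orbF neq_lt => /orP[] ?; [exact: Hb|exact: Ha].
by move=> <-; rewrite addbC addbK.
Qed.

(** If a differs from b and a' from b', then a + a' equals b + b' in F_2. *)
Lemma inexact_sum D D' p : (forall q, q <> p -> exact_at D q) ->
  (forall q, q <> p -> exact_at D' q) ->
  ~ exact_on D [set q | q <> p] -> ~ exact_on D' [set q | q <> p] ->
  exact_on (fun x z => D x z (+) D' x z) [set q | q <> p].
Proof.
move=> /slit_class_exists[g1 [g2 [a [b C]]]] /slit_class_exists[g1' [g2' [a' [b' C']]]] nD nD'.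
have ab : a <> b by move=> /(slit_class_exact C).
have ab' : a' <> b' by move=> /(slit_class_exact C').
have [p1 p2 Ha Hb] := C; have [p1' p2' Ha' Hb'] := C'.
have pD g g' q : prim D g q -> prim D' g' q ->
    prim (fun x z => D x z (+) D' x z) (fun z => g z (+) g' z) q.
  by apply: filterS2 => z -> ->; rewrite addbACA.
apply: (@slit_class_exact _ _ (fun z => g1 z (+) g1' z) (fun z => g2 z (+) g2' z)
  (a (+) a') (b (+) b')).
  split => q H.
  - by apply: pD; [exact: p1|exact: p1'].
  - by apply: pD; [exact: p2|exact: p2'].
  - by rewrite addbACA Ha// Ha'.
  - by rewrite addbACA Hb// Hb'.
by move: ab ab'; case: (a); case: (a'); case: (b); case: (b').
Qed.

(** Comparison along the boundary of a square around p: f is compared with [g1] over the right half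
    and with [g2] over the left half. Both ways from the top to the bottom give the same change of
    f, whence a = b. *)
Lemma exact_outside D p f (r : R) : (forall q, q <> p -> exact_at D q) -> 0 < r ->
  (forall q, r <= `|q.1 - p.1| \/ r <= `|q.2 - p.2| -> prim D f q) ->
  exact_on D [set q | q <> p].
Proof.
move=> /slit_class_exists[g1 [g2 [a [b C]]]] r0 fp.
apply: (slit_class_exact C); have [p1 p2 Ha Hb] := C.
pose P (x y : R) := (p.1 + x * r, p.2 + y * r).
have step (g : R * R -> bool) (x y x' y' : R) :
    (forall t, 0 <= t <= 1 -> let q := lerp (P x y) (P x' y') t in
       (r <= `|q.1 - p.1| \/ r <= `|q.2 - p.2|) /\ prim D g q) ->
    g (P x y) (+) f (P x y) = g (P x' y') (+) f (P x' y').
  move=> H; apply: (@lerp_const_plane (fun q => g q (+) f q)) => t t01.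
  by have [H1 H2] := H _ t01; exact: (prim_diff H2 (fp _ H1)).
have n1 (x u v : R) : `|x| = 1 -> u - v = x * r -> r <= `|u - v|.
  by move=> x1 ->; rewrite normrM x1 mul1r gtr0_norm.
have N1 : `|1 : R| = 1 by rewrite normr1.
have NN1 : `|- 1 : R| = 1 by rewrite normrN normr1.
have around (g : R * R -> bool) (s : R) : `|s| = 1 ->
    (forall q, q.2 != p.2 \/ q.1 - p.1 = s * r -> prim D g q) ->
    g (P 0 1) (+) f (P 0 1) = g (P 0 (- 1)) (+) f (P 0 (- 1)).
  move=> s1 pg.
  rewrite (step g 0 1 s 1); last first.
    move=> t t01 q; have q2 : q.2 - p.2 = 1 * r by rewrite /q lerp2E /=; ring.
    split; first by right; exact: n1 q2.
    by apply: pg; left; rewrite -subr_eq0 q2 mul1r gt_eqF.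
  rewrite (step g s 1 s (- 1)); last first.
    move=> t t01 q; have q1 : q.1 - p.1 = s * r by rewrite /q lerp1E /=; ring.
    by split; [left; exact: n1 q1|apply: pg; right].
  rewrite (step g s (- 1) 0 (- 1))//.
  move=> t t01 q; have q2 : q.2 - p.2 = - 1 * r by rewrite /q lerp2E /=; ring.
  split; first by right; exact: n1 q2.
  by apply: pg; left; rewrite -subr_eq0 q2 mulN1r oppr_eq0 gt_eqF.
have E1 : g1 (P 0 1) (+) f (P 0 1) = g1 (P 0 (- 1)) (+) f (P 0 (- 1)).
  apply: (around _ 1 N1) => q [q2|q1]; apply: p1; first by left.
  by right; rewrite -subr_gt0 q1 mul1r.
have E2 : g2 (P 0 1) (+) f (P 0 1) = g2 (P 0 (- 1)) (+) f (P 0 (- 1)).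
  apply: (around _ (- 1) NN1) => q [q2|q1]; apply: p2; first by left.
  by right; rewrite -subr_lt0 q1 mulN1r oppr_lt0.
rewrite -(Ha (P 0 1)) -?(Hb (P 0 (- 1))) /P /=; last 2 first.
- by rewrite mulN1r gtrBl.
- by rewrite mul1r ltrDl.
rewrite -!/(P _ _); move: E1 E2.
by case: (g1 _); case: (g1 _); case: (g2 _); case: (g2 _); case: (f _); case: (f _).
Qed.

End PlaneCohomology.

(** * Transport to punctured open cells *)

Section Cells.
Variables (R : realType) (S : topologicalType) (F : set S) (h : S -> R * R).
Hypothesis Fh : plane_chart F h.
Implicit Types D : S -> S -> bool.

Lemma cell_exact D (k : R * R -> S) v : continuous k -> (forall x, F x -> k (h x) = x) ->
  (forall p, F (k p)) -> (forall p, h (k p) = p) -> F v ->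
  exact_on (fun p q => D (k p) (k q)) [set q | q <> h v] <->
  exact_on D [set x | F x /\ x <> v].
Proof.
move=> ck kh Fk hk Fv; split=> [[g gp]|[g gp]].
  exists (g \o h) => x [Fx xv].
  have hxv : h x <> h v by move=> /(congr1 k); rewrite !kh.
  have := near_preimage_at (chart_continuous Fh Fx) (gp _ hxv).
  have [oF _ _] := Fh.
  by apply: filterS2 (open_nbhs_nbhs (conj oF Fx)) => z Fz /=; rewrite !kh.
exists (g \o k) => q qv; apply: (prim_pull ck); apply: gp; split => //.
by move=> /(congr1 h); rewrite hk.
Qed.

Lemma cell_inexact_sum D D' v : F v ->
  (forall x, F x -> x <> v -> exact_at D x) -> (forall x, F x -> x <> v -> exact_at D' x) ->
  ~ exact_on D [set x | F x /\ x <> v] -> ~ exact_on D' [set x | F x /\ x <> v] ->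
  exact_on (fun x z => D x z (+) D' x z) [set x | F x /\ x <> v].
Proof.
move=> Fv eD eD'; have [k [ck kh Fk hk kW]] := chart_inv Fh.
have T D0 := @cell_exact D0 k v ck kh Fk hk Fv.
move=> /(T D) nD /(T D') nD'; apply/(T (fun x z => D x z (+) D' x z)).
apply: inexact_sum => // q qv; apply: exact_pull => //; [apply: eD|apply: eD'] => //;
  by move=> /(congr1 h); rewrite hk.
Qed.

Lemma cell_exact_outside D (C : set S) p f : F p -> C `<=` F -> compact C ->
  (forall x, F x -> x <> p -> exact_at D x) ->
  (forall x, F x -> ~ C x -> prim D f x) ->
  exact_on D [set x | F x /\ x <> p].
Proof.
move=> Fp CF cC eD fp; have [k [ck kh Fk hk kW]] := chart_inv Fh.
apply/(@cell_exact D k p ck kh Fk hk Fp).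
have hC : compact (h @` C).
  apply: continuous_compact => //.
  by have [_ ch _] := Fh; apply: continuous_subspaceW ch.
have [M [_ MC]] := compact_bounded hC.
have {}MC x : C x -> `|h x| <= `|M| + 1.
  by move=> Cx; apply: MC; [rewrite (le_lt_trans (ler_norm _))// ltrDl|exists x].
(* A point whose distance to [h p] in some coordinate is at least r has norm greater than [|M| + 1],
   the bound for the image of C. *)
pose r := `|M| + 1 + `|h p| + 1.
have r0 : 0 < r by rewrite /r; have := normr_ge0 M; have := normr_ge0 (h p); lra.
apply: (@exact_outside R _ (h p) (f \o k) r) => // [q qp|q qr].
  by apply: exact_pull => //; apply: eD => // /(congr1 h); rewrite hk.
apply: (prim_pull ck); apply: fp => // /MC; rewrite hk => qM.
have q1 : `|q.1| <= `|q| by rewrite prod_normE le_max lexx.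
have q2 : `|q.2| <= `|q| by rewrite prod_normE le_max lexx orbT.
have p1 : `|(h p).1| <= `|h p| by rewrite prod_normE le_max lexx.
have p2 : `|(h p).2| <= `|h p| by rewrite prod_normE le_max lexx orbT.
have n1 := ler_normB q.1 (h p).1; have n2 := ler_normB q.2 (h p).2.
by case: qr; rewrite /r => ?; lra.
Qed.

End Cells.

(** * Arcs of a drawing *)

Section Jumps.
Variables (R : realType) (S : topologicalType) (A : set S).
Variable ch : S -> set S * (S -> R * R).
Hypothesis chA : forall x, A x -> straightens (ch x).1 (ch x).2 A /\ (ch x).1 x.
Implicit Types (f : S -> bool) (x : S) (m : bool).

(** The jump m does not change when the sides of A are swapped, whereas n may; so m can be compared
    along A. *)
Definition jump f x m := exists n, \forall z \near x, ~ A z -> f z = n (+) (m && side ch x z).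

Lemma jump_uniq f x m m' : A x -> jump f x m -> jump f x m' -> m = m'.
Proof.
move=> Ax [n Hn] [n' Hn']; have [s Ux] := chA Ax.
have N : nbhs x [set z | ~ A z -> n (+) (m && side ch x z) = n' (+) (m' && side ch x z)].
  by apply: filterS2 Hn Hn' => z H H' nA; rewrite -H// -H'.
have [z [Hz _ nAz sz]] := near_side true s Ux Ax N.
have [w [Hw _ nAw sw]] := near_side false s Ux Ax N.
move: (Hz nAz) (Hw nAw); rewrite /side sz sw.
by case: (m); case: (m'); case: (n); case: (n').
Qed.

Lemma jump_near f x m : A x -> jump f x m -> \forall w \near x, A w -> jump f w m.
Proof.
move=> Ax [n Hn]; apply: filterS2 (near_join Hn) (near_side_compare chA Ax) => w Hw Hc Aw.
have [k Hk] := Hc Aw; exists (n (+) (m && k)).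
apply: filterS2 Hw Hk => z H H' nA; rewrite H// H'//.
by case: (n); case: (m); case: (k); case: (side _ _ _).
Qed.

Lemma jump_exists f x : A x -> (\forall z \near x, ~ A z -> locally_const f z) ->
  exists m, jump f x m.
Proof.
move=> Ax lf; have [s Ux] := chA Ax.
by have [n [m H]] := two_sides s Ux Ax lf; exists m, n.
Qed.

End Jumps.

Lemma near_not (S : topologicalType) (C : set S) x : closed C -> ~ C x -> \forall z \near x, ~ C z.
Proof. by move=> cC nC; apply: open_nbhs_nbhs; split => //; exact: closed_openC. Qed.

Section Drawing.
Variables (R : realType) (S : topologicalType) (E : finType) (G : drawing R S E).
Hypothesis hS : hausdorff_space S.
Hypothesis emb : embedded_graph G.
Implicit Types (e : E) (t a b : R) (x : S).

Definition gam e t := edge_path G e (clamp 0 1 t).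

Lemma gam_continuous e : continuous (gam e).
Proof.
have [_ /(_ e)/subspace_sigL_continuousP cp _ _ _] := emb.
have cl t : `[0, 1]%classic (clamp 0 1 t : R) by rewrite /= in_itv/= clamp_itv.
move=> t; apply: (@continuous_comp _ _ _ (corestrict cl) (sigL `[0, 1]%classic (edge_path G e))).
  by apply: corestrict_continuous; exact: clamp_continuous.
exact: cp.
Qed.

Lemma gamE e t : 0 <= t <= 1 -> gam e t = edge_path G e t.
Proof. by move=> t01; rewrite /gam clamp_id. Qed.

Lemma open_edgeP e x : open_edge G e x <-> exists2 t, 0 < t < 1 & gam e t = x.
Proof.
split=> [[t /=]|[t /andP[t0 t1] <-]].
  by rewrite in_itv/= => /andP[t0 t1] <-; exists t; rewrite ?t0// gamE// !ltW.
by exists t; rewrite /= ?in_itv/= ?t0// gamE// !ltW.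
Qed.

Lemma open_edge_gam e t : 0 < t < 1 -> open_edge G e (gam e t).
Proof. by move=> t01; apply/open_edgeP; exists t. Qed.

Lemma edgeP e x : edge G e x <-> exists2 t, 0 <= t <= 1 & gam e t = x.
Proof.
split=> [[t /=]|[t t01 <-]].
  by rewrite in_itv/= => t01 <-; exists t => //; rewrite gamE.
by exists t; rewrite /= ?in_itv/= // gamE.
Qed.

Lemma vertex_ends e : vertices G (gam e 0) /\ vertices G (gam e 1).
Proof. by have [_ _ /(_ e) + _ _] := emb; rewrite !gamE ?lexx ?ler01. Qed.

Lemma open_edge_not_vertex e x : open_edge G e x -> ~ vertices G x.
Proof.
have [_ _ _ nv _] := emb.
by move=> [t /= t01 <-]; apply: nv.
Qed.

Lemma edge_open_or_vertex e x : edge G e x -> open_edge G e x \/ vertices G x.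
Proof.
move=> /edgeP[t /andP[t0 t1] <-]; have [v0 v1] := vertex_ends e.
have [->|n0] := eqVneq t 0; first by right.
have [->|n1] := eqVneq t 1; first by right.
by left; apply: open_edge_gam; rewrite !lt_neqAle eq_sym n0 n1 t0 t1.
Qed.

Lemma open_edge_edge e x : open_edge G e x -> edge G e x.
Proof. by move=> /open_edgeP[t /andP[t0 t1] <-]; apply/edgeP; exists t; rewrite ?ltW. Qed.

(** The second parameter may be an end: its point would be a vertex, which never lies on an open
    edge. *)
Lemma gam_inj e e' t t' : 0 < t < 1 -> 0 <= t' <= 1 -> gam e t = gam e' t' -> e = e' /\ t = t'.
Proof.
move=> t01 /andP[t0' t1'] tt'; have nv := open_edge_not_vertex (open_edge_gam e t01).
have [v0 v1] := vertex_ends e'.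
have n0 : t' != 0 by apply: contra_notN nv => /eqP t0; rewrite tt' t0.
have n1 : t' != 1 by apply: contra_notN nv => /eqP t1; rewrite tt' t1.
have t01' : 0 < t' < 1 by rewrite !lt_neqAle eq_sym n0 n1 t0' t1'.
have [_ _ _ _ [inj _]] := emb; apply: inj; rewrite ?in_itv//.
move: tt'; rewrite !gamE//; first by rewrite t0' t1'.
by case/andP: t01 => ? ?; rewrite !ltW.
Qed.

Lemma open_edge_disj e e' x : open_edge G e x -> open_edge G e' x -> e = e'.
Proof.
move=> /open_edgeP[t t01 <-] /open_edgeP[t' /andP[t0' t1'] E'].
by have [] := @gam_inj e e' t t' t01; rewrite ?ltW// E'.
Qed.

Lemma arc_compact e a b : compact (gam e @` `[a, b]%classic).
Proof.
apply: continuous_compact; last exact: segment_compact.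
by apply: continuous_subspaceT; exact: gam_continuous.
Qed.

Lemma arc_closed e a b : closed (gam e @` `[a, b]%classic).
Proof. by apply: compact_closed => //; exact: arc_compact. Qed.

Lemma edge_closed e : closed (edge G e).
Proof.
rewrite (_ : edge G e = gam e @` `[0, 1]%classic); first exact: arc_closed.
apply/seteqP; split => x; first by move=> /edgeP[t t01 <-]; exists t; rewrite //= in_itv.
by move=> [t /=]; rewrite in_itv/= => t01 <-; apply/edgeP; exists t.
Qed.

Lemma vertices_closed : closed (vertices G).
Proof.
have [fV _ _ _ _] := emb.
by apply: compact_closed => //; exact: finite_compact.
Qed.

Definition piece e a b : set S := [set x | exists2 t, a < t < b & gam e t = x].

Lemma piece_sub e a b : 0 <= a -> b <= 1 -> piece e a b `<=` open_edge G e.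
Proof.
move=> a0 b1 x [t /andP[at_ tb] <-]; apply: open_edge_gam.
by rewrite (le_lt_trans a0 at_) (lt_le_trans tb b1).
Qed.

Lemma piece_closed e a b x : ~ piece e a b x -> x <> gam e a -> x <> gam e b ->
  \forall z \near x, ~ piece e a b z.
Proof.
move=> np xa xb; have : ~ (gam e @` `[a, b]%classic) x.
  move=> [t /=]; rewrite in_itv/= => /andP[at_ tb] tx; apply: np; exists t => //.
  by rewrite !lt_neqAle at_ tb !andbT; apply/andP; split; apply/eqP => E0;
    [apply: xa|apply: xb]; rewrite -tx E0.
move=> /(near_not (@arc_closed _ _ _)); apply: filterS => z nz [t /andP[at_ tb] tz].
by apply: nz; exists t => //=; rewrite in_itv/= !ltW.
Qed.

(** The rest of the edge consists of two closed arcs that miss x by injectivity. *)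
Lemma piece_open e a b x : 0 <= a -> b <= 1 -> piece e a b x ->
  \forall z \near x, open_edge G e z -> piece e a b z.
Proof.
move=> a0 b1 [t /andP[at_ tb] tx].
have t01 : 0 < t < 1 by rewrite (le_lt_trans a0 at_) (lt_le_trans tb b1).
have n0 : ~ (gam e @` `[0, a]%classic) x.
  move=> [s /=]; rewrite in_itv/= => /andP[s0 sa] sx.
  have [] := @gam_inj e e t s t01; rewrite ?sx//.
    by rewrite s0 (le_trans sa)// (le_trans (ltW at_))// (le_trans (ltW tb)).
  by move=> _ ts; move: at_; rewrite ts ltNge sa.
have n1 : ~ (gam e @` `[b, 1]%classic) x.
  move=> [s /=]; rewrite in_itv/= => /andP[sb s1] sx.
  have [] := @gam_inj e e t s t01; rewrite ?sx//.
    by rewrite s1 andbT (le_trans a0)// (le_trans (ltW at_))// (le_trans (ltW tb)).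
  by move=> _ ts; move: tb; rewrite ts ltNge sb.
apply: filterS2 (near_not (@arc_closed _ _ _) n0) (near_not (@arc_closed _ _ _) n1).
move=> z z0 z1 /open_edgeP[s /andP[s0 s1] sz]; exists s => //; apply/andP; split.
  by rewrite ltNge; apply/negP => sa; apply: z0; exists s; rewrite //= in_itv/= sa ltW.
by rewrite ltNge; apply/negP => sb; apply: z1; exists s; rewrite //= in_itv/= sb ltW.
Qed.

Lemma edge_charts : exists ch : E -> S -> set S * (S -> R * R), forall e x,
  open_edge G e x -> straightens (ch e x).1 (ch e x).2 (open_edge G e) /\ (ch e x).1 x.
Proof.
have /choice[ch Hch] : forall ex : E * S, exists c : set S * (S -> R * R),
    open_edge G ex.1 ex.2 -> straightens c.1 c.2 (open_edge G ex.1) /\ c.1 ex.2.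
  move=> [e x] /=; have [ox|nox] := pselect (open_edge G e x); last by exists (set0, fun=> 0).
  have [_ _ _ _ [_ tame]] := emb.
  by have [U [h [s Ux]]] := tame _ _ ox; exists (U, h).
by exists (fun e x => ch (e, x)) => e x; exact: (Hch (e, x)).
Qed.

(** The jump is locally constant along the edge by [jump_near] and [jump_uniq], and the piece is
    connected. *)
Lemma jump_piece e a b (ch : S -> set S * (S -> R * R)) (f : S -> bool) m x x' : 0 <= a -> b <= 1 ->
  (forall x, open_edge G e x -> straightens (ch x).1 (ch x).2 (open_edge G e) /\ (ch x).1 x) ->
  (forall x, piece e a b x -> exists m, jump (open_edge G e) ch f x m) ->
  piece e a b x -> piece e a b x' -> jump (open_edge G e) ch f x m ->
  jump (open_edge G e) ch f x' m.
Proof.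
move=> a0 b1 chA ex px px'.
pose J t := jump (open_edge G e) ch f (gam e t) m.
suff H s t : a < s -> s <= t -> t < b -> J s <-> J t.
  have [t /andP[at_ tb] <-] := px; have [t' /andP[at' tb'] <-] := px'.
  have [tt|/ltW tt] := leP t t'; first by move/(H _ _ at_ tt tb').
  by move/(H _ _ at' tt tb).
move=> as_ st tb; apply: (@segment_chain R (fun s t => J s <-> J t)) => //.
  by move=> u v w -> ->.
move=> u /andP[su ut].
have pu : piece e a b (gam e u).
  by exists u => //; rewrite (lt_le_trans as_ su) (le_lt_trans ut tb).
have ou := piece_sub a0 b1 pu; have [m' Jm'] := ex _ pu.
have := near_preimage (@gam_continuous e) (jump_near chA ou Jm').
apply: filterS => v Jv /andP[sv vt].
have ov : open_edge G e (gam e v).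
  apply: (piece_sub a0 b1); exists v => //.
  by rewrite (lt_le_trans as_ sv) (le_lt_trans vt tb).
have {}Jv := Jv ov.
suff Juv : J u <-> J v by split => //; exact: iff_sym.
split=> Ju; rewrite /J; first by rewrite (jump_uniq chA ou Ju Jm').
by rewrite (jump_uniq chA ov Ju Jv).
Qed.

End Drawing.

(** * Crossings of two curves *)

Lemma chart_swap (R : realType) (S : topologicalType) (U : set S) (h : S -> R * R) :
  plane_chart U h -> plane_chart U (fun z => ((h z).2, (h z).1)).
Proof.
have cs : continuous (fun q : R * R => (q.2, q.1)).
  move=> q; apply: (@cvg_pair _ _ _ _ (nbhs q.2) (nbhs q.1)); first exact: cvg_snd.
  exact: cvg_fst.
move=> Uh; have [oU ch [k [ck kh hk]]] := Uh; split=> //.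
  rewrite continuous_open_subspace// => x /set_mem Ux.
  apply: (@continuous_comp _ _ _ h (fun q : R * R => (q.2, q.1))); last exact: cs.
  exact: (chart_continuous Uh).
exists (fun q => k (q.2, q.1)); split=> [q|x Ux|q] /=.
- apply: (@continuous_comp _ _ _ (fun q : R * R => (q.2, q.1)) k); first exact: cs.
  exact: ck.
- by rewrite -surjective_pairing kh.
- by have [? ->] := hk (q.2, q.1); rewrite -surjective_pairing.
Qed.

Lemma near_neq_point (S : topologicalType) (x y : S) : hausdorff_space S -> x <> y ->
  \forall z \near x, z <> y.
Proof.
move=> hS xy; apply: (@near_not _ [set y]) => //.
by apply: compact_closed => //; exact: compact_set1.
Qed.

(* Two curves A and B crossing at y, each cut by y into two halves PA and PB;
   near y, su tells the sides of B and sv the sides of A, normalised so that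
   su and sv are the indices of the halves of A and B. *)
Record crossing (R : realType) (S : topologicalType) (A B : set S)
    (ca cb : S -> set S * (S -> R * R)) (PA PB : bool -> set S) (y : S)
    (su sv : S -> bool) : Prop := Crossing {
  su_const : \forall w \near y, ~ B w -> locally_const su w ;
  sv_const : \forall w \near y, ~ A w -> locally_const sv w ;
  su_half : \forall w \near y, A w -> w <> y -> PA (su w) w ;
  sv_half : \forall w \near y, B w -> w <> y -> PB (sv w) w ;
  sv_side : \forall w \near y, A w ->
    exists k, \forall z \near w, ~ A z -> sv z = side ca w z (+) k ;
  su_side : \forall w \near y, B w ->
    exists k, \forall z \near w, ~ B z -> su z = side cb w z (+) k ;
  quadrant : forall W i j, nbhs y W -> exists z, [/\ W z, ~ A z, ~ B z, su z = i & sv z = j] ;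
  quadrant_const : forall f, (\forall z \near y, ~ A z -> ~ B z -> locally_const f z) ->
    exists v, \forall z \near y, ~ A z -> ~ B z -> f z = v (su z) (sv z) }.

Lemma crossing_sym R S A B ca cb PA PB y su sv :
  @crossing R S A B ca cb PA PB y su sv -> @crossing R S B A cb ca PB PA y sv su.
Proof.
case=> H1 H2 H3 H4 H5 H6 H7 H8; split => //.
  by move=> W i j /(H7 _ j i)[z [? ? ? ? ?]]; exists z.
move=> f lf; have [v Hv] : exists v, \forall z \near y, ~ A z -> ~ B z -> f z = v (su z) (sv z).
  by apply: H8; apply: filterS lf => z H nA nB; exact: H.
by exists (fun i j => v j i); apply: filterS Hv => z H nA nB; exact: H.
Qed.

(** On half i of A, close to y, [su] is locally i and [sv] is a side of A. Thus the four values of f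
    around y turn into a jump across that half, which can then be followed away from y. *)
Lemma crossing_half_point (R : realType) (S : topologicalType) (A B : set S)
    (ca cb : S -> set S * (S -> R * R)) PA PB y su sv (Y : set S)
    (f : S -> bool) (v : bool -> bool -> bool) i :
  crossing A B ca cb PA PB y su sv -> (forall x, A x -> B x -> x = y) ->
  (forall i j x, PA i x -> PA j x -> i = j) ->
  (forall x, A x -> x <> y -> \forall z \near x, Y z -> A z) ->
  (\forall w \near y, ~ Y w -> f w = v (su w) (sv w)) ->
  (forall W, nbhs y W -> exists2 x, W x & PA i x /\ A x /\ x <> y) ->
  exists2 w, PA i w & exists k, \forall u \near w, ~ A u -> f u = v i (side ca w u (+) k).
Proof.
move=> cr AB disj nearA vf accum.
have N : nbhs y [set w | [/\ ~ B w -> locally_const su w, A w -> w <> y -> PA (su w) w,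
    A w -> exists k, \forall u \near w, ~ A u -> sv u = side ca w u (+) k &
    \forall u \near w, ~ Y u -> f u = v (su u) (sv u)]].
  have N1 := su_const cr; have N2 := su_half cr; have N3 := sv_side cr.
  have N4 := near_join vf.
  by near=> w; split; near: w.
have [w [H1 H2 H3 H4] [Pw [Aw wy]]] := accum _ N; exists w => //.
have suw : su w = i by apply: (disj _ _ w); [exact: H2|].
have [k Hk] := H3 Aw; have nB : ~ B w by move=> /(AB _ Aw).
exists k; have := H1 nB; rewrite /locally_const suw => suc.
have nYA := nearA _ Aw wy.
near=> u => nA.
have nY : ~ Y u by move=> Yu; apply: nA; move: Yu; near: u.
have fu : ~ Y u -> f u = v (su u) (sv u) by near: u.
have su_ : su u = i by near: u.
have sv_ : ~ A u -> sv u = side ca w u (+) k by near: u.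
by rewrite fu// su_ sv_.
Unshelve. all: by end_near.
Qed.

Definition signed_half (R : realType) (e : R) (b : bool) : R := if b then e / 2 else - (e / 2).

Section SignedHalf.
Variables (R : realType) (e : R).
Hypothesis e0 : 0 < e.

Lemma signed_half_gt0 b : (0 < signed_half e b) = b.
Proof.
by move: e0 => e0'; rewrite /signed_half; case: b => /=; [apply/idP; lra|apply/negbTE;
  rewrite -leNgt; lra].
Qed.

Lemma signed_half_lt0 b : (signed_half e b < 0) = ~~ b.
Proof.
by move: e0 => e0'; rewrite /signed_half; case: b => /=; [apply/negbTE; rewrite -leNgt;
  lra|apply/idP; lra].
Qed.

Lemma signed_half_norm b : `|signed_half e b| < e.
Proof.
move: e0 => e0'; have e2 : 0 <= e / 2 by lra.
have ee : e / 2 < e by lra.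
by rewrite /signed_half; case: b; rewrite ?normrN ger0_norm.
Qed.

Lemma signed_half_neq0 b : signed_half e b <> 0.
Proof.
by move=> H; have := signed_half_gt0 b; have := signed_half_lt0 b; rewrite H ltxx; case: b {H}.
Qed.

End SignedHalf.

Lemma between_neq0 (R : realType) (u v t : R) : 0 < u * v -> u <= t -> t <= v -> t != 0.
Proof. by move=> uv ut tv; apply/eqP => t0; subst t; nra. Qed.

Section MakeCrossing.
Variables (R : realType) (S : topologicalType).

(** Each open half-axis of the chart is connected, so it lies in a single half of A. Both halves of
    A accumulate at y, so the two half-axes lie in different ones; s adjusts the labels. *)
Lemma half_sign (A B : set S) (U : set S) (h : S -> R * R) y (P : bool -> set S) :
  straightens U h A -> U y -> A y -> (forall x, U x -> B x <-> (h x).1 = 0) -> B y ->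
  (forall x, A x -> x <> y -> P true x \/ P false x) ->
  (forall i j x, P i x -> P j x -> i = j) ->
  (forall i x, P i x -> \forall z \near x, A z -> P i z) ->
  (forall W i, nbhs y W -> exists2 x, W x & P i x /\ A x /\ x <> y) ->
  exists s, \forall z \near y, A z -> z <> y -> P ((0 < (h z).1) (+) s) z.
Proof.
move=> [Uh UA] Uy Ay UB By cover disj Pop Pnear.
have [k [ck kh Uk hk kW]] := chart_inv Uh.
have hy : h y = (0, 0).
  by rewrite [h y]surjective_pairing; congr (_, _); [apply/UB|apply/UA].
have Ak (u : R) : A (k (u, 0)) by apply/UA => //; rewrite hk.
have ky (u : R) : u != 0 -> k (u, 0) <> y.
  by move=> u0 /(congr1 h); rewrite hk hy => -[]; apply/eqP.
have along (u v : R) i : 0 < u * v -> u <= v -> P i (k (u, 0)) <-> P i (k (v, 0)).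
  move=> uv lev; apply: (@segment_chain R (fun u v => P i (k (u, 0)) <-> P i (k (v, 0)))) => //.
    by move=> a b c -> ->.
  move=> t /andP[ut tv].
  have t0 : t != 0 by exact: between_neq0 uv ut tv.
  have ct : continuous (fun t : R => k (t, 0)).
    move=> w; apply: (@continuous_comp _ _ _ (fun t : R => (t, 0) : R * R) k); last exact: ck.
    exact: pairr_continuous.
  have [j Pj] : exists j, P j (k (t, 0)).
    by have [] := cover _ (Ak t) (ky _ t0); [exists true|exists false].
  have := near_preimage ct (Pop _ _ Pj); apply: filterS => w Hw _.
  have Pw := Hw (Ak w).
  suff H : P i (k (t, 0)) <-> P i (k (w, 0)) by split => //; exact: iff_sym.
  by split => Pi; [rewrite (disj _ _ _ Pi Pj)|rewrite (disj _ _ _ Pi Pw)].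
have [a Pa] : exists a, P a (k (1, 0)).
  by have [] := cover _ (Ak 1) (ky _ (oner_neq0 _)); [exists true|exists false].
have N10 : - 1 != 0 :> R by rewrite oppr_eq0 oner_neq0.
have [b Pb] : exists b, P b (k (- 1, 0)).
  by have [] := cover _ (Ak (- 1)) (ky _ N10); [exists true|exists false].
have pos (u : R) : 0 < u -> P a (k (u, 0)).
  move=> u0; have [u1|/ltW u1] := leP u 1; first by apply/(along u 1 a); rewrite ?mulr1.
  by apply/(along 1 u a); rewrite ?mul1r.
have neg (u : R) : u < 0 -> P b (k (u, 0)).
  move=> u0; have [u1|/ltW u1] := leP u (- 1); first by apply/(along u (- 1) b);
    rewrite ?mulrN1 ?oppr_gt0.
  by apply/(along (- 1) u b); rewrite ?mulN1r ?oppr_gt0.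
have onA z : U z -> A z -> z <> y -> P (if 0 < (h z).1 then a else b) z.
  move=> Uz Az zy; have hz : h z = ((h z).1, 0).
    by rewrite [LHS]surjective_pairing; congr (_, _); apply/UA.
  have hz0 : (h z).1 != 0.
    by apply/eqP => hz0; apply: zy; rewrite -(kh z)// -(kh y)// hz hy hz0.
  rewrite -{2}(kh z)// hz; case: ifP => h0; first exact: pos.
  by apply: neg; rewrite lt_neqAle hz0 leNgt h0.
have [oU _ _] := Uh; have nU : nbhs y U by apply: open_nbhs_nbhs.
have ab : a <> b.
  move=> ab; have [x Ux [Px [Ax xy]]] := Pnear _ (~~ a) nU.
  have := onA _ Ux Ax xy; rewrite -ab if_same => /(disj _ _ _ Px).
  by case: (a).
exists (~~ a); apply: filterS nU => z Uz Az zy; have := onA _ Uz Az zy.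
by move: ab; case: (0 < _); case: (a); case: (b).
Qed.

(** Every open quadrant of a small box is convex and meets neither axis. *)
Lemma quadrant_values (A B : set S) (U : set S) (h : S -> R * R) y (f : S -> bool) :
  straightens U h A -> U y -> A y -> (forall x, U x -> B x <-> (h x).1 = 0) -> B y ->
  (\forall z \near y, ~ A z -> ~ B z -> locally_const f z) ->
  exists v, \forall z \near y, ~ A z -> ~ B z -> f z = v (0 < (h z).1) (0 < (h z).2).
Proof.
move=> [Uh UA] Uy Ay UB By lf; have [k [ck kh Uk hk kW]] := chart_inv Uh.
have hy : h y = (0, 0).
  by rewrite [h y]surjective_pairing; congr (_, _); [apply/UB|apply/UA].
have [e e0 eW] := kW _ _ Uy lf.
pose s := signed_half e.
have se b : `|s b| < e by exact: signed_half_norm.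
exists (fun i j => f (k (s i, s j))).
apply: filterS (chart_box Uh Uy e0) => z [Uz zb] nA nB.
have h1 : (h z).1 != 0 by apply/eqP => /(UB _ Uz).
have h2 : (h z).2 != 0 by apply/eqP => /(UA _ Uz).
rewrite -{1}(kh z)//; set q := (s _, s _).
have bq : box (h y) e q by split; rewrite hy subr0 se.
have ne (a : R) t : 0 <= t <= 1 -> a != 0 -> a + t * (s (0 < a) - a) != 0.
  move=> t01; rewrite neq_lt => /orP[a0|a0].
    by rewrite lt_eqF// lerp_lt// signed_half_lt0// -leNgt ltW.
  by rewrite gt_eqF// lerp_gt// signed_half_gt0.
apply: (@lerp_const R S f k) => // t t01.
apply: eW; first exact: lerp_box.
  by move=> /(UA _ (Uk _)); rewrite hk lerp2E => /eqP; apply/negP; exact: ne.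
by move=> /(UB _ (Uk _)); rewrite hk lerp1E => /eqP; apply/negP; exact: ne.
Qed.

Lemma crossing_exists (A B : set S) (ca cb : S -> set S * (S -> R * R))
    (PA PB : bool -> set S) y :
  (forall x, A x -> straightens (ca x).1 (ca x).2 A /\ (ca x).1 x) ->
  (forall x, B x -> straightens (cb x).1 (cb x).2 B /\ (cb x).1 x) ->
  (forall x, A x -> x <> y -> PA true x \/ PA false x) ->
  (forall i j x, PA i x -> PA j x -> i = j) ->
  (forall i x, PA i x -> \forall z \near x, A z -> PA i z) ->
  (forall W i, nbhs y W -> exists2 x, W x & PA i x /\ A x /\ x <> y) ->
  (forall x, B x -> x <> y -> PB true x \/ PB false x) ->
  (forall i j x, PB i x -> PB j x -> i = j) ->
  (forall i x, PB i x -> \forall z \near x, B z -> PB i z) ->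
  (forall W i, nbhs y W -> exists2 x, W x & PB i x /\ B x /\ x <> y) ->
  cross_at (R := R) A B y -> A y -> B y ->
  exists su sv, crossing A B ca cb PA PB y su sv.
Proof.
move=> chA chB cA dA oA nA cB dB oB nB [U [h [sU Uy UB]]] Ay By.
have [Uh UA] := sU; have [oU _ _] := Uh.
have nU : nbhs y U by apply: open_nbhs_nbhs.
pose h' z := ((h z).2, (h z).1).
have sU' : straightens U h' B by split => //; exact: chart_swap.
have UA' x : U x -> A x <-> (h' x).1 = 0 by exact: UA.
have [s1 Hs1] := half_sign sU Uy Ay UB By cA dA oA nA.
have [s2 Hs2] := half_sign sU' Uy By UA' Ay cB dB oB nB.
exists (fun z => (0 < (h z).1) (+) s1), (fun z => (0 < (h z).2) (+) s2); split.
- apply: filterS nU => w Uw nBw.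
  by have := side_locally_const sU' Uw nBw; apply: filterS => z /= ->.
- apply: filterS nU => w Uw nAw.
  by have := side_locally_const sU Uw nAw; apply: filterS => z /= ->.
- exact: Hs1.
- exact: Hs2.
- apply: filterS nU => w Uw Aw; have [sa Uaw] := chA _ Aw.
  have [n Hn] := side_compare sa sU Uaw Uw Aw.
  by exists (n (+) s2); apply: filterS Hn => z H nAz; rewrite H// addbA.
- apply: filterS nU => w Uw Bw; have [sb Ubw] := chB _ Bw.
  have [n Hn] := side_compare sb sU' Ubw Uw Bw.
  exists (n (+) s1); apply: filterS Hn => z H nBz.
  by rewrite -[(h z).1]/(h' z).2 H// addbA.
- move=> W i j yW; have [k [ck kh Uk hk kW]] := chart_inv Uh.
  have [e e0 eW] := kW _ _ Uy yW.
  have hy : h y = (0, 0).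
    by rewrite [h y]surjective_pairing; congr (_, _); [apply/UB|apply/UA].
  pose s := signed_half e.
  have se b : `|s b| < e by exact: signed_half_norm.
  have s0 b : (0 < s b) = b by exact: signed_half_gt0.
  have sn b : s b <> 0 by exact: signed_half_neq0.
  exists (k (s (i (+) s1), s (j (+) s2))); rewrite !hk /= !s0 !addbK; split => //.
  + by apply: eW; split; rewrite hy subr0 se.
  + by move=> /(UA _ (Uk _)); rewrite hk; exact: sn.
  + by move=> /(UB _ (Uk _)); rewrite hk; exact: sn.
- move=> f lf; have [v Hv] := quadrant_values sU Uy Ay UB By lf.
  exists (fun i j => v (i (+) s1) (j (+) s2)).
  by apply: filterS Hv => z H nAz nBz; rewrite !addbK; exact: H.
Qed.

End MakeCrossing.

Lemma atlasD (S : topologicalType) (Y X : set S) c c' : atlas Y X c -> atlas Y X c' ->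
  atlas Y X (fun x z => c x z (+) c' x z).
Proof.
move=> ac ac' x Xx; apply: filterS2 (ac _ Xx) (ac' _ Xx) => y [k Hk] [k' Hk'].
by exists (k (+) k'); apply: filterS2 Hk Hk' => z H H' nY; rewrite H// H'// addbACA.
Qed.

Lemma atlas_mono (S : topologicalType) (Y Y' X X' : set S) c : Y `<=` Y' -> X' `<=` X ->
  atlas Y X c -> atlas Y' X' c.
Proof.
move=> YY XX ac x /XX/ac; apply: filterS => y [k Hk]; exists k.
by apply: filterS Hk => z H nY; apply: H => /YY.
Qed.

(** * L-shaped curves bounding the quadrants of a crossing *)

Section CornerCurve.
Variables (R : realType) (S : topologicalType) (A B X : set S).
Variables (ca cb : S -> set S * (S -> R * R)) (PA PB : bool -> set S) (y : S).
Variables (su sv : S -> bool).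
Hypothesis hS : hausdorff_space S.
Hypothesis chA : forall x, A x -> straightens (ca x).1 (ca x).2 A /\ (ca x).1 x.
Hypothesis chB : forall x, B x -> straightens (cb x).1 (cb x).2 B /\ (cb x).1 x.
Hypothesis subA : forall i, PA i `<=` A.
Hypothesis subB : forall i, PB i `<=` B.
Hypothesis disjA : forall i j x, PA i x -> PA j x -> i = j.
Hypothesis disjB : forall i j x, PB i x -> PB j x -> i = j.
Hypothesis openA : forall i x, PA i x -> \forall z \near x, A z -> PA i z.
Hypothesis openB : forall i x, PB i x -> \forall z \near x, B z -> PB i z.
Hypothesis closedA : forall i x, X x -> x <> y -> ~ PA i x -> \forall z \near x, ~ PA i z.
Hypothesis closedB : forall i x, X x -> x <> y -> ~ PB i x -> \forall z \near x, ~ PB i z.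
Hypothesis AB : forall x, A x -> B x -> x = y.
Hypothesis cr : crossing A B ca cb PA PB y su sv.

Definition half_color (P : bool -> set S) (c : S -> set S * (S -> R * R)) i x z :=
  `[< P i x >] && side c x z.

(** Around y the colour is the indicator of the quadrant (i, j), which changes across half i of A
    and half j of B; elsewhere the two halves are coloured separately. *)
Definition corner_color i j x z := if pselect (x = y) then (su z == i) && (sv z == j)
  else half_color PA ca i x z (+) half_color PB cb j x z.

Lemma corner_colorN i j x z : x <> y ->
  corner_color i j x z = half_color PA ca i x z (+) half_color PB cb j x z.
Proof. by rewrite /corner_color; case: pselect. Qed.

Lemma corner_colory i j z : corner_color i j y z = (su z == i) && (sv z == j).
Proof. by rewrite /corner_color; case: pselect. Qed.

Lemma corner_curve i j x : (forall x, A x -> x <> y -> PA true x \/ PA false x) -> A y ->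
  exists k, \forall w \near x, ~ A w ->
    false = corner_color i j x w (+) corner_color (~~ i) j x w (+)
            (`[< A x >] && side ca x w) (+) k.
Proof.
move=> cover Ay; have [xy|xy] := pselect (x = y); last first.
  exists false; apply: nearW => w _; rewrite !corner_colorN// /half_color.
  have -> : `[< A x >] = `[< PA i x >] (+) `[< PA (~~ i) x >].
    have [Ax|nA] := pselect (A x); last by rewrite !asboolF// => /subA.
    rewrite (asboolT Ax); have [Pi|nPi] := pselect (PA i x).
      by rewrite (asboolT Pi) asboolF// => /(disjA Pi); case: (i).
    by rewrite (asboolF nPi) asboolT//; have [] := cover _ Ax xy; case: i nPi.
  by case: `[< _ >]; case: `[< _ >]; case: `[< _ >]; case: (side _ _ _); case: (side _ _ _).
subst x; have [k Hk] := nbhs_singleton (sv_side cr) Ay.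
exists (~~ j (+) k); apply: filterS Hk => w Hw nA.
rewrite !corner_colory (asboolT Ay) Hw//.
by case: (su w); case: (side _ _ _); case: (k); case: (i); case: (j).
Qed.

(** Only the base points near y need care. Close to half i of A, [su] is constant and [sv] is a side
    of A, so the quadrant indicator is the colouring of that half up to a constant; similarly for B,
    and off both curves the indicator is locally constant. *)
Lemma corner_atlas i j : atlas (A `|` B) X (corner_color i j).
Proof.
move=> x Xx; have [xy|xy] := pselect (x = y); last first.
  pose X0 := X `&` [set x | x <> y].
  have a1 : atlas (A `|` B) X0 (half_color PA ca i).
    apply: (atlas_mono (@subsetUl _ A B) (@subset_refl _ X0)).
    apply: piece_atlas => // [w [Xw wy]|w [Xw wy] nP]; [exact: openA|exact: closedA].
  have a2 : atlas (A `|` B) X0 (half_color PB cb j).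
    apply: (atlas_mono (@subsetUr _ A B) (@subset_refl _ X0)).
    apply: piece_atlas => // [w [Xw wy]|w [Xw wy] nP]; [exact: openB|exact: closedB].
  have := atlasD a1 a2 (conj Xx xy : X0 x).
  apply: filterS2 (near_neq_point hS xy) => w wy [k Hk]; exists k.
  by apply: filterS Hk => z H nY; rewrite !corner_colorN// H.
subst x.
have N := cr.
near=> w.
have H1 : ~ B w -> locally_const su w by near: w; exact: su_const N.
have H2 : ~ A w -> locally_const sv w by near: w; exact: sv_const N.
have H3 : A w -> w <> y -> PA (su w) w by near: w; exact: su_half N.
have H4 : B w -> w <> y -> PB (sv w) w by near: w; exact: sv_half N.
have H5 : A w -> exists k, \forall z \near w, ~ A z -> sv z = side ca w z (+) k.
  by near: w; exact: sv_side N.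
have H6 : B w -> exists k, \forall z \near w, ~ B z -> su z = side cb w z (+) k.
  by near: w; exact: su_side N.
have [wy|wy] := pselect (w = y).
  by exists false; apply: nearW => z _; rewrite wy addbF.
have [Aw|nAw] := pselect (A w).
  have nBw : ~ B w by move=> /(AB Aw).
  have suw := H1 nBw.
  have Pw := H3 Aw wy.
  have [k Hk] := H5 Aw.
  exists ((su w == i) && (~~ j (+) k)).
  apply: filterS2 suw Hk => z suz svz nY.
  have nAz : ~ A z by move=> Az; apply: nY; left.
  rewrite corner_colorN// corner_colory suz svz// /half_color.
  rewrite (_ : `[< PB j w >] = false) ?addbF; last by apply/asboolPn => /subB.
  have -> : `[< PA i w >] = (su w == i).
    by apply/asboolP/eqP => [/(disjA Pw)//|<-].
  by case: (su w == i); case: (side ca w z); case: (k); case: (j).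
have sva := H2 nAw.
have [Bw|nBw] := pselect (B w).
  have Pw := H4 Bw wy.
  have [k Hk] := H6 Bw.
  exists ((sv w == j) && (~~ i (+) k)).
  apply: filterS2 sva Hk => z svz suz nY.
  have nBz : ~ B z by move=> Bz; apply: nY; right.
  rewrite corner_colorN// corner_colory svz suz// /half_color.
  rewrite (_ : `[< PA i w >] = false); last by apply/asboolPn => /subA.
  have -> : `[< PB j w >] = (sv w == j).
    by apply/asboolP/eqP => [/(disjB Pw)//|<-].
  by case: (sv w == j); case: (side cb w z); case: (k); case: (i).
have suw := H1 nBw.
exists ((su w == i) && (sv w == j)); apply: filterS2 suw sva => z suz svz nY.
rewrite corner_colorN// corner_colory suz svz /half_color.
rewrite (_ : `[< PA i w >] = false); last by apply/asboolPn => /subA.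
by rewrite (_ : `[< PB j w >] = false) ?addbb//; apply/asboolPn => /subB.
Unshelve. all: by end_near.
Qed.

End CornerCurve.

Lemma corner_color_sym (R : realType) (S : topologicalType)
    (ca cb : S -> set S * (S -> R * R)) PA PB y su sv i j x z :
  corner_color ca cb PA PB y su sv i j x z = corner_color cb ca PB PA y sv su j i x z.
Proof.
have [->|xy] := pselect (x = y); first by rewrite !corner_colory andbC.
by rewrite !corner_colorN// addbC.
Qed.

(** * Combinatorics of corners *)

Lemma sum_involution (I : finType) (s : I -> I) (F : I -> 'F_2) : involutive s ->
  (forall i, F (s i) = F i) -> (forall i, s i = i -> F i = 0) -> \sum_i F i = 0.
Proof.
move=> ss Fs F0; rewrite (bigID (fun i => (enum_rank i < enum_rank (s i))%N))/=.
rewrite [X in _ + X](bigID (fun i => s i == i))/=.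
rewrite [X in _ + (X + _)]big1 ?add0r => [|i /andP[_ /eqP/F0]//].
rewrite [X in _ + X](reindex_inj (inv_inj ss))/=.
rewrite [X in _ + X](eq_big (fun i => (enum_rank i < enum_rank (s i))%N) F); last 2 first.
- move=> i; rewrite ss -leqNgt ltn_neqAle andbC; congr (_ && _).
  by rewrite (inj_eq val_inj) (inj_eq enum_rank_inj) eq_sym.
- by move=> i _; rewrite Fs.
exact: addF2xx.
Qed.

Section CornerCombinatorics.
Variables (E : finType) (FT : Type) (fc : E -> bool -> FT).
Local Notation K := (E * bool * bool)%type.
Variable W : (K -> bool) -> Prop.
Hypothesis W_const : forall b, W (fun=> b).
Hypothesis W_op : forall (op : bool -> bool -> bool) u w, W u -> W w ->
  W (fun k => op (u k) (w k)).

(** The corner (e, i, j) lies between half i of e and half j of its coedge. The latter is its ray,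
    and i says on which side of the ray it lies. W stands for the values at corners of locally
    constant functions on the complement. *)
Definition ray (k : K) : E * bool := (k.1.1, k.2).
Definition ray_jump (u : K -> bool) (r : E * bool) := u (r.1, true, r.2) (+) u (r.1, false, r.2).

Hypothesis W_two : forall r r', r <> r' -> fc r.1 r.2 = fc r'.1 r'.2 ->
  exists2 u, W u & forall r'', ray_jump u r'' = (r'' == r) (+) (r'' == r').
Hypothesis W_one : forall u r, W u -> ~ (forall r', ray_jump u r' = (r' == r)).
Hypothesis W_face : forall r, exists2 u, W u &
  forall k, u k = `[< fc (ray k).1 (ray k).2 = fc r.1 r.2 >].

(** Inseparability by W takes the place of lying in one component of the complement. *)
Definition same (k k' : K) := `[< forall u, W u -> u k = u k' >].

Lemma sameP k k' : reflect (forall u, W u -> u k = u k') (same k k').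
Proof. exact: asboolP. Qed.

Lemma same_sym k k' : same k k' -> same k' k.
Proof. by move=> /sameP H; apply/sameP => u Wu; rewrite H. Qed.

Lemma same_trans k k' k'' : same k k' -> same k' k'' -> same k k''.
Proof. by move=> /sameP H /sameP H'; apply/sameP => u Wu; rewrite H// H'. Qed.

Lemma same_refl k : same k k. Proof. by apply/sameP. Qed.

Lemma same_face k k' : same k k' -> fc (ray k').1 (ray k').2 = fc (ray k).1 (ray k).2.
Proof.
move=> /sameP H; have [u Wu uE] := W_face (ray k).
by have := H u Wu; rewrite !uE asboolT// => /esym/asboolP.
Qed.

Lemma ray_jump_eq u k k' : ray k = ray k' -> k <> k' -> ray_jump u (ray k) = u k (+) u k'.
Proof.
case: k k' => [[e i] j] [[e' i'] j'] [<- <-]; rewrite /ray_jump /=.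
by case: i; case: i' => // _; rewrite addbC.
Qed.

(** The colouring bounded by the rays of k and k'' separates the two sides k and k' of the first
    ray. *)
Lemma same_ray k k' k'' : same k k' -> same k k'' -> k <> k' -> ray k = ray k' ->
  ray k'' <> ray k -> False.
Proof.
move=> kk kk' ne rr rr'; have [u Wu uJ] := W_two rr' (same_face kk').
have := uJ (ray k); rewrite eqxx (ray_jump_eq u rr ne) (sameP _ _ kk u Wu) addbb addbT.
by move/esym/negbFE/eqP => E0; apply: rr'.
Qed.

Lemma rays3 (k k' k'' : K) : ray k = ray k' -> ray k = ray k'' ->
  k <> k' -> k <> k'' -> k' <> k'' -> False.
Proof.
case: k k' k'' => [[e i] j] [[e' i'] j'] [[e'' i''] j''] [<- <-] [<- <-].
by case: i; case: i'; case: i''.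
Qed.

(** For three different rays take u jumping across those of k and k1, and w across those of k and
    k2, both shifted to vanish at k and hence at all three corners. The product of u and w jumps
    across the ray of k alone: at each other ray one factor is zero on both sides, or neither jumps.
    This contradicts [W_one]. *)
Lemma block_le2 k k1 k2 : same k k1 -> same k k2 -> k <> k1 -> k <> k2 -> k1 <> k2 -> False.
Proof.
move=> s1 s2 n1 n2 n12.
have s12 := same_trans (same_sym s1) s2.
have [r1|r1] := pselect (ray k = ray k1).
  have [r2|r2] := pselect (ray k2 = ray k); first exact: (rays3 r1 (esym r2)).
  exact: (same_ray s1 s2).
have [r2|r2] := pselect (ray k = ray k2).
  by apply: (same_ray s2 s1) => //; apply/nesym.
have [r12|r12] := pselect (ray k1 = ray k2).
  by apply: (same_ray s12 (same_sym s1)).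
have [u0 Wu0 uJ0] := W_two r1 (esym (same_face s1)).
have [w0 Ww0 wJ0] := W_two r2 (esym (same_face s2)).
pose u x := u0 x (+) u0 k; pose w x := w0 x (+) w0 k.
have Wu : W u by exact: (W_op addb Wu0 (W_const _)).
have Ww : W w by exact: (W_op addb Ww0 (W_const _)).
have uJ r : ray_jump u r = (r == ray k) (+) (r == ray k1).
  by rewrite -uJ0 /ray_jump /u addbACA addbb addbF.
have wJ r : ray_jump w r = (r == ray k) (+) (r == ray k2).
  by rewrite -wJ0 /ray_jump /w addbACA addbb addbF.
have uk : u k = false by rewrite /u addbb.
have wk : w k = false by rewrite /w addbb.
have uk2 : u k2 = false by rewrite -(sameP _ _ s2 u Wu).
have wk1 : w k1 = false by rewrite -(sameP _ _ s1 w Ww).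
apply: (@W_one (fun x => u x && w x) (ray k)); first exact: (W_op andb Wu Ww).
move=> r; have := uJ r; have := wJ r; rewrite /ray_jump.
have side_at (x : K) : x = ((ray x).1, true, (ray x).2) \/ x = ((ray x).1, false, (ray x).2).
  by case: x => [[e []] j]; [left|right].
have [rk|rk] := eqVneq r (ray k).
  have -> : (r == ray k1) = false by rewrite rk; apply/eqP.
  have -> : (r == ray k2) = false by rewrite rk; apply/eqP.
  have [[-> ->]|[-> ->]] : (u (r.1, true, r.2) = false /\ w (r.1, true, r.2) = false) \/
      (u (r.1, false, r.2) = false /\ w (r.1, false, r.2) = false).
  - by have := side_at k; rewrite -rk => -[<-|<-]; [left|right].
  - by case: (u _); case: (w _).
  - by case: (u _); case: (w _).
have [rk1|rk1] := eqVneq r (ray k1).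
  have -> : (r == ray k2) = false by rewrite rk1; apply/eqP.
  have [->|->] : w (r.1, true, r.2) = false \/ w (r.1, false, r.2) = false.
  - by have := side_at k1; rewrite -rk1 => -[<-|<-]; [left|right].
  - by case: (w _); case: (u _); case: (u _).
  - by case: (w _); case: (u _); case: (u _).
have [rk2|rk2] := eqVneq r (ray k2).
  have [->|->] : u (r.1, true, r.2) = false \/ u (r.1, false, r.2) = false.
  - by have := side_at k2; rewrite -rk2 => -[<-|<-]; [left|right].
  - by case: (u _); case: (w _); case: (w _).
  - by case: (u _); case: (w _); case: (w _).
move: (u (r.1, true, r.2)) (u (r.1, false, r.2)) (w (r.1, true, r.2)) (w (r.1, false, r.2)).
by move=> [] [] [] [].
Qed.

(** A finite product: each corner outside the block contributes a factor from W that is true at k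
    and false at that corner. *)
Lemma block_indicator k : exists2 u, W u & forall k', u k' = same k k'.
Proof.
suff [u [Wu u1 u0]] : exists u, [/\ W u, forall k', same k k' -> u k' = true &
    forall k', k' \in enum {: K} -> ~~ same k k' -> u k' = false].
  exists u => // k'; case: (boolP (same k k')) => kk; first exact: u1.
  by apply: u0 => //; rewrite mem_enum.
elim: (enum {: K}) => [|x r [u [Wu u1 u0]]]; first by exists (fun=> true).
have [sx|nsx] := boolP (same k x).
  exists u; split => // k'; rewrite inE => /orP[/eqP -> /negP//|]; exact: u0.
have [w Ww wx] : exists2 w, W w & w k <> w x.
  apply: contrapT => H; case/negP: nsx; apply/sameP => w Ww.
  by apply: contrapT => ne; apply: H; exists w.
exists (fun k' => u k' && (w k' == w k)); split.
- exact: (W_op andb Wu (W_op eq_op Ww (W_const (w k)))).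
- by move=> k' kk; rewrite u1// -(sameP _ _ kk w Ww) eqxx.
- move=> k'; rewrite inE => /orP[/eqP -> _|k'r nk]; last by rewrite u0.
  by case: eqP => [E0|]; rewrite ?andbF//; case: wx.
Qed.

Lemma corner_sum0 (d d' : K -> 'F_2) :
  (forall u, W u -> \sum_k (u k)%:R * d k = 0) ->
  (forall u, W u -> \sum_k (u k)%:R * d' k = 0) ->
  \sum_k d k * d' k = 0.
Proof.
move=> Hd Hd'.
(* Swaps the two corners of a block and fixes a corner that is alone. The relation for the indicator
   of the block says that d agrees on the two, or vanishes at the lone one. *)
pose s k := odflt k [pick k' | same k k' && (k' != k)].
have sP k : (s k = k /\ forall k', same k k' -> k' = k) \/ (same k (s k) /\ s k <> k).
  rewrite /s; case: pickP => [k' /andP[kk /eqP ne]|no]; [right|left] => //; split => // k' kk.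
  by have := no k'; rewrite kk/= => /negbFE/eqP.
have ss : involutive s.
  move=> k; have [[E0 _]|[kk ne]] := sP k; first by rewrite !E0.
  have [[_ only]|[kk' ne']] := sP (s k).
    by case: ne; exact: esym (only _ (same_sym kk)).
  apply: contrapT => nk; apply: (@block_le2 k (s k) (s (s k))) => //.
  - exact: same_trans kk'.
  - by apply/nesym.
  - by apply/nesym.
  - by apply/nesym.
have block (d0 : K -> 'F_2) : (forall u, W u -> \sum_k (u k)%:R * d0 k = 0) -> forall k,
    (s k = k -> d0 k = 0) /\ d0 (s k) = d0 k.
  move=> H k; have [u Wu uE] := block_indicator k.
  have := H u Wu; rewrite (bigD1 k)//= uE same_refl mul1r.
  have [[sk only]|[kk ne]] := sP k.
    rewrite big1 ?addr0 => [d00|k' /eqP k'k]; first by rewrite sk.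
    have -> : u k' = false by rewrite uE; apply/negP => /only.
    by rewrite mul0r.
  rewrite (bigD1 (s k))/=; last exact/eqP.
  rewrite uE kk mul1r big1 ?addr0 => [|k' /andP[/eqP n1 /eqP n2]]; last first.
    have -> : u k' = false.
      rewrite uE; apply/negP => kk'; apply: (@block_le2 k (s k) k') => //; exact/nesym.
    by rewrite mul0r.
  move=> /eqP; rewrite addr_eq0 => /eqP dE; split => //.
  by rewrite dE; apply/eqP; rewrite -subr_eq0 opprK addF2xx.
apply: (sum_involution ss) => [k|k sk].
  by rewrite (block d Hd k).2 (block d' Hd' k).2.
by rewrite ((block d Hd k).1 sk) mul0r.
Qed.

End CornerCombinatorics.

(** * A map and its dual *)

Section Halves.
Variables (R : realType) (S : topologicalType) (E : finType) (G : drawing R S E).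
Hypothesis hS : hausdorff_space S.
Hypothesis emb : embedded_graph G.
Variables (e : E) (t0 : R).
Hypothesis t01 : 0 < t0 < 1.

Definition half (i : bool) : set S := if i then piece G e t0 1 else piece G e 0 t0.

Let tpos : 0 < t0. Proof. by case/andP: t01. Qed.
Let tlt1 : t0 < 1. Proof. by case/andP: t01. Qed.

Lemma halfP i x : half i x <-> exists t, [/\ 0 < t < 1, t != t0, (t0 < t) = i & gam G e t = x].
Proof.
case: i; split.
- move=> [t /andP[tt t1] <-]; exists t; split => //; last by rewrite gt_eqF.
  by rewrite (lt_trans tpos tt).
- by move=> [t [/andP[_ t1] _ tt <-]]; exists t => //; rewrite tt.
- move=> [t /andP[t0' tt] <-]; exists t; split => //; last 2 first.
    by rewrite lt_eqF.
  + by apply/negbTE; rewrite -leNgt ltW.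
  by rewrite t0' (lt_trans tt tlt1).
- move=> [t [/andP[t0' _] tn tt <-]]; exists t => //; rewrite t0' /=.
  by rewrite lt_neqAle tn leNgt tt.
Qed.

Lemma half_sub i : half i `<=` open_edge G e.
Proof. by case: i; apply: piece_sub => //; rewrite ltW. Qed.

Lemma half_cover x : open_edge G e x -> x <> gam G e t0 -> half true x \/ half false x.
Proof.
move=> /open_edgeP[t tt <-] xt; have tn : t != t0 by apply/eqP => tE; rewrite tE in xt.
have [lt|le] := boolP (t0 < t); [left|right]; apply/halfP; exists t; split => //.
exact/negbTE.
Qed.

Lemma half_disj i j x : half i x -> half j x -> i = j.
Proof.
move=> /halfP[t [tt _ <- <-]] /halfP[s [/andP[s0 s1] _ <- st]].
by have [|_ ->] := @gam_inj _ _ _ _ emb e e t s tt _ (esym st); rewrite ?ltW.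
Qed.

Lemma half_not_mid i : ~ half i (gam G e t0).
Proof.
move=> /halfP[t [/andP[s0 s1] tn _ tE]].
have [|_ tE'] := @gam_inj _ _ _ _ emb e e t0 t t01 _ (esym tE); first by rewrite !ltW.
by rewrite tE' eqxx in tn.
Qed.

Lemma half_open i x : half i x -> \forall z \near x, open_edge G e z -> half i z.
Proof. by case: i; apply: piece_open => //; rewrite ltW. Qed.

Lemma half_closed i x : ~ vertices G x -> x <> gam G e t0 -> ~ half i x ->
  \forall z \near x, ~ half i z.
Proof.
move=> nV xt nh; have [v0 v1] := vertex_ends emb e.
by case: i nh => nh; apply: piece_closed => // xE; apply: nV; rewrite xE.
Qed.

Lemma half_near i W : nbhs (gam G e t0) W ->
  exists2 x, W x & half i x /\ open_edge G e x /\ x <> gam G e t0.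
Proof.
move=> /(near_preimage (@gam_continuous _ _ _ _ emb e)) /nbhs_ballP[d /= d0 dW].
pose d1 := Num.min (d / 2) (Num.min (t0 / 2) ((1 - t0) / 2)).
have d10 : 0 < d1 by rewrite !lt_min !divr_gt0// subr_gt0.
have d1d : d1 < d by rewrite gt_min; apply/orP; left; lra.
have d1t : d1 < t0 by rewrite !gt_min; apply/orP; right; apply/orP; left; move: tpos => tp; lra.
have d11 : d1 < 1 - t0 by rewrite !gt_min; apply/orP; right; apply/orP; right; move: tlt1 => tp;
  lra.
pose t := if i then t0 + d1 else t0 - d1.
have h : half i (gam G e t).
  apply/halfP; exists t; split => //; rewrite /t; case: (i).
  - by apply/andP; split; lra.
  - by apply/andP; split; lra.
  - by apply/eqP; lra.
  - by apply/eqP; lra.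
  - by apply/idP; lra.
  - by apply/negbTE; rewrite -leNgt; lra.
exists (gam G e t).
  apply: dW; rewrite /ball/= /t; case: (i);
    rewrite opprD addrA subrr add0r ?opprK ?normrN gtr0_norm//.
split => //; split; first exact: half_sub h.
by move=> tE; apply: (@half_not_mid i); rewrite -tE.
Qed.

End Halves.

Lemma near_forall_fin (S : topologicalType) (I : finType) (P : I -> S -> Prop) (x : S) :
  (forall i, \forall z \near x, P i z) -> \forall z \near x, forall i, P i z.
Proof. by move=> H; apply: (@filter_forall _ _ P _ (nbhs_filter x)). Qed.

Section MapPair.
Variables (R : realType) (S : topologicalType) (E : finType) (M M' : drawing R S E).
Hypothesis hS : hausdorff_space S.
Hypothesis embM : embedded_graph M.
Hypothesis embM' : embedded_graph M'.
Hypothesis dualV : vertices M' `<=` ~` points M.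
Hypothesis noiso : forall v, vertices M v -> exists e, edge M e v.
Variables (y : E -> S) (tt tt' : E -> R).
Hypothesis ycr : forall e, edge M e `&` edge M' e = [set y e].
Hypothesis disjE : forall e e', e != e' -> edge M e `&` edge M' e' = set0.
Hypothesis tt01 : forall e, 0 < tt e < 1.
Hypothesis tt01' : forall e, 0 < tt' e < 1.
Hypothesis gamy : forall e, gam M e (tt e) = y e.
Hypothesis gamy' : forall e, gam M' e (tt' e) = y e.
Variables ch ch' : E -> S -> set S * (S -> R * R).
Hypothesis chP : forall e x, open_edge M e x ->
  straightens (ch e x).1 (ch e x).2 (open_edge M e) /\ (ch e x).1 x.
Hypothesis chP' : forall e x, open_edge M' e x ->
  straightens (ch' e x).1 (ch' e x).2 (open_edge M' e) /\ (ch' e x).1 x.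
Variables su sv : E -> S -> bool.
Hypothesis cr : forall e, crossing (open_edge M e) (open_edge M' e) (ch e) (ch' e)
  (half M e (tt e)) (half M' e (tt' e)) (y e) (su e) (sv e).

Local Notation A := (open_edge M).
Local Notation B := (open_edge M').
Local Notation X := (punctured M M').
Local Notation Y := (points M `|` points M').
Local Notation PA e := (half M e (tt e)).
Local Notation PB e := (half M' e (tt' e)).

Lemma Ay e : A e (y e). Proof. by rewrite -gamy; exact: open_edge_gam. Qed.
Lemma By e : B e (y e). Proof. by rewrite -gamy'; exact: open_edge_gam. Qed.

Lemma AB_same e e' x : A e x -> B e' x -> e = e' /\ x = y e.
Proof.
move=> /open_edge_edge Ax /open_edge_edge Bx; have [ee|ee] := eqVneq e e'.
  subst e'; split => //.
  by have : (edge M e `&` edge M' e) x by []; rewrite ycr.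
by have : (edge M e `&` edge M' e') x by []; rewrite disjE.
Qed.

Lemma A_punctured e x : A e x -> X x.
Proof.
move=> Ax [|/dualV]; first exact: (open_edge_not_vertex embM Ax).
by apply; right; exists e => //; exact: open_edge_edge.
Qed.

(** A vertex on the open coedge would lie on some edge by [noiso], hence be the crossing point of
    that edge, which is interior to the edge. *)
Lemma B_punctured e x : B e x -> X x.
Proof.
move=> Bx [Vx|]; last exact: (open_edge_not_vertex embM' Bx).
have [e' ex] := noiso Vx; have [ee|ee] := eqVneq e' e.
  subst e'; have : (edge M e `&` edge M' e) x by split => //; exact: open_edge_edge.
  by rewrite ycr => xy; apply: (open_edge_not_vertex embM (Ay e)); rewrite -xy.
have : (edge M e' `&` edge M' e) x by split => //; exact: open_edge_edge.
by rewrite disjE.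
Qed.

Lemma punctured_open : open X.
Proof.
by apply: closed_openC; apply: closedU; exact: vertices_closed.
Qed.

Lemma punctured_near x : X x -> nbhs x X.
Proof. by move=> Xx; apply: open_nbhs_nbhs; split => //; exact: punctured_open. Qed.

(** Edges and coedges are closed and finite in number, so those that come near x pass through it; x
    is not an end of any of them. *)
Lemma near_Y x : X x -> \forall z \near x, Y z ->
  (exists2 e, A e x & A e z) \/ (exists2 e, B e x & B e z).
Proof.
move=> Xx.
have H1 : \forall z \near x, forall e, edge M e z -> edge M e x.
  apply: (@near_forall_fin _ _ (fun e z => edge M e z -> edge M e x)) => e.
  have [ex|nex] := pselect (edge M e x); first exact: nearW.
  by apply: filterS (near_not (edge_closed hS embM (e := e)) nex).
have H2 : \forall z \near x, forall e, edge M' e z -> edge M' e x.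
  apply: (@near_forall_fin _ _ (fun e z => edge M' e z -> edge M' e x)) => e.
  have [ex|nex] := pselect (edge M' e x); first exact: nearW.
  by apply: filterS (near_not (edge_closed hS embM' (e := e)) nex).
apply: filterS3 H1 H2 (punctured_near Xx) => z E1 E2 Xz.
have eA e w : X w -> edge M e w -> A e w.
  by move=> Xw /(edge_open_or_vertex embM)[//|Vw]; case: Xw; left.
have eB e w : X w -> edge M' e w -> B e w.
  by move=> Xw /(edge_open_or_vertex embM')[//|Vw]; case: Xw; right.
move=> [[Vz|[e _ ez]]|[Vz|[e _ ez]]]; try by case: Xz; [left|right].
- by case: Xz; left.
- by left; exists e; apply: eA => //; exact: E1.
- by case: Xz; right.
- by right; exists e; apply: eB => //; exact: E2.
Qed.

Lemma A_Y e x : A e x -> Y x.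
Proof. by move=> /open_edge_edge ex; left; right; exists e. Qed.

Lemma B_Y e x : B e x -> Y x.
Proof. by move=> /open_edge_edge ex; right; right; exists e. Qed.

Lemma Y_cases x : X x -> Y x -> (exists e, A e x) \/ (exists e, B e x).
Proof.
by move=> /near_Y/nbhs_singleton H /H[[e]|[e]]; [left|right]; exists e.
Qed.

Lemma near_A e x : A e x -> x <> y e -> \forall z \near x, Y z -> A e z.
Proof.
move=> Ax xy; apply: filterS (near_Y (A_punctured Ax)) => z H /H[[e' Ax' Az]|[e' Bx _]].
  by rewrite (open_edge_disj embM Ax Ax').
by case: xy; have [] := AB_same Ax Bx.
Qed.

Lemma near_B e x : B e x -> x <> y e -> \forall z \near x, Y z -> B e z.
Proof.
move=> Bx xy; apply: filterS (near_Y (B_punctured Bx)) => z H /H[[e' Ax _]|[e' Bx' Bz]].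
  by case: xy; have [<-] := AB_same Ax Bx.
by rewrite (open_edge_disj embM' Bx Bx').
Qed.

Lemma near_y e : \forall z \near y e, Y z -> A e z \/ B e z.
Proof.
apply: filterS (near_Y (A_punctured (Ay e))) => z H /H[[e' Ax Az]|[e' Bx Bz]].
  by left; rewrite (open_edge_disj embM (Ay e) Ax).
by right; rewrite (open_edge_disj embM' (By e) Bx).
Qed.

Lemma thinY x : X x -> thin Y x.
Proof.
move=> Xx W xW; have [Yx|nY] := pselect (Y x); last first.
  by exists x => //; exact: nbhs_singleton xW.
have at_y e : x = y e -> exists2 z, W z & ~ Y z.
  move=> xy; subst x.
  have [z [[Wz Hz] nA nB _ _]] := quadrant (cr e) true true (filterI xW (near_y e)).
  by exists z => // /Hz[].
have [[e Ax]|[e Bx]] := Y_cases Xx Yx.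
  have [/at_y//|xy] := pselect (x = y e).
  have [z [Wz Hz] nA] := curve_thin (chP (e := e)) (filterI xW (near_A Ax xy)).
  by exists z => // /Hz.
have [/at_y//|xy] := pselect (x = y e).
have [z [Wz Hz] nB] := curve_thin (chP' (e := e)) (filterI xW (near_B Bx xy)).
by exists z => // /Hz.
Qed.

Lemma thinY_near x : X x -> \forall z \near x, thin Y z.
Proof. by move=> /punctured_near; apply: filterS => z; exact: thinY. Qed.

Definition edge_color e x z := `[< A e x >] && side (ch e) x z.
Definition coedge_color e x z := `[< B e x >] && side (ch' e) x z.
Definition corner e i j :=
  corner_color (ch e) (ch' e) (PA e) (PB e) (y e) (su e) (sv e) i j.

Lemma edge_far e x : X x -> ~ A e x -> \forall z \near x, ~ A e z.
Proof.
move=> Xx nA; have nE : ~ edge M e x.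
  by move=> /(edge_open_or_vertex embM)[//|Vx]; case: Xx; left.
by apply: filterS (near_not (edge_closed hS embM (e := e)) nE) => z nz /open_edge_edge.
Qed.

Lemma coedge_far e x : X x -> ~ B e x -> \forall z \near x, ~ B e z.
Proof.
move=> Xx nB; have nE : ~ edge M' e x.
  by move=> /(edge_open_or_vertex embM')[//|Vx]; case: Xx; right.
by apply: filterS (near_not (edge_closed hS embM' (e := e)) nE) => z nz /open_edge_edge.
Qed.

Lemma edge_rep e : exists D, rep D (A e) X (edge_color e).
Proof.
apply: atlas_rep; first by move=> x _; apply: nearW => z; exact: (curve_thin (chP (e := e))).
apply: (piece_atlas (chP (e := e))) => // x Xx; last exact: edge_far.
by move=> _; exact: nearW.
Qed.

Lemma coedge_rep e : exists D, rep D (B e) X (coedge_color e).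
Proof.
apply: atlas_rep; first by move=> x _; apply: nearW => z; exact: (curve_thin (chP' (e := e))).
apply: (piece_atlas (chP' (e := e))) => // x Xx; last exact: coedge_far.
by move=> _; exact: nearW.
Qed.

Lemma AY e : A e `<=` Y. Proof. by move=> x; exact: A_Y. Qed.
Lemma BY e : B e `<=` Y. Proof. by move=> x; exact: B_Y. Qed.

Lemma corner_rep e i j : exists D, rep D Y X (corner e i j).
Proof.
apply: atlas_rep; first exact: thinY_near.
apply: (@atlas_mono _ (A e `|` B e) Y X X) => //.
  by move=> x [/A_Y|/B_Y].
apply: corner_atlas => //.
- exact: chP.
- exact: chP'.
- by move=> k; exact: half_sub.
- by move=> k; exact: half_sub.
- by move=> k l x; exact: half_disj.
- by move=> k l x; exact: half_disj.
- by move=> k x; exact: half_open.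
- by move=> k x; exact: half_open.
- move=> k x Xx xy; rewrite -gamy in xy; apply: half_closed => // Vx; by apply: Xx; left.
- move=> k x Xx xy; rewrite -gamy' in xy; apply: half_closed => // Vx; by apply: Xx; right.
- by move=> x Ax Bx; have [] := AB_same Ax Bx.
Qed.

Section Periods.
Variable z : singular R 1 X -> 'F_2.
Hypothesis cz : cycle1 z.

Definition per (D : S -> S -> bool) : 'F_2 := period (restrict2 (X := X) D) z.

Lemma restrict_exact D c Z : rep D Z X c -> forall x, exact_at (restrict2 (X := X) D) x.
Proof.
move=> rD x; apply: exact_pull; first exact: set_val_continuous.
by apply: (rep_exact rD); exact: set_valP.
Qed.

Lemma perD D D' c c' Z Z' : rep D Z X c -> rep D' Z' X c' ->
  per (fun x w => D x w (+) D' x w) = per D + per D'.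
Proof.
move=> rD rD'; apply: periodD; [exact: restrict_exact rD|exact: restrict_exact rD'|].
exact: cz.1.
Qed.

(** A colouring f of the complement with the jumps prescribed by c extends to a global primitive of
    D on the punctured surface. *)
Lemma per_eq0 D c f : rep D Y X c ->
  (forall x, X x -> exists k, \forall w \near x, ~ Y w -> f w = c x w (+) k) -> per D = 0.
Proof.
move=> rD fc; have [g gp _] := rep_primitive thinY_near punctured_open rD fc.
apply: (@period_prim R _ _ (g \o set_val)) => // x.
apply: (prim_pull (@set_val_continuous S X)); apply: gp; exact: set_valP.
Qed.

Lemma per_false : per (fun _ _ => false) = 0.
Proof.
apply: (@period_prim R _ _ (fun=> false)) => // x.
exact: (@filterE _ _ (nbhs_filter x)).
Qed.

Lemma per_add3 D D' D'' c c' c'' : rep D Y X c -> rep D' Y X c' -> rep D'' Y X c'' ->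
  (forall x, X x -> exists k, \forall w \near x, ~ Y w ->
     false = c x w (+) c' x w (+) c'' x w (+) k) -> per D + per D' = per D''.
Proof.
move=> rD rD' rD'' H; have := per_eq0 (f := fun=> false) (repD (repD rD rD') rD'') H.
rewrite (perD (repD rD rD') rD'') (perD rD rD') => /eqP; rewrite addr_eq0 => /eqP ->.
by apply/eqP; rewrite eq_sym -subr_eq0 opprK addF2xx.
Qed.

Lemma corner_edge e i j D D' D'' : rep D Y X (corner e i j) -> rep D' Y X (corner e (~~ i) j) ->
  rep D'' (A e) X (edge_color e) -> per D + per D' = per D''.
Proof.
move=> rD rD' /(rep_mono (@AY e) (@subset_refl _ X)) rD''; apply: (per_add3 rD rD' rD'') => x Xx.
have [|||k Hk] := corner_curve _ _ (cr e) i j x _ (Ay e).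
- by move=> l; exact: half_sub.
- by move=> l m w; exact: half_disj.
- by move=> w Aw; rewrite -gamy; exact: half_cover.
by exists k; apply: filterS Hk => w Hw nY; apply: Hw => /A_Y.
Qed.

Lemma corner_coedge e i j D D' D'' : rep D Y X (corner e i j) -> rep D' Y X (corner e i (~~ j)) ->
  rep D'' (B e) X (coedge_color e) -> per D + per D' = per D''.
Proof.
move=> rD rD' /(rep_mono (@BY e) (@subset_refl _ X)) rD''; apply: (per_add3 rD rD' rD'') => x Xx.
have [|||k Hk] := corner_curve _ _ (crossing_sym (cr e)) j i x _ (By e).
- by move=> l; exact: half_sub.
- by move=> l m w; exact: half_disj.
- by move=> w Aw; rewrite -gamy'; exact: half_cover.
exists k; apply: filterS Hk => w Hw nY; rewrite /corner !(corner_color_sym (ch e)).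
by apply: Hw => /B_Y.
Qed.

End Periods.

(** * Colourings of the complement and linear relations between corner periods *)

Definition lcY (f : S -> bool) := forall x, ~ Y x -> locally_const f x.

Definition corner_values (f : S -> bool) (v : E -> bool -> bool -> bool) :=
  forall e, \forall w \near y e, ~ Y w -> f w = v e (su e w) (sv e w).

Lemma corner_values_exist f : lcY f -> exists v, corner_values f v.
Proof.
move=> lf; have /choice[v Hv] : forall e, exists v : bool -> bool -> bool,
    \forall w \near y e, ~ Y w -> f w = v (su e w) (sv e w).
  move=> e; have [|v Hv] := quadrant_const (cr e) (f := f).
    by apply: filterS (near_y e) => w Hw nA nB; apply: lf => /Hw[].
  exists v; apply: filterS Hv => w Hw nY; apply: Hw => [/A_Y|/B_Y]//.
by exists v.
Qed.

Lemma edge_corner_point f v e i : corner_values f v -> exists2 w, PA e i w &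
  exists k, \forall u \near w, ~ A e u -> f u = v e i (side (ch e) w u (+) k).
Proof.
move=> vf; apply: (crossing_half_point (cr e) _ _ _ (vf e)).
- by move=> w Aw Bw; have [] := AB_same Aw Bw.
- by move=> k l w; exact: half_disj.
- by move=> w; exact: near_A.
- by rewrite -gamy => W; exact: half_near.
Qed.

Lemma coedge_corner_point f v e j : corner_values f v -> exists2 w, PB e j w &
  exists k, \forall u \near w, ~ B e u -> f u = v e (side (ch' e) w u (+) k) j.
Proof.
move=> vf; apply: (crossing_half_point (v := fun j i => v e i j) (crossing_sym (cr e)) _ _ _ (vf
  e)).
- by move=> w Bw Aw; have [] := AB_same Aw Bw.
- by move=> k l w; exact: half_disj.
- by move=> w; exact: near_B.
- by rewrite -gamy' => W; exact: half_near.
Qed.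

Lemma jump_of_values (Z : set S) (c : S -> set S * (S -> R * R)) f w (v : bool -> bool) k :
  (\forall u \near w, ~ Z u -> f u = v (side c w u (+) k)) ->
  jump Z c f w (v true (+) v false).
Proof.
move=> H; exists (v k); apply: filterS H => u Hu nZ; rewrite Hu//.
by case: (side _ _ _); case: (k); case: (v true); case: (v false).
Qed.

(** Near the crossing the jump is the difference of the two corners along half i, and it is constant
    along this half, which meets no coedge. *)
Lemma jump_edge f v e i x : lcY f -> corner_values f v -> PA e i x ->
  jump (A e) (ch e) f x (v e i true (+) v e i false).
Proof.
move=> lf vf Px.
have exJ w : PA e i w -> exists m, jump (A e) (ch e) f w m.
  move=> Pw; have Aw := half_sub (tt01 e) Pw.
  have wy : w <> y e.
    by move=> wy; apply: (half_not_mid embM (tt01 e) (e := e) (i := i)); rewrite gamy -wy.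
  apply: (jump_exists (chP (e := e)) Aw).
  by apply: filterS (near_A Aw wy) => u Hu nA; apply: lf => /Hu.
have [w Pw [k /jump_of_values Jw]] := edge_corner_point e i vf.
have /andP[t0 t1] := tt01 e.
by move: Px Pw exJ Jw; rewrite /half; case: (i) => Px Pw exJ Jw;
  apply: (jump_piece embM _ _ (chP (e := e)) exJ Pw Px Jw) => //; exact: ltW.
Qed.

Lemma jump_coedge f v e j x : lcY f -> corner_values f v -> PB e j x ->
  jump (B e) (ch' e) f x (v e true j (+) v e false j).
Proof.
move=> lf vf Px.
have exJ w : PB e j w -> exists m, jump (B e) (ch' e) f w m.
  move=> Pw; have Bw := half_sub (tt01' e) Pw.
  have wy : w <> y e.
    by move=> wy; apply: (half_not_mid embM' (tt01' e) (e := e) (i := j)); rewrite gamy' -wy.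
  apply: (jump_exists (chP' (e := e)) Bw).
  by apply: filterS (near_B Bw wy) => u Hu nB; apply: lf => /Hu.
have [w Pw [k Hk]] := coedge_corner_point e j vf.
have Jw := jump_of_values (v := fun i => v e i j) Hk.
have /andP[t0 t1] := tt01' e.
by move: Px Pw exJ Jw; rewrite /half; case: (j) => Px Pw exJ Jw;
  apply: (jump_piece embM' _ _ (chP' (e := e)) exJ Pw Px Jw) => //; exact: ltW.
Qed.

Lemma rep_big (I : finType) (D c : I -> S -> S -> bool) (Z W : set S) :
  (forall i, rep (D i) Z W (c i)) ->
  rep (fun x w => \big[addb/false]_i D i x w) Z W (fun x w => \big[addb/false]_i c i x w).
Proof.
move=> rD x Wx; have /choice[F HF] : forall i, exists F,
    (\forall u \near x, prim (D i) F u) /\ (\forall w \near x, ~ Z w -> F w = c i x w).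
  by move=> i; have [F] := rD i x Wx; exists F.
exists (fun w => \big[addb/false]_i F i w).
  have := near_forall_fin (fun i => (HF i).1); apply: filterS => u Hu.
  have := near_forall_fin Hu; apply: filterS => w Hw.
  by rewrite -big_split/=; apply: eq_bigr => i _; exact: Hw.
have := near_forall_fin (fun i => (HF i).2); apply: filterS => w Hw nZ.
by apply: eq_bigr => i _; exact: Hw.
Qed.

Lemma rep_and (b : bool) D c (Z W : set S) : rep D Z W c ->
  rep (fun x w => b && D x w) Z W (fun x w => b && c x w).
Proof.
case: b => //= _ x Wx; exists (fun=> false); last exact: nearW.
by apply: nearW => u; exact: nearW.
Qed.

Lemma per_big z (cz : cycle1 z) (I : finType) (D c : I -> S -> S -> bool) :
  (forall i, rep (D i) Y X (c i)) ->
  per z (fun x w => \big[addb/false]_i D i x w) = \sum_i per z (D i).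
Proof.
move=> rD; rewrite /per /period; have [cz1 _] := cz.
have -> : \sum_i pairing z (fun s => (integ (restrict2 (X := X) (D i)) s)%:R) =
    pairing z (fun s => \sum_i (integ (restrict2 (X := X) (D i)) s)%:R).
  have /chain_bears[C bC] := cz1; rewrite (pairing_bears _ bC).
  under eq_bigr do rewrite (pairing_bears _ bC).
  by rewrite exchange_big/=; apply: eq_bigr => s _; rewrite mulr_sumr.
apply: eq_pairing => s _.
have /choice[g Hg] : forall i, exists g, (forall x, prim (fun x w => restrict2 (X := X) (D i) (s
  x) (s w)) g x) /\
   integ (restrict2 (X := X) (D i)) s = g (vtx R ord_max) (+) g (vtx R ord0).
  by move=> i; have [g] := integ_prim s (restrict_exact (rD i)); exists g.
rewrite (@integE _ _ _ s (fun x => \big[addb/false]_i g i x)).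
  have nb (F : I -> bool) : (\big[addb/false]_i F i)%:R = \sum_i (F i)%:R :> 'F_2.
    by elim/big_rec2: _ => // i a b _ <-; rewrite natF2D.
  rewrite natF2D !nb -big_split/=; apply: eq_bigr => i _.
  by rewrite (Hg i).2 natF2D.
move=> x.
have : \forall w \near x, forall i, restrict2 (X := X) (D i) (s x) (s w) = g i w (+) g i x.
  by apply: near_forall_fin => i; exact: (Hg i).1.
apply: filterS => w Hw; rewrite -big_split/=.
by apply: eq_bigr => i _; exact: Hw.
Qed.

Lemma per_and z (cz : cycle1 z) (b : bool) D : per z (fun x w => b && D x w) = b%:R * per z D.
Proof. by case: b; rewrite ?mul1r// mul0r; exact: per_false. Qed.

Lemma corner0 e i j x w : ~ A e x -> ~ B e x -> corner e i j x w = false.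
Proof.
move=> nA nB; rewrite /corner corner_colorN; last by move=> xy; apply: nA; rewrite xy; exact: Ay.
rewrite /half_color !asboolF// => /half_sub.
  by move=> /(_ (tt01' e)).
by move=> /(_ (tt01 e)).
Qed.

(** f is a primitive of the sum of the germs [D e i j] with [v e i j] true. Across half i of e it
    jumps by [v e i true] (+) [v e i false], and the curves of the corners (e, i, true) and (e, i,
    false) are those that contain this half; likewise for the coedges. *)
Lemma corner_relation f v z (D : E -> bool -> bool -> S -> S -> bool) : lcY f ->
  corner_values f v -> (forall e i j, rep (D e i j) Y X (corner e i j)) -> cycle1 z ->
  \sum_e \sum_i \sum_j (v e i j)%:R * per z (D e i j) = 0.
Proof.
move=> lf vf rD cz.
pose D1 e i x w := \big[addb/false]_j (v e i j && D e i j x w).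
pose D2 e x w := \big[addb/false]_i D1 e i x w.
pose c1 e i x w := \big[addb/false]_j (v e i j && corner e i j x w).
pose c2 e x w := \big[addb/false]_i c1 e i x w.
have r0 e i j : rep (fun x w => v e i j && D e i j x w) Y X (fun x w => v e i j && corner e i j
  x w).
  exact: rep_and.
have r1 e i : rep (D1 e i) Y X (c1 e i) by apply: rep_big => j.
have r2 e : rep (D2 e) Y X (c2 e) by apply: rep_big => i.
have r3 := rep_big r2.
transitivity (per z (fun x w => \big[addb/false]_e D2 e x w)).
  rewrite (per_big cz r2); apply: eq_bigr => e _.
  rewrite (per_big cz (r1 e)); apply: eq_bigr => i _.
  rewrite (per_big cz (r0 e i)); apply: eq_bigr => j _.
  by rewrite per_and.
apply: (per_eq0 cz (f := f) r3) => x Xx.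
have c20 e w : ~ A e x -> ~ B e x -> c2 e x w = false.
  by move=> nA nB; rewrite /c2 big1// => i _; rewrite /c1 big1// => j _; rewrite corner0// andbF.
have [Yx|nY] := pselect (Y x); last first.
  exists (f x); apply: filterS (lf _ nY) => w -> _.
  by rewrite big1// => e _; apply: c20 => [/A_Y|/B_Y].
have [e ABx] : exists e, A e x \/ B e x.
  by have [[e]|[e]] := Y_cases Xx Yx; exists e; [left|right].
have only w : \big[addb/false]_e' c2 e' x w = c2 e x w.
  rewrite (bigD1 e)//= big1 ?addbF// => e' /negP ee; apply: c20 => H; apply: ee.
    case: ABx => H'; first by rewrite (open_edge_disj embM H H').
    by have [->] := AB_same H H'.
  case: ABx => H'; first by have [->] := AB_same H' H.
  by rewrite (open_edge_disj embM' H H').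
have c2E w : c2 e x w = (v e true true && corner e true true x w) (+)
    (v e true false && corner e true false x w) (+) ((v e false true && corner e false true x w) (+)
    (v e false false && corner e false false x w)).
  by rewrite /c2 /c1 !big_bool.
have [xy|xy] := pselect (x = y e).
  (* At a crossing the quadrant indicators weighted by v add up to f itself. *)
  subst x; exists false; apply: filterS (vf e) => w Hw nYw.
  rewrite only c2E Hw// /corner !corner_colory.
  by case: (su e w); case: (sv e w); rewrite /= ?andbF ?andbT ?addbF.
case: ABx => [Ax|Bx].
  have [i Px] : exists i, PA e i x.
    by have := half_cover (tt01 e) Ax; rewrite gamy => /(_ xy)[]; [exists true|exists false].
  have [n Hn] := jump_edge lf vf Px.
  exists n; apply: filterS2 Hn (near_A Ax xy) => w Hw HA nYw.
  rewrite only c2E Hw => [|/A_Y]//.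
  rewrite /corner !corner_colorN// /half_color.
  have nB j : `[< PB e j x >] = false.
    by apply/asboolPn => /(half_sub (tt01' e)) Bx; apply: xy; have [] := AB_same Ax Bx.
  have PE k : `[< PA e k x >] = (i == k).
    by apply/asboolP/eqP => [/(half_disj embM (tt01 e) Px)//|<-].
  rewrite !nB !PE /= !addbF.
  by case: (i); case: (side _ _ _); case: (n); rewrite /= ?andbF ?andbT ?addbF ?addFb //;
    do 2 case: (v _ _ _).
have [j Px] : exists j, PB e j x.
  by have := half_cover (tt01' e) Bx; rewrite gamy' => /(_ xy)[]; [exists true|exists false].
have [n Hn] := jump_coedge lf vf Px.
exists n; apply: filterS2 Hn (near_B Bx xy) => w Hw HB nYw.
rewrite only c2E Hw => [|/B_Y]//.
rewrite /corner !corner_colorN// /half_color.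
have nA i : `[< PA e i x >] = false.
  by apply/asboolPn => /(half_sub (tt01 e)) Ax; apply: xy; have [] := AB_same Ax Bx.
have PE k : `[< PB e k x >] = (j == k).
  by apply/asboolP/eqP => [/(half_disj embM' (tt01' e) Px)//|<-].
rewrite !nA !PE /=.
by case: (j); case: (side _ _ _); case: (n); rewrite /= ?andbF ?andbT ?addbF ?addFb //;
  do 2 case: (v _ _ _).
Qed.

(** * Half coedges as rays in the faces *)

Hypothesis cellM : forall F, face M F -> open_2cell R F.
Hypothesis faceV : forall F, face M F -> exists! v, vertices M' v /\ F v.

Lemma face_open F : face M F -> open F.
Proof. by move=> /cellM[h []]. Qed.

Lemma face_sub F x : face M F -> F x -> ~ points M x.
Proof. by move=> [x0 _ ->] /connected_component_sub. Qed.

Lemma face_eq F F' x : face M F -> face M F' -> F x -> F' x -> F = F'.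
Proof.
move=> [x0 _ ->] [x1 _ ->] H0 H1.
by rewrite (same_connected_component H0) (same_connected_component H1).
Qed.

Lemma face_at x : ~ points M x -> exists2 F, face M F & F x.
Proof.
move=> nx; exists (connected_component (~` points M) x); first by exists x.
exact: connected_component_refl.
Qed.

Lemma face_lc F x : face M F -> ~ points M x -> locally_const (fun w => `[< F w >]) x.
Proof.
move=> fF nx; have [F' fF' F'x] := face_at nx.
apply: filterS (open_nbhs_nbhs (conj (face_open fF') F'x)) => w F'w.
have [Fx|nFx] := pselect (F x).
  by rewrite (face_eq fF fF' Fx F'x) !asboolT.
rewrite (asboolF nFx) asboolF// => Fw; apply: nFx.
by rewrite (face_eq fF fF' Fw F'w).
Qed.

Definition ray_end e (j : bool) : S := gam M' e (if j then 1 else 0).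

Definition ray_face e j : set S := connected_component (~` points M) (ray_end e j).

Lemma ray_end_vertex e j : vertices M' (ray_end e j).
Proof. by have [] := vertex_ends embM' e; rewrite /ray_end; case: j. Qed.

Lemma ray_faceP e j : face M (ray_face e j).
Proof. by exists (ray_end e j) => //; apply: dualV; exact: ray_end_vertex. Qed.

Lemma ray_face_end e j : ray_face e j (ray_end e j).
Proof. by apply: connected_component_refl; apply: dualV; exact: ray_end_vertex. Qed.

Lemma PB_neq e j x : PB e j x -> x <> y e.
Proof. by move=> + xy; rewrite xy -gamy'; exact: (half_not_mid embM' (tt01' e)). Qed.

Lemma PB_B e j x : PB e j x -> B e x. Proof. exact: half_sub. Qed.

Lemma ray_points e j x : PB e j x -> ~ points M x.
Proof.
move=> Px; have Bx := PB_B Px; move=> [Vx|[e' _ /(edge_open_or_vertex embM)[Ax|Vx]]].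
- by apply: (B_punctured Bx); left.
- by have [ee xy] := AB_same Ax Bx; apply: (PB_neq Px); rewrite xy ee.
- by apply: (B_punctured Bx); left.
Qed.

(** From the covertex back to, but not including, the crossing, the half coedge misses M, and the
    indicator of a face is locally constant off M. *)
Lemma ray_in_face e j : PB e j `<=` ray_face e j.
Proof.
move=> x; have cg := @gam_continuous _ _ _ _ embM' e; have [v0 v1] := vertex_ends embM' e.
have fF := ray_faceP e j.
have H (a b : R) : a <= b -> (forall s, a <= s <= b -> ~ points M (gam M' e s)) ->
    ray_face e j (gam M' e a) <-> ray_face e j (gam M' e b).
  move=> ab nM; have : `[< ray_face e j (gam M' e a) >] = `[< ray_face e j (gam M' e b) >].
    apply: (@path_const R S (fun w => `[< ray_face e j w >]) (gam M' e)) => // s sab.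
    by apply: face_lc => //; exact: nM.
  by move=> E0; split => /asboolP H0; apply/asboolP; [rewrite -E0|rewrite E0].
have := ray_face_end e j; rewrite /ray_end.
case: j fF H => fF H Fe; move=> [t /andP[t0 t1] <-].
  apply/(H _ 1 (ltW t1)) => // s /andP[ts s1]; have [->|sn] := eqVneq s 1.
    exact: dualV.
  apply: (@ray_points e true); exists s => //.
  by rewrite (lt_le_trans t0 ts) lt_neqAle sn.
apply/(H 0 _ (ltW t0)) => // s /andP[s0 st]; have [->|sn] := eqVneq s 0.
  exact: dualV.
apply: (@ray_points e false); exists s => //.
by rewrite (le_lt_trans st t1) lt_neqAle eq_sym sn s0.
Qed.

Lemma face_vertex F v v' : face M F -> vertices M' v -> vertices M' v' -> F v -> F v' -> v = v'.
Proof. by move=> /faceV[u [_ u1]] V1 V2 F1 F2; rewrite -(u1 v)// -(u1 v'). Qed.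

Lemma face_punctured F v x : face M F -> vertices M' v -> F v -> F x -> x <> v -> X x.
Proof.
move=> fF Vv Fv Fx xv [Vx|Vx]; first by apply: (face_sub fF Fx); left.
by apply: xv; exact: (face_vertex fF).
Qed.

Lemma Y_in_face F x : face M F -> F x -> Y x -> X x -> exists e j, PB e j x /\ ray_face e j = F.
Proof.
move=> fF Fx Yx Xx; have [[e Ax]|[e Bx]] := Y_cases Xx Yx.
  by case: (face_sub fF Fx); right; exists e => //; exact: open_edge_edge.
have xy : x <> y e.
  move=> xy; apply: (face_sub fF Fx); right; exists e => //; rewrite xy.
  by apply: open_edge_edge; exact: Ay.
have [j Px] : exists j, PB e j x.
  by have := half_cover (tt01' e) Bx; rewrite gamy' => /(_ xy)[]; [exists true|exists false].
exists e, j; split => //; apply: (face_eq (ray_faceP e j) fF _ Fx).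
exact: ray_in_face Px.
Qed.

Definition ray_color e j := half_color (PB e) (ch' e) j.

(** The possible ends of the two rays of e are removed, so that a ray is relatively closed in this
    set. *)
Definition ray_dom e : set S := [set x | ~ vertices M' x /\ x <> y e].

Lemma ray_rep e j : exists D, rep D (B e) (ray_dom e) (ray_color e j).
Proof.
apply: atlas_rep; first by move=> x _; apply: nearW => w; exact: (curve_thin (chP' (e := e))).
apply: (piece_atlas (chP' (e := e))).
- exact: half_sub.
- by move=> x _; exact: half_open.
- by move=> x [nV xy]; rewrite -gamy' in xy; exact: half_closed.
Qed.

Lemma face_ray_dom e F v : face M F -> vertices M' v -> F v ->
  [set x | F x /\ x <> v] `<=` ray_dom e.
Proof.
move=> fF Vv Fv x [Fx xv]; split.
  by move=> Vx; apply: xv; exact: (face_vertex fF).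
move=> xy; apply: (face_sub fF Fx); right; exists e => //; rewrite xy.
by apply: open_edge_edge; exact: Ay.
Qed.

(** The cut point is halfway in the parameter between the crossing and the covertex. C is the
    compact arc from it to the covertex, and the piece (a, b) is the subray going to infinity in the
    face. Half [~~ j] at the cut point starts in the subray, half j in C. *)
Lemma ray_cut e j : exists t1 a b (C : set S), [/\ 0 < t1 < 1 /\ PB e j (gam M' e t1),
  0 <= a /\ b <= 1, (forall x, x <> y e -> x <> gam M' e t1 -> x <> gam M' e a /\ x <> gam M' e b),
  [/\ C (ray_end e j), C (gam M' e t1), compact C & C `<=` PB e j `|` [set ray_end e j]] &
  [/\ (forall x, PB e j x -> ~ C x -> piece M' e a b x),
      (forall x, piece M' e a b x -> ~ C x),
      piece M' e a b `<=` PB e j,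
      (forall x, half M' e t1 (~~ j) x -> PB e j x -> piece M' e a b x) &
      (forall x, half M' e t1 j x -> ~ piece M' e a b x)]].
Proof.
have /andP[tp tl] := tt01' e.
have inj := @gam_inj _ _ _ _ embM' e e.
case: j.
  pose t1 := (tt' e + 1) / 2.
  have tt1 : tt' e < t1 by rewrite /t1; lra.
  have t11 : t1 < 1 by rewrite /t1; lra.
  exists t1, (tt' e), t1, (gam M' e @` `[t1, 1]%classic); split.
  - split; first by rewrite t11 (lt_trans tp tt1).
    by exists t1 => //; rewrite tt1.
  - by split; apply: ltW.
  - by move=> x; rewrite -gamy'.
  - split.
    + by exists 1 => //=; rewrite in_itv/= lexx ltW.
    + by exists t1 => //=; rewrite in_itv/= lexx ltW.
    + exact: arc_compact.
    + move=> x [t /=]; rewrite in_itv/= => /andP[t1t tle1] <-.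
      have [->|tn] := eqVneq t 1; [by right|left]; exists t => //.
      by rewrite (lt_le_trans tt1 t1t) lt_neqAle tn.
  - split.
    + move=> x [t /andP[tt_ t1_] <-] nC; exists t => //; rewrite tt_ ltNge.
      by apply/negP => t1t; apply: nC; exists t => //=; rewrite in_itv/= t1t ltW.
    + move=> x [t /andP[tt_ tt1_] <-] [s /=]; rewrite in_itv/= => /andP[t1s s1] sE.
      have [|||_ tE] := inj t s; rewrite ?sE//.
      * by rewrite (lt_trans tp tt_) (lt_trans tt1_ t11).
      * by rewrite s1 andbT (le_trans _ t1s)// ltW// (lt_trans tp tt1).
      * by move: tt1_; rewrite tE ltNge t1s.
    + by move=> x [t /andP[tt_ tt1_] <-]; exists t => //; rewrite tt_ (lt_trans tt1_ t11).
    + move=> x [t /andP[t0 tt1_] <-] [s /andP[s0 s1] sE].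
      have [|||_ sE'] := inj s t; rewrite ?sE//.
      * by rewrite s1 (lt_trans tp s0).
      * by rewrite !ltW// (lt_trans tt1_ t11).
      * by exists t => //; rewrite tt1_ -sE' s0.
    + move=> x [t /andP[t1t tle1] <-] [s /andP[s0 s1] sE].
      have [|||_ sE'] := inj s t; rewrite ?sE//.
      * by rewrite (lt_trans tp s0) (lt_trans s1 t11).
      * by rewrite !ltW// (lt_trans tp)// (lt_trans tt1).
      * by move: s1; rewrite sE' ltNge ltW.
pose t1 := tt' e / 2.
have tt1 : t1 < tt' e by rewrite /t1; lra.
have t10 : 0 < t1 by rewrite /t1; lra.
exists t1, t1, (tt' e), (gam M' e @` `[0, t1]%classic); split.
- split; first by rewrite t10 (lt_trans tt1 tl).
  by exists t1 => //; rewrite tt1 t10.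
- by split; apply: ltW.
- by move=> x; rewrite -gamy'.
- split.
  + by exists 0 => //=; rewrite in_itv/= lexx ltW.
  + by exists t1 => //=; rewrite in_itv/= lexx ltW.
  + exact: arc_compact.
  + move=> x [t /=]; rewrite in_itv/= => /andP[t0 tt1_] <-.
    have [->|tn] := eqVneq t 0; [by right|left]; exists t => //.
    by rewrite (le_lt_trans tt1_ tt1) lt_neqAle eq_sym tn t0.
- split.
  + move=> x [t /andP[t0 tt_] <-] nC; exists t => //; rewrite tt_ andbT ltNge.
    by apply/negP => t1t; apply: nC; exists t => //=; rewrite in_itv/= t1t ltW.
  + move=> x [t /andP[tt_ tt1_] <-] [s /=]; rewrite in_itv/= => /andP[s0 st1] sE.
    have [|||_ tE] := inj t s; rewrite ?sE//.
    * by rewrite (lt_trans t10 tt_) (lt_trans tt1_ tl).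
    * by rewrite s0 (le_trans st1)// ltW// (lt_trans tt1 tl).
    * by move: tt_; rewrite tE ltNge st1.
  + by move=> x [t /andP[tt_ tt1_] <-]; exists t => //; rewrite tt1_ (lt_trans t10 tt_).
  + move=> x [t /andP[t0 tt1_] <-] [s /andP[s0 s1] sE].
    have [|||_ sE'] := inj s t; rewrite ?sE//.
    * by rewrite s0 (lt_trans s1 tl).
    * by rewrite !ltW// (lt_trans t10 t0).
    * by exists t => //; rewrite t0 -sE' s1.
  + move=> x [t /andP[t0 tt1_] <-] [s /andP[s0 s1] sE].
    have [|||_ sE'] := inj s t; rewrite ?sE//.
    * by rewrite (lt_trans t10 s0) (lt_trans s1 tl).
    * by rewrite !ltW// (lt_trans tt1_)// (lt_trans tt1).
    * by move: s0; rewrite sE' ltNge ltW.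
Qed.

(* A ray from the covertex to infinity does not separate its face: cutting it at p
   leaves a subray that agrees with the supposed colouring outside a compact set, so
   that the subray is a coboundary on the complement of p, contradicting the picture
   in a chart around p. *)
Lemma ray_inexact e j D : rep D (B e) (ray_dom e) (ray_color e j) ->
  ~ exact_on D [set x | ray_face e j x /\ x <> ray_end e j].
Proof.
move=> rD [g gp].
have [t1 [a [b [C [[t101 Pp] [a0 b1] ends [Ce Cp cC CP] [PC pC pP hP hnP]]]]]] := ray_cut e j.
set F := ray_face e j; set p := gam M' e t1; pose Q := piece M' e a b.
have fF : face M F := ray_faceP e j.
have FC : C `<=` F.
  by move=> x /CP[/ray_in_face//|->]; exact: ray_face_end.
have QB : Q `<=` B e by exact: piece_sub.
pose c x w := `[< Q x >] && side (ch' e) x w.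
have [D0 rD0] : exists D0, rep D0 (B e) [set x | x <> y e /\ x <> p] c.
  apply: atlas_rep; first by move=> x _; apply: nearW => w; exact: (curve_thin (chP' (e := e))).
  apply: (piece_atlas (chP' (e := e))) => //.
    by move=> x _; exact: piece_open.
  by move=> x [xy xp] nQ; have [] := ends _ xy xp; exact: piece_closed.
have Fy x : F x -> x <> y e.
  move=> Fx xy; apply: (face_sub fF Fx); right; exists e => //; rewrite xy.
  by apply: open_edge_edge; exact: Ay.
have oFC : open [set x | F x /\ ~ C x].
  apply: openI; first exact: face_open.
  by apply: closed_openC; exact: compact_closed.
(* Outside C the ray and the subray coincide, so the supposed primitive g of the ray serves the
   subray too. *)
have [G0 G0p _] : exists2 G0, (forall x, F x /\ ~ C x -> prim D0 G0 x) &
    (forall x, F x /\ ~ C x -> ~ B e x -> G0 x = g x).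
  apply: (@rep_primitive _ _ (B e) [set x | F x /\ ~ C x] c) => //.
  - by move=> x _; apply: nearW => w; exact: (curve_thin (chP' (e := e))).
  - apply: rep_mono rD0 => // x [Fx nC]; split; first exact: Fy.
    by move=> xp; apply: nC; rewrite xp.
  move=> x [Fx nC]; have xe : x <> ray_end e j by move=> xe; apply: nC; rewrite xe.
  have [k Hk] := prim_rep rD (face_ray_dom e fF (ray_end_vertex e j) (ray_face_end e j) (conj Fx
    xe))
    (gp _ (conj Fx xe)).
  exists k; apply: filterS Hk => w Hw nB; rewrite Hw// /ray_color /half_color /c.
  congr ((_ && _) (+) _); apply/asboolP/asboolP => [Px|Qx]; first exact: PC.
  exact: pP.
have [h Fh] := cellM fF.
(* C is compact in the cell F, so exactness outside C extends to the complement of p. *)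
have [||G Gp] := @cell_exact_outside R S F h Fh D0 C p G0 (FC _ Cp) FC cC.
- by move=> x Fx xp; apply: (rep_exact rD0); split => //; exact: Fy.
- by move=> x Fx nC; exact: G0p.
have Gk x : F x -> x <> p -> exists k, \forall w \near x, ~ B e w -> G w = c x w (+) k.
  by move=> Fx xp; apply: (prim_rep rD0); [split => //; exact: Fy|exact: Gp].
have Bp : B e p := PB_B Pp.
have Fp : F p := FC _ Cp.
have nF : nbhs p F by apply: open_nbhs_nbhs; split => //; exact: face_open.
(* Off the curve G is locally constant near p, so it has one jump m across the curve there; but m is
   true along the subray and false along C. *)
have [m Jm] : exists m, jump (B e) (ch' e) G p m.
  apply: (jump_exists (chP' (e := e)) Bp).
  apply: filterS2 nF (punctured_near (B_punctured Bp)) => x Fx Xx nB.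
  have xp : x <> p by move=> xp; apply: nB; rewrite xp.
  have [k Hk] := Gk _ Fx xp.
  have H : \forall w \near x, G w = k.
    apply: filterS2 Hk (coedge_far Xx nB) => w Hw nBw.
    by rewrite Hw// /c asboolF// => /QB.
  by have := nbhs_singleton H => Gx; apply: filterS H => w ->; rewrite Gx.
have N : nbhs p [set w | [/\ F w, B e w -> jump (B e) (ch' e) G w m & B e w -> PB e j w]].
  have N1 := jump_near (chP' (e := e)) Bp Jm.
  have N2 := half_open (e := e) hS embM' (tt01' e) Pp.
  by apply: filterS3 nF N1 N2 => w; split.
have [w [Fw Jw Pw] [hw [Bw wp]]] := half_near embM' t101 (~~ j) N.
have [w' [Fw' Jw' Pw'] [hw' [Bw' wp']]] := half_near embM' t101 j N.
have m1 : m = true.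
  apply: (jump_uniq (chP' (e := e)) Bw (Jw Bw)).
  have [k Hk] := Gk _ Fw wp; exists k; apply: filterS Hk => u Hu nB; rewrite Hu//.
  have Qw : Q w by apply: hP => //; exact: Pw.
  by rewrite /c (asboolT Qw) addbC.
have m0 : m = false.
  apply: (jump_uniq (chP' (e := e)) Bw' (Jw' Bw')).
  have [k Hk] := Gk _ Fw' wp'; exists k; apply: filterS Hk => u Hu nB; rewrite Hu//.
  have nQ : ~ Q w' by exact: hnP.
  by rewrite /c (asboolF nQ) addbC.
by rewrite m1 in m0.
Qed.

Definition single_ray e j : bool -> E -> bool := fun j' e' => (e' == e) && (j' == j).

Lemma PB_same e e' j j' x : PB e j x -> PB e' j' x -> e = e' /\ j = j'.
Proof.
move=> Px Px'; have ee := open_edge_disj embM' (PB_B Px) (PB_B Px'); subst e'.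
by split => //; exact: (half_disj embM' (tt01' e) Px Px').
Qed.

Lemma ray_color_at e j e' j' x w : PB e' j' x ->
  ray_color e j x w = single_ray e j j' e' && side (ch' e') x w.
Proof.
move=> Px; rewrite /ray_color /half_color /single_ray.
have [[ee jj]|ne] := pselect (e' = e /\ j' = j).
  by subst e' j'; rewrite asboolT// !eqxx.
rewrite asboolF => [|Px']; last by apply: ne; have [] := PB_same Px Px'.
by apply/esym/negbTE; rewrite negb_and; apply/orP; left; apply/negP => /andP[/eqP ? /eqP ?];
  apply: ne.
Qed.

Lemma ray_color_off e j x w : ~ Y x -> ray_color e j x w = false.
Proof. by move=> nY; rewrite /ray_color /half_color asboolF// => /PB_B/B_Y. Qed.

Lemma face_thin F v : face M F -> vertices M' v -> F v ->
  forall x, [set x | F x /\ x <> v] x -> \forall w \near x, thin Y w.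
Proof.
by move=> fF Vv Fv x [Fx xv]; apply: thinY_near; exact: (face_punctured fF Vv Fv).
Qed.

Lemma face_minus_open F v : face M F -> open [set x | F x /\ x <> v].
Proof.
move=> fF; apply: openI; first exact: face_open.
by apply: closed_openC; apply: compact_closed => //; exact: compact_set1.
Qed.

(** Such a colouring would give a primitive of the germ of one ray on its face minus the
    covertex. *)
Lemma no_single_jump f v e j : lcY f -> corner_values f v ->
  ~ (forall e' j', v e' true j' (+) v e' false j' = single_ray e j j' e').
Proof.
move=> lf vf sj; have [D rD] := ray_rep e j; apply: (ray_inexact rD).
have fF := ray_faceP e j; have Vv := ray_end_vertex e j; have Fv := ray_face_end e j.
have rDY := rep_mono (@BY e) (face_ray_dom e fF Vv Fv) rD.
have [|g gp _] := rep_primitive (f := f) (face_thin fF Vv Fv) (face_minus_open (ray_end e j) fF)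
  rDY;
  last by exists g.
move=> x [Fx xv]; have Xx := face_punctured fF Vv Fv Fx xv.
have [Yx|nY] := pselect (Y x); last first.
  by exists (f x); apply: filterS (lf _ nY) => w -> _; rewrite ray_color_off.
have [e' [j' [Px _]]] := Y_in_face fF Fx Yx Xx.
have [n Hn] := jump_coedge lf vf Px; rewrite sj in Hn.
exists n; apply: filterS Hn => w Hw nYw; rewrite (ray_color_at _ _ _ Px).
by rewrite (Hw (fun Bw => nYw (B_Y Bw))) addbC.
Qed.

(** Both rays end at the unique covertex of F and neither germ is exact on F minus this point, so
    their sum is exact there; its primitive is the colouring wanted inside F. *)
Lemma two_jumps e j e' j' : ray_face e j = ray_face e' j' -> (e, j) <> (e', j') ->
  exists f v, [/\ lcY f, corner_values f v &
    forall e'' j'', v e'' true j'' (+) v e'' false j'' =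
      single_ray e j j'' e'' (+) single_ray e' j' j'' e''].
Proof.
move=> FF ne; set F := ray_face e j.
have fF : face M F := ray_faceP e j; have Vv := ray_end_vertex e j;
  have Fv : F _ := ray_face_end e j.
have vE : ray_end e' j' = ray_end e j.
  by apply: (face_vertex fF) => //; [exact: ray_end_vertex|rewrite /F FF; exact: ray_face_end].
have [D rD] := ray_rep e j; have [D' rD'] := ray_rep e' j'.
have nD := ray_inexact rD; have nD' := ray_inexact rD'; rewrite -FF vE in nD'.
have sub e0 := face_ray_dom e0 fF Vv Fv.
have [h Fh] := cellM fF.
have [||g gp] := cell_inexact_sum Fh Fv _ _ nD nD'.
- by move=> x Fx xv; apply: (rep_exact rD); exact: sub.
- by move=> x Fx xv; apply: (rep_exact rD'); exact: sub.
have rDD := repD (rep_mono (@BY e) (sub e) rD) (rep_mono (@BY e') (sub e') rD').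
(* The indicator of F is locally constant off M, so extending g by false outside F keeps f locally
   constant off Y. *)
pose f x := `[< F x >] && g x.
have gk x : F x -> x <> ray_end e j -> exists k, \forall w \near x, ~ Y w ->
    f w = ray_color e j x w (+) ray_color e' j' x w (+) k.
  move=> Fx xv; have [k Hk] := prim_rep rDD (conj Fx xv) (gp _ (conj Fx xv)); exists k.
  apply: filterS2 Hk (open_nbhs_nbhs (conj (face_open fF) Fx)) => w Hw Fw nY.
  by rewrite /f asboolT// Hw.
have f0 x : ~ points M x -> ~ F x -> \forall w \near x, f w = false.
  move=> nM nF; apply: filterS (face_lc fF nM) => w; rewrite /f (asboolF nF).
  by move=> ->.
have lf : lcY f.
  move=> x nY; have nM : ~ points M x by move=> Mx; apply: nY; left.
  have [Fx|nF] := pselect (F x); last first.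
    have := f0 _ nM nF => H; have fx := nbhs_singleton H.
    by apply: filterS H => w ->; rewrite fx.
  have xv : x <> ray_end e j by move=> xv; apply: nY; right; left; rewrite xv.
  have [k Hk] := gk _ Fx xv; have Xx := face_punctured fF Vv Fv Fx xv.
  have H : \forall w \near x, f w = k.
    apply: filterS2 Hk (near_Y Xx) => w Hw HY; rewrite Hw ?ray_color_off//.
    by move=> /HY[[e0 /A_Y]|[e0 /B_Y]].
  by have fx := nbhs_singleton H; apply: filterS H => w ->; rewrite fx.
have [v vf] := corner_values_exist lf.
exists f, v; split => // e2 j2.
(* The jump is the same along the whole ray, so it may be computed at any one of its points. *)
have [x Px] : exists x, PB e2 j2 x.
  have [x _ [Px _]] := half_near embM' (tt01' e2) j2 (filterT : nbhs (gam M' e2 (tt' e2)) setT).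
  by exists x.
have Bx := PB_B Px; apply: (jump_uniq (chP' (e := e2)) Bx (jump_coedge lf vf Px)).
have nM := ray_points Px; have xy := PB_neq Px.
have [Fx|nF] := pselect (F x).
  have xv : x <> ray_end e j.
    by move=> xv; apply: (B_punctured Bx); right; rewrite xv.
  have [k Hk] := gk _ Fx xv; exists k; apply: filterS2 Hk (near_B Bx xy) => w Hw HB nBw.
  rewrite Hw; last by move=> /HB.
  rewrite !(ray_color_at _ _ _ Px).
  by case: (single_ray _ _ _ _); case: (single_ray _ _ _ _); case: (side _ _ _); case: (k).
have s0 e0 j0 : ray_face e0 j0 = F -> single_ray e0 j0 j2 e2 = false.
  move=> F0; apply/negP => /andP[/eqP ee /eqP jj]; subst e2 j2.
  by apply: nF; rewrite -F0; exact: ray_in_face.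
rewrite !s0//; exists false; apply: filterS (f0 _ nM nF) => w -> _.
by [].
Qed.

Lemma face_values e j : exists f v, [/\ lcY f, corner_values f v &
  forall e' i j', v e' i j' = `[< ray_face e' j' = ray_face e j >]].
Proof.
set F := ray_face e j; have fF : face M F := ray_faceP e j.
pose f x := `[< F x >].
have lf : lcY f by move=> x nY; apply: face_lc => // Mx; apply: nY; left.
have [v vf] := corner_values_exist lf.
exists f, v; split => // e' i j'.
have [w Pw [k Hk]] := coedge_corner_point e' j' vf; have Bw := PB_B Pw.
have fw : `[< ray_face e' j' = F >] = f w.
  apply/asboolP/asboolP => [<-|Fw]; first exact: ray_in_face.
  by apply: (face_eq (ray_faceP e' j') fF _ Fw); exact: ray_in_face.
have flc : \forall u \near w, f u = f w by apply: face_lc => //; exact: ray_points Pw.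
have [s Uw] := chP' Bw.
have W : nbhs w [set u | f u = f w /\ (~ B e' u -> f u = v e' (side (ch' e') w u (+) k) j')].
  by apply: filterS2 flc Hk.
(* A point close to w on the side i (+) k lies in the corner (e', i, j'). *)
have [u [[fu fv] _ nB su_]] := near_side (i (+) k) s Uw Bw W.
by rewrite fw -fu fv// /side su_ addbK.
Qed.

(** * Boolean operations on corner values and the isotropy relation *)

Lemma corner_values_const b : lcY (fun=> b) /\ corner_values (fun=> b) (fun _ _ _ => b).
Proof. by split => [x _|e]; exact: nearW. Qed.

Lemma corner_values_op (op : bool -> bool -> bool) f f' v v' :
  lcY f -> lcY f' -> corner_values f v -> corner_values f' v' ->
  lcY (fun x => op (f x) (f' x)) /\
  corner_values (fun x => op (f x) (f' x)) (fun e i j => op (v e i j) (v' e i j)).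
Proof.
move=> lf lf' vf vf'; split=> [x nY|e].
  by apply: filterS2 (lf _ nY) (lf' _ nY) => w -> ->.
by apply: filterS2 (vf e) (vf' e) => w H H' nY; rewrite H// H'.
Qed.

Lemma isotropy z z' (Dphi Dpsi : E -> S -> S -> bool) :
  (forall e, rep (Dphi e) (A e) X (edge_color e)) ->
  (forall e, rep (Dpsi e) (B e) X (coedge_color e)) -> cycle1 z -> cycle1 z' ->
  \sum_e (per z (Dphi e) * per z' (Dpsi e) + per z (Dpsi e) * per z' (Dphi e)) = 0.
Proof.
move=> rphi rpsi cz cz'.
have /choice[D rD] : forall k : E * bool * bool, exists D, rep D Y X (corner k.1.1 k.1.2 k.2).
  by move=> k; exact: corner_rep.
pose W (u : E * bool * bool -> bool) := exists f v, [/\ lcY f, corner_values f v &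
  forall e i j, u (e, i, j) = v e i j].
have rays (e e' : E) (j j' : bool) : single_ray e j j' e' = ((e', j') == (e, j)).
  by rewrite xpair_eqE.
have rel c : cycle1 c -> forall u, W u -> \sum_k (u k)%:R * per c (D k) = 0.
  move=> cc u [f [v [lf vf uv]]].
  rewrite -[RHS](corner_relation lf vf (fun e i j => rD (e, i, j)) cc).
  rewrite pair_bigA pair_bigA /=; apply: eq_bigr => -[[e i] j] _ /=.
  by rewrite uv.
have key : \sum_k per z (D k) * per z' (D k) = 0.
  apply: (@corner_sum0 E (set S) ray_face W) => //; last 2 first.
  - exact: rel.
  - exact: rel.
  - move=> b; have [lb vb] := corner_values_const b.
    by exists (fun=> b), (fun _ _ _ => b).
  - move=> op u w [f [v [lf vf uv]]] [f' [v' [lf' vf' uv']]].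
    have [lo vo] := corner_values_op op lf lf' vf vf'.
    exists (fun x => op (f x) (f' x)), (fun e i j => op (v e i j) (v' e i j)).
    by split => // e i j; rewrite uv uv'.
  - move=> [e j] [e' j'] ne FF; have [f [v [lf vf vJ]]] := two_jumps FF ne.
    exists (fun k => v k.1.1 k.1.2 k.2); first by exists f, v.
    by move=> [e2 j2]; rewrite /ray_jump/= vJ !rays.
  - move=> u [e j] [f [v [lf vf uv]]] H; apply: (no_single_jump lf vf (e := e) (j := j)).
    by move=> e' j'; rewrite rays -H /ray_jump /= !uv.
  - move=> [e j]; have [f [v [lf vf vF]]] := face_values e j.
    exists (fun k => v k.1.1 k.1.2 k.2); first by exists f, v.
    by move=> [[e' i'] j'] /=; rewrite vF.
rewrite -[RHS]key; transitivity (\sum_e \sum_i \sum_j per z (D (e, i, j)) * per z' (D (e, i, j))).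
  apply: eq_bigr => e _; rewrite !big_bool /=.
  have E1 c (cc : cycle1 c) := corner_edge cc (rD (e, true, true)) (rD (e, false, true)) (rphi e).
  have E2 c (cc : cycle1 c) := corner_edge cc (rD (e, true, false)) (rD (e, false, false)) (rphi e).
  have E3 c (cc : cycle1 c) := corner_coedge cc (rD (e, true, true)) (rD (e, true, false)) (rpsi e).
  rewrite -!E1// -!E3//.
  (* With a, b, c the periods at three corners, the fourth is a + b + c and the periods of e and of
     its coedge are a + b and a + c. What remains is (a + b)(a' + c') + (a + c)(a' + b') = aa' + bb'
     + cc' + (a + b + c)(a' + b' + c'). *)
  have E4 c (cc : cycle1 c) : per c (D (e, false, false)) = per c (D (e, true, true)) +
      per c (D (e, false, true)) + per c (D (e, true, false)).
    by rewrite (E1 _ cc) -(E2 _ cc) addrC addrA addF2xx add0r.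
  rewrite !E4//.
  move: (per z _) (per z _) (per z _) (per z' _) (per z' _) (per z' _).
  by move=> [[|[|//]] ?] [[|[|//]] ?] [[|[|//]] ?] [[|[|//]] ?] [[|[|//]] ?] [[|[|//]] ?];
    exact/val_inj.
by rewrite pair_bigA pair_bigA /=; apply: eq_bigr => -[[e i] j].
Qed.

End MapPair.

(** * Isolated vertices *)

(** The outside of a rectangle is covered by four half-planes, consecutive ones meeting at a corner
    point of C. It is used for a punctured box, with a degenerate rectangle, and for the outside of
    a square in the plane. *)
Lemma convex_halves_const (R : realType) (f : R * R -> bool) (C : set (R * R))
    (l1 r1 l2 r2 xl xr yl yr : R) :
  (forall p q t, C p -> C q -> 0 <= t <= 1 -> C (lerp p q t)) ->
  C (xl, yl) -> C (xl, yr) -> C (xr, yl) -> C (xr, yr) ->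
  xl < l1 -> r1 < xr -> yl < l2 -> r2 < yr ->
  (forall q, C q -> [\/ q.1 < l1, r1 < q.1, q.2 < l2 | r2 < q.2] -> locally_const f q) ->
  forall q, C q -> [\/ q.1 < l1, r1 < q.1, q.2 < l2 | r2 < q.2] -> f q = f (xr, yr).
Proof.
move=> cC C1 C2 C3 C4 hl1 hr1 hl2 hr2 lf.
have L p q : C p -> C q -> p.1 < l1 -> q.1 < l1 -> f p = f q.
  move=> Cp Cq p1 q1; apply: lerp_const_plane => t t01; apply: lf; first exact: cC.
  by apply: Or41; rewrite lerp1E; exact: lerp_lt.
have R' p q : C p -> C q -> r1 < p.1 -> r1 < q.1 -> f p = f q.
  move=> Cp Cq p1 q1; apply: lerp_const_plane => t t01; apply: lf; first exact: cC.
  by apply: Or42; rewrite lerp1E; exact: lerp_gt.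
have D p q : C p -> C q -> p.2 < l2 -> q.2 < l2 -> f p = f q.
  move=> Cp Cq p1 q1; apply: lerp_const_plane => t t01; apply: lf; first exact: cC.
  by apply: Or43; rewrite lerp2E; exact: lerp_lt.
have U p q : C p -> C q -> r2 < p.2 -> r2 < q.2 -> f p = f q.
  move=> Cp Cq p1 q1; apply: lerp_const_plane => t t01; apply: lf; first exact: cC.
  by apply: Or44; rewrite lerp2E; exact: lerp_gt.
move=> q Cq [] hq.
- by rewrite (L q (xl, yr))// (U (xl, yr) (xr, yr)).
- exact: R'.
- by rewrite (D q (xr, yl))// (R' (xr, yl) (xr, yr)).
- exact: U.
Qed.

Section IsolatedVertices.
Variables (R : realType) (S : topologicalType) (E : finType) (M : drawing R S E).
Hypothesis surfS : closed_surface R S.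
Hypothesis connS : connected [set: S].
Hypothesis mapM : is_map M.

(* Around an isolated vertex v lies a single face F, whose only end is at v: then F and
   v together form a compact open set. *)
Lemma no_isolated v : vertices M v -> exists e, edge M e v.
Proof.
move=> Vv; apply: contrapT => niso.
have [hS cS charts] := surfS; have [emb cardE cells] := mapM.
have [fV _ _ _ _] := emb.
have near_v : \forall z \near v, points M z -> z = v.
  have H1 : \forall z \near v, forall e, ~ edge M e z.
    apply: (@near_forall_fin _ _ (fun e z => ~ edge M e z)) => e.
    apply: near_not; first exact: edge_closed.
    by move=> ev; apply: niso; exists e.
  have H2 : \forall z \near v, ~ (vertices M `\ v) z.
    apply: near_not; last by move=> [_]; exact.
    by apply: compact_closed => //; apply: finite_compact; exact: finite_setD.
  apply: filterS2 H1 H2 => z nz nV [Vz|[e _ /nz//]].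
  by apply: contrapT => zv; apply: nV.
have [U [h Uh] Uv] := charts v; have [k [ck kh Uk hk kW]] := chart_inv Uh.
have [e e0 eW] := kW _ _ Uv near_v.
(* The closed box C of radius d then lies in the box of radius e, where v is the only point of M. *)
set p := h v in eW; pose d := e / 2.
have d0 : 0 < d by rewrite /d divr_gt0.
have de : d < e by rewrite /d; move: e0 {eW} => e0; lra.
pose N := [set z | U z /\ box p d (h z)].
pose C := k @` [set q | p.1 - d <= q.1 <= p.1 + d /\ p.2 - d <= q.2 <= p.2 + d].
have cC : compact C.
  apply: continuous_compact; first exact: continuous_subspaceT.
  rewrite (_ : [set q | _] = `[p.1 - d, p.1 + d]%classic `*` `[p.2 - d, p.2 + d]%classic).
    by apply: compact_setX; exact: segment_compact.
  by apply/seteqP; split => q; rewrite /= !in_itv.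
have NC : N `<=` C.
  move=> z [Uz [b1 b2]]; exists (h z); last exact: kh.
  by move: b1 b2; rewrite !ltr_distl => /andP[? ?] /andP[? ?]; split; rewrite !ltW.
have oN : open N.
  rewrite openE => z [Uz bz]; rewrite /interior.
  have [d1 d10 d1b] : exists2 d1, 0 < d1 & box (h z) d1 `<=` box p d.
    exists (Num.min (d - `|(h z).1 - p.1|) (d - `|(h z).2 - p.2|)).
      by case: bz => b1 b2; rewrite lt_min !subr_gt0 b1 b2.
    move=> [r1 r2] [/=]; rewrite !lt_min => /andP[c1 _] /andP[_ c2]; split => /=.
      have := ler_distD (h z).1 r1 p.1; move: c1 {bz eW near_v} => c1 c3; lra.
    have := ler_distD (h z).2 r2 p.2; move: c2 {bz eW near_v} => c2 c3; lra.
  by apply: filterS (chart_box Uh Uz d10) => w [Uw bw]; split => //; exact: d1b.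
have Nv : N v by split => //; split; rewrite subrr normr0.
have Cbox z : C z -> U z /\ box p e (h z).
  move=> [q [/andP[q1 q2] /andP[q3 q4]] <-]; rewrite hk; split => //.
  by split; rewrite ltr_distl; apply/andP; split; [move: q1|move: q2|move: q3|move: q4];
    move: de {eW Uh NC cC} => de ?; lra.
pose q0 : R * R := (p.1 + d, p.2 + d).
have bq0 : box p e q0.
  by split; rewrite /= addrAC subrr add0r gtr0_norm.
have nq0 : k q0 <> v.
  move=> /(congr1 h); rewrite hk -/p => q0p; have := congr1 fst q0p; rewrite /q0 /=.
  by move: d0 {q0p} => d0 H; lra.
have [F fF Fq0] : exists2 F, face M F & F (k q0).
  apply: (face_at (M := M)) => /(eW _ bq0); exact: nq0.
(* The punctured box is connected and misses M, so it lies in the single face F. *)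
have Fin z : U z -> box p e (h z) -> z <> v -> F z.
  move=> Uz bz zv.
  have hzp : h z <> p by move=> /(congr1 k); rewrite /p !kh.
  have out (q : R * R) : q <> p -> [\/ q.1 < p.1, p.1 < q.1, q.2 < p.2 | p.2 < q.2].
    move=> qp; have [?|?|E1] := ltgtP q.1 p.1; [exact: Or41|exact: Or42|].
    have [?|?|E2] := ltgtP q.2 p.2; [exact: Or43|exact: Or44|].
    by case: qp; rewrite [q]surjective_pairing [p]surjective_pairing E1 E2.
  have nd : `|- d| < e by rewrite normrN gtr0_norm.
  have pd : `|d| < e by rewrite gtr0_norm.
  have := @convex_halves_const R (fun q => `[< F (k q) >]) (box p e) p.1 p.1 p.2 p.2
    (p.1 - d) (p.1 + d) (p.2 - d) (p.2 + d).
  rewrite -/q0 => /(_ _ _ _ _ _ _ _ _ _ _ (h z) bz (out _ hzp)).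
  rewrite kh// (asboolT Fq0) => H; apply/asboolP; apply: H.
  - by move=> a b t Ca Cb t01; exact: lerp_box.
  - by split; rewrite /= addrAC subrr add0r.
  - by split; rewrite /= addrAC subrr add0r.
  - by split; rewrite /= addrAC subrr add0r.
  - exact: bq0.
  - by rewrite gtrBl.
  - by rewrite ltrDl.
  - by rewrite gtrBl.
  - by rewrite ltrDl.
  - move=> q bq oq; have nM : ~ points M (k q).
      move=> /(eW _ bq) /(congr1 h); rewrite hk -/p => qp; subst q.
      by case: oq; rewrite ltxx.
    have := near_preimage ck (face_lc cells fF nM); exact.
have [hF FhF] := cells _ fF; have [kF [ckF kFh FkF hkF _]] := chart_inv FhF.
have nFv : ~ F v by move=> /(face_sub fF); apply; left.
(* The boundary of the box: compact and inside F, hence bounded in the chart of F. Elsewhere the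
   indicator of N is locally constant. *)
pose K0 := C `\` N.
have cK0 : compact K0.
  have : compact (C `&` ~` N) by apply: compact_closedI => //; exact: open_closedC.
  by [].
have K0F : K0 `<=` F.
  move=> z [Cz nN]; have [Uz bz] := Cbox _ Cz; apply: Fin => // zv; apply: nN.
  by rewrite zv.
have hK0 : compact (hF @` K0).
  apply: continuous_compact => //.
  by have [_ ch _] := FhF; apply: continuous_subspaceW ch.
have [B [_ BK]] := compact_bounded hK0.
pose r := `|B| + 1.
have r0 : 0 < r by rewrite /r ltr_wpDl.
have {}BK z : K0 z -> `|hF z| <= r.
  by move=> Kz; apply: BK; [rewrite (le_lt_trans (ler_norm _))// ltrDl|exists z].
have Cclosed : closed C by exact: compact_closed.
have chiN z : ~ K0 z -> locally_const (fun w => `[< N w >]) z.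
  move=> nK; have [Nz|nN] := pselect (N z).
    by apply: filterS (open_nbhs_nbhs (conj oN Nz)) => w Nw; rewrite !asboolT.
  have nC : ~ C z by move=> Cz; apply: nK.
  apply: filterS (near_not Cclosed nC) => w nw; rewrite !asboolF//.
  by move=> /NC.
pose outer (q : R * R) := [\/ q.1 < - r, r < q.1, q.2 < - r | r < q.2].
have outerK q : outer q -> ~ K0 (kF q).
  move=> oq /BK; rewrite hkF => qr.
  have q1 : `|q.1| <= r by rewrite (le_trans _ qr)// prod_normE le_max lexx.
  have q2 : `|q.2| <= r by rewrite (le_trans _ qr)// prod_normE le_max lexx orbT.
  move: q1 q2; rewrite !ler_norml => /andP[q1 q1'] /andP[q2 q2'].
  by case: oq => H; [move: q1|move: q1'|move: q2|move: q2']; rewrite leNgt H.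
have outer_const q : outer q -> `[< N (kF q) >] = `[< N (kF (r + 1, r + 1)) >].
  move=> oq; apply: (@convex_halves_const R (fun q => `[< N (kF q) >]) setT (- r) r (- r) r
    (- r - 1) (r + 1) (- r - 1) (r + 1)) => //; rewrite ?gtrBl ?ltrDl//.
  by move=> q' _ oq'; exact: (near_preimage ckF (chiN _ (outerK _ oq'))).
pose K1 := kF @` [set q : R * R | - r <= q.1 <= r /\ - r <= q.2 <= r].
have cK1 : compact K1.
  apply: continuous_compact; first exact: continuous_subspaceT.
  rewrite (_ : [set q | _] = `[- r, r]%classic `*` `[- r, r]%classic).
    by apply: compact_setX; exact: segment_compact.
  by apply/seteqP; split => q; rewrite /= !in_itv.
have K1F : K1 `<=` F by move=> _ [q _ <-].
have K1c : closed K1 by exact: compact_closed.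
have inK1 z : F z -> ~ K1 z -> outer (hF z).
  move=> Fz nK; apply: contrapT => no; apply: nK; exists (hF z); last exact: kFh.
  split; apply/andP; split; rewrite leNgt; apply/negP => H; apply: no.
  - exact: Or41.
  - exact: Or42.
  - exact: Or43.
  - exact: Or44.
(* The indicator of N is constant far out in the chart of F, so one point suffices. Points of F
   close to v lie in N and outside the compact [K1], which misses v; they are therefore far out. *)
have allN q : outer q -> N (kF q).
  move=> oq; apply/asboolP; rewrite outer_const//.
  have nK1v : ~ K1 v by move=> /K1F.
  have [e1 e10 e1W] := kW _ _ Uv (filterI (open_nbhs_nbhs (conj oN Nv)) (near_not K1c nK1v)).
  pose q1 : R * R := (p.1 + Num.min (e1 / 2) (e / 2), p.2).
  have m0 : 0 < Num.min (e1 / 2) (e / 2) by rewrite lt_min !divr_gt0.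
  have bq1 : box (h v) e1 q1.
    split; rewrite /= ?subrr ?normr0// addrAC subrr add0r gtr0_norm//.
    by rewrite gt_min; apply/orP; left; move: e10 {e1W} => e10; lra.
  have bq1' : box p e q1.
    split; rewrite /= ?subrr ?normr0// addrAC subrr add0r gtr0_norm//.
    by rewrite gt_min; apply/orP; right; rewrite -/d.
  have [Nq nKq] := e1W _ bq1.
  have Fq : F (k q1).
    apply: Fin => //; first by rewrite hk.
    move=> /(congr1 h); rewrite hk => /(congr1 fst) /eqP.
    by rewrite /= -/p -subr_eq0 addrAC subrr add0r gt_eqF.
  rewrite -(outer_const _ (inK1 _ Fq nKq)) kFh//; exact: asboolT.
(* The far part of F lies in the box around v, so F with v added is the union of two compact
   sets. *)
have FvE : F `|` [set v] = K1 `|` C.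
  apply/seteqP; split => z.
    move=> [Fz|->]; last by right; exact: NC.
    have [K1z|nK1z] := pselect (K1 z); first by left.
    by right; apply: NC; rewrite -(kFh z)//; apply: allN; exact: inK1.
  move=> [/K1F|Cz]; first by left.
  have [->|zv] := pselect (z = v); first by right.
  by left; have [Uz bz] := Cbox _ Cz; exact: Fin.
have Fv_closed : closed (F `|` [set v]) by rewrite FvE; exact: closedU.
have Fv_open : open (F `|` [set v]).
  rewrite (_ : F `|` [set v] = F `|` N); first by apply: openU => //; exact: face_open fF.
  apply/seteqP; split => z; first by move=> [|->]; [left|right].
  move=> [|Nz]; first by left.
  have : (F `|` [set v]) z by rewrite FvE; right; exact: NC.
  by [].
have FvT : F `|` [set v] = setT.
  apply: connS.
  - by exists v; right.
  - by exists (F `|` [set v]) => //; rewrite setTI.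
  - by exists (F `|` [set v]) => //; rewrite setTI.
have /card_gt0P[e1 _] := cardE.
have half01 : 0 < (1 / 2 : R) < 1 by apply/andP; split; lra.
have ox := open_edge_gam M e1 half01.
have : (F `|` [set v]) (gam M e1 (1 / 2)) by rewrite FvT.
case=> [/(face_sub fF)|xv].
  by apply; right; exists e1 => //; exact: open_edge_edge.
by apply: niso; exists e1; rewrite -xv; exact: open_edge_edge.
Qed.

End IsolatedVertices.

(** * The incidence vectors form a totally isotropic subspace *)

(** A nonzero scalar of F_2 is 1, so additivity suffices. A subspace of maximal dimension inside P
    contains all of P, since adjoining a missing element would enlarge it. *)
Lemma subspace_F2 (vT : vectType 'F_2) (P : vT -> Prop) : P 0 ->
  (forall u v, P u -> P v -> P (u + v)) -> exists W : {vspace vT}, forall u, P u <-> u \in W.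
Proof.
move=> P0 PD.
have PZ (a : 'F_2) u : P u -> P (a *: u).
  move=> Pu; have [->|a0] := eqVneq a 0; first by rewrite scale0r.
  rewrite (_ : a = 1) ?scale1r//.
  by move: a a0 => [[|[|//]] i] a0; apply/val_inj.
pose dims n := `[< exists W : {vspace vT}, (forall u, u \in W -> P u) /\ \dim W = n >].
have ex : exists n, dims n.
  exists 0%N; apply/asboolP; exists 0%VS; split; last exact: dimv0.
  by move=> u; rewrite memv0 => /eqP ->.
have bd n : dims n -> (n <= \dim {:vT})%N.
  by move=> /asboolP[W [_ <-]]; apply: dimvS; exact: subvf.
case: (ex_maxnP ex bd) => n /asboolP[W [WP dW]] nmax.
exists W => u; split=> [Pu|]; last exact: WP.
apply: contraT => nW.
have : dims (\dim (W + <[u]>)).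
  apply/asboolP; exists (W + <[u]>)%VS; split => // x /memv_addP[w Ww [x' /vlineP[a ->] ->]].
  by apply: PD; [exact: WP|exact: PZ].
move=> /nmax; rewrite -dW leqNgt => /negP; case.
have sub : (W <= W + <[u]>)%VS by exact: addvSl.
rewrite ltn_neqAle dimvS// andbT; apply/negP => /eqP dE.
have /eqP WE : (W == W + <[u]>)%VS by rewrite eqEdim sub dE leqnn.
by move/negP: nW; apply; rewrite WE memvE addvSr.
Qed.

Lemma sformE (E : finType) (u v : sspace E) :
  sform u v = \sum_e (u (inl e) * v (inr e) + u (inr e) * v (inl e)).
Proof.
rewrite /sform.
have inner f : \sum_g u f * v g * (g == star f)%:R = u f * v (star f).
  rewrite (bigD1 (star f))//= eqxx mulr1 big1 ?addr0// => g /negbTE ->.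
  by rewrite mulr0.
under eq_bigr do rewrite inner.
by rewrite big_sumType/= -big_split.
Qed.

Section InterIndex.
Variables (R : realType) (S : topologicalType) (X A : set S).
Hypothesis oX : open X.
Hypothesis cA : forall x, X x -> ~ A x -> \forall z \near x, ~ A z.
Variable ch : S -> set S * (S -> R * R).
Hypothesis chA : forall x, A x -> straightens (ch x).1 (ch x).2 A /\ (ch x).1 x.
Variable D : S -> S -> bool.
Hypothesis rD : rep D A X (fun x z => `[< A x >] && side ch x z).

(** The class contains a transverse cycle, so [xget] does not return its default, and every crossing
    number it may choose equals the period. *)
Lemma inter_index_period (z : singular R 1 X -> 'F_2) : cycle1 z ->
  inter_index [set z' | cycle1 z' /\ homologous1 z z'] A = period (restrict2 (X := X) D) z.
Proof.
move=> cz; have [z0 [cz0 hz0 tz0]] := transverse_cycle oX cA chA cz.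
have : [set crossings z' A | z' in [set z' | (cycle1 z' /\ homologous1 z z') /\ transverse z' A]]
    (inter_index [set z' | cycle1 z' /\ homologous1 z z'] A).
  by apply: xgetPex; exists (crossings z0 A), z0.
move=> [z' [[cz' hz'] tz'] <-].
rewrite (crossings_period chA rD)//; last by case: cz'.
by apply: period_homologous => //; exact: (restrict2_exact rD).
Qed.

End InterIndex.

(** The origin of the crossing chart lies on both curves, hence is y. In this way the crossing is
    interior to the edge and to the coedge, though it is given as a point of the closed ones. *)
Lemma crossing_point (R : realType) (S : topologicalType) (A B : set S) y :
  A `&` B `<=` [set y] -> cross_at (R := R) A B y -> A y /\ B y.
Proof.
move=> AB [U [h [[Uh UA] Uy UB]]]; have [k [ck kh Uk hk _]] := chart_inv Uh.
have A0 : A (k (0, 0)) by apply/UA => //; rewrite hk.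
have B0 : B (k (0, 0)) by apply/UB => //; rewrite hk.
by have /= <- : [set y] (k (0, 0)) by exact: AB.
Qed.

Theorem mainTheorem6 (R : realType) (S : topologicalType) (E : finType)
    (M M' : drawing R S E)
    (surfS : closed_surface R S) (connS : connected [set: S])
    (mapM : is_map M) (dualM : dual_map M M') :
  exists2 W : {vspace sspace E},
    incidence (M := M) (M' := M') @` H1 R (punctured M M') = [set` W] &
    totally_isotropic W.
Proof.
have [hS _ _] := surfS.
have [embM _ cellM] := mapM.
have [[embM' _ _] dualV faceV crossE disjE] := dualM.
have noiso := no_isolated surfS connS mapM.
have [ch chP] := edge_charts embM; have [ch' chP'] := edge_charts embM'.
have /choice[y yP] : forall e, exists y, edge M e `&` edge M' e = [set y] /\
    cross_at (R := R) (open_edge M e) (open_edge M' e) y.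
  by move=> e; have [y] := crossE e; exists y.
have yAB e : open_edge M e (y e) /\ open_edge M' e (y e).
  have [ye cy] := yP e; apply: crossing_point cy; rewrite -ye => x [Ax Bx].
  by split; exact: open_edge_edge.
have /choice[tt ttP] : forall e, exists t, 0 < t < 1 /\ gam M e t = y e.
  by move=> e; have [/open_edgeP[t ? ?] _] := yAB e; exists t.
have /choice[tt' ttP'] : forall e, exists t, 0 < t < 1 /\ gam M' e t = y e.
  by move=> e; have [_ /open_edgeP[t ? ?]] := yAB e; exists t.
have /choice[su Hsu] : forall e, exists su, exists sv,
    crossing (open_edge M e) (open_edge M' e) (ch e) (ch' e)
      (half M e (tt e)) (half M' e (tt' e)) (y e) su sv.
  move=> e; have [t01 tE] := ttP e; have [t01' tE'] := ttP' e.
  apply: crossing_exists; last 3 first.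
  - by have [] := yP e.
  - by have [] := yAB e.
  - by have [] := yAB e.
  - exact: chP.
  - exact: chP'.
  - by move=> x Ax; rewrite -tE; exact: half_cover.
  - by move=> i j x; exact: half_disj.
  - by move=> i x; exact: half_open.
  - by move=> W i; rewrite -tE; exact: half_near.
  - by move=> x Ax; rewrite -tE'; exact: half_cover.
  - by move=> i j x; exact: half_disj.
  - by move=> i x; exact: half_open.
  - by move=> W i; rewrite -tE'; exact: half_near.
have [sv cr] := choice Hsu.
pose tt01 e := (ttP e).1; pose gamy e := (ttP e).2.
pose tt01' e := (ttP' e).1; pose gamy' e := (ttP' e).2.
pose ycr e := (yP e).1.
have oX : open (punctured M M') by exact: punctured_open.
have farA e := @edge_far R S E M M' hS embM e.
have farB e := @coedge_far R S E M M' hS embM' e.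
have /choice[Dphi rphi] : forall e, exists D, rep D (open_edge M e) (punctured M M')
    (edge_color M ch e) by move=> e; exact: edge_rep.
have /choice[Dpsi rpsi] : forall e, exists D, rep D (open_edge M' e) (punctured M M')
    (coedge_color M' ch' e) by move=> e; exact: coedge_rep.
(* Made of periods, so additive in the cycle, which the choice in [inter_index] does not show. *)
pose iota (z : singular R 1 (punctured M M') -> 'F_2) : sspace E := [ffun f => match f with
  | inl e => per z (Dphi e) | inr e => per z (Dpsi e) end].
have incE z : cycle1 z ->
    incidence (M := M) (M' := M') [set z' | cycle1 z' /\ homologous1 z z'] = iota z.
  move=> cz; apply/ffunP => -[e|e]; rewrite !ffunE /=.
    exact: (inter_index_period oX (farA e) (chP e) (rphi e)).
  exact: (inter_index_period oX (farB e) (chP' e) (rpsi e)).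
pose P u := exists2 z, cycle1 z & u = iota z.
have [||W WP] := @subspace_F2 (sspace E) P.
- exists 0; first exact: cycle10.
  by apply/ffunP => -[e|e]; rewrite !ffunE; apply/esym; exact: pairing0l.
- move=> _ _ [z cz ->] [z' cz' ->]; exists (z + z'); first exact: cycle1D.
  apply/ffunP => -[e|e]; rewrite !ffunE; apply/esym.
    by apply: periodDl; [case: cz|case: cz'].
  by apply: periodDl; [case: cz|case: cz'].
exists W.
  apply/seteqP; split => [u|u /= /WP[z cz ->]].
    by move=> [_ [z cz <-] <-]; apply/WP; exists z => //; exact: incE.
  exists [set z' | cycle1 z' /\ homologous1 z z']; last exact: incE.
  by exists z.
move=> u v /WP[z cz ->] /WP[z' cz' ->]; rewrite sformE.
under eq_bigr do rewrite !ffunE.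
exact: (isotropy hS embM embM' dualV noiso ycr disjE tt01 tt01' gamy gamy' chP chP' cr
  cellM faceV rphi rpsi cz cz').
Qed.
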